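(* Suppose $\Gamma$ is a group of isometries of a locally compact Hadamard space $X$. If $\Gamma$ does not contain any rank one isometry, then the limit set $\Lambda(\Gamma)$ has diameter at most $2\pi$ in the Tits metric.
   Context: A Hadamard space is a (complete) CAT(0) space. $\partial_\infty X$ is the set of asymptote classes of geodesic rays in $X$ with the cone topology. For $\xi,\eta\in\partial_\infty X$, the Tits angle $\angle_T(\xi,\eta)$ is defined by $\sin(\angle_T(\xi,\eta)/2)=\lim_{t\to\infty}d(c_1(t),c_2(t))/(2t)$, where $c_1,c_2$ are the rays from a point $p\in X$ to $\xi,\eta$ (independent of $p$); the Tits metric $d_T$ is the path metric induced by $\angle_T$ (with $d_T=\infty$ between points in different components). An isometry $g$ of $X$ is hyperbolic if there is a geodesic $c:\mathbb R\to X$ (an axis) and $l>0$ with $g(c(t))=c(t+l)$ for all $t$; a hyperbolic isometry is rank one if no axis of it bounds a flat half plane, i.e. no axis is the image of the boundary line under an isometric embedding $\{(x,y)\in\mathbb E^2:y\ge0\}\to X$. The limit set $\Lambda(\Gamma)\subset\partial_\infty X$ is the set of points $\xi$ for which there is a sequence $\gamma_i\in\Gamma$ with $\gamma_i(x)\to\xi$ for some (hence any) $x\in X$. *)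

(* Defs.v *)
From HB Require Import structures.
From mathcomp Require Import all_boot all_order all_algebra.
From mathcomp Require Import all_classical all_reals all_analysis.

Set Implicit Arguments.
Unset Strict Implicit.
Unset Printing Implicit Defensive.

Import Order.TTheory GRing.Theory Num.Theory.
Import numFieldNormedType.Exports.

Local Open Scope classical_set_scope.
Local Open Scope ring_scope.

(* The library norm on [R * R] is the maximum norm, so the Euclidean distance
   of the plane is spelled out. *)
Definition eucl_dist {R : realType} (a b : R * R) : R :=
  Num.sqrt ((a.1 - b.1) ^+ 2 + (a.2 - b.2) ^+ 2).

Definition isometric_on {R : realType} {S T : Type} (dS : S -> S -> R)
    (dT : T -> T -> R) (D : set S) (f : S -> T) : Prop :=
  forall s t, D s -> D t -> dT (f s) (f t) = dS s t.

(* Curves are total functions on R of which only the restriction to the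
   relevant interval is meaningful. *)
Definition geodesic_on {R : realType} {T : Type} (d : T -> T -> R)
    (D : set R) (c : R -> T) : Prop :=
  isometric_on (fun s t => `|s - t|) d D c.

Definition geodesic_segment {R : realType} {T : Type} (d : T -> T -> R)
    (x y : T) (c : R -> T) : Prop :=
  [/\ c 0 = x, c (d x y) = y & geodesic_on d `[0, d x y] c].

Section Hadamard.
Context {R : realType} (X : metricType R).

Let d : X -> X -> R := mdist.

(* A geodesic triangle has vertices [v i] (i : 'I_3) and sides [c i] from
   [v i] to [v (i + 1)], indices modulo 3; [w] and [cb] are the vertices and
   sides of a comparison triangle in the Euclidean plane. *)
Definition CAT0 : Prop :=
  (forall x y, exists c, geodesic_segment d x y c) /\
  forall (v : 'I_3 -> X) (c : 'I_3 -> R -> X)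
         (w : 'I_3 -> R * R) (cb : 'I_3 -> R -> R * R),
    (forall i, geodesic_segment d (v i) (v (ordS i)) (c i)) ->
    (forall i, eucl_dist (w i) (w (ordS i)) = d (v i) (v (ordS i))) ->
    (forall i, geodesic_segment eucl_dist (w i) (w (ordS i)) (cb i)) ->
    forall (i j : 'I_3) (s t : R),
      0 <= s <= d (v i) (v (ordS i)) -> 0 <= t <= d (v j) (v (ordS j)) ->
      d (c i s) (c j t) <= eucl_dist (cb i s) (cb j t).

(* The library's [completeType] would require a distinguished point. *)
Definition complete : Prop :=
  forall F : set_system X, ProperFilter F -> cauchy F -> exists x : X, F --> x.

Definition Hadamard : Prop := complete /\ CAT0.

Definition isometry (g : X -> X) : Prop :=
  bijective g /\ isometric_on d d setT g.

Definition isometry_group (G : set (X -> X)) : Prop :=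
  [/\ forall g, G g -> isometry g,
      G id,
      forall g h, G g -> G h -> G (g \o h) &
      forall g h, G g -> cancel g h -> cancel h g -> G h].

Definition axis (g : X -> X) (c : R -> X) : Prop :=
  geodesic_on d setT c /\ exists2 l : R, 0 < l & forall t, g (c t) = c (t + l).

Definition hyperbolic (g : X -> X) : Prop :=
  isometry g /\ exists c, axis g c.

Definition bounds_flat_half_plane (c : R -> X) : Prop :=
  exists2 F : R * R -> X,
    isometric_on eucl_dist d [set z | 0 <= z.2] F &
    range c = [set F (x, 0) | x in [set: R]].

Definition rank_one (g : X -> X) : Prop :=
  hyperbolic g /\ forall c, axis g c -> ~ bounds_flat_half_plane c.

Definition ray (c : R -> X) : Prop := geodesic_on d `[0, +oo[ c.

Definition asymptotic (c c' : R -> X) : Prop :=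
  exists K : R, forall t, 0 <= t -> d (c t) (c' t) <= K.

Record boundary := Boundary {
  rays_to :> set (R -> X);
  rays_toP : exists2 c, ray c &
    rays_to = [set c' | ray c' /\ asymptotic c c'] }.

(* The traces on X of the basic neighbourhoods
     U(c, r, e) = {y | d(y, c(0)) > r, d(p_r(y), c(r)) < e}
   of xi in the cone topology of the bordification of X, where c runs over the
   rays to xi and p_r(y) is the point at distance r from c(0) on the geodesic
   from c(0) to y. *)
Definition cone_basic_nbhs (u : (R -> X) * R * R) : set X :=
  let: (c, r, e) := u in
  [set y | r < d (c 0) y /\
    exists2 s, geodesic_segment d (c 0) y s & d (s r) (c r) < e].

Definition cone_nbhs (xi : boundary) : set_system X :=
  filter_from [set u | [/\ rays_to xi u.1.1, 0 < u.1.2 & 0 < u.2]]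
    cone_basic_nbhs.

Definition limit_set (G : set (X -> X)) : set boundary :=
  [set xi | exists x : X, exists2 g : nat -> X -> X,
    forall n, G (g n) & g n x @[n --> \oo] --> cone_nbhs xi].

(* [get] picks the element of the set, which is a singleton when X is a
   Hadamard space. *)
Definition tits_angle (xi eta : boundary) : R :=
  get [set a : R | 0 <= a <= pi /\
    forall c1 c2, rays_to xi c1 -> rays_to eta c2 -> c1 0 = c2 0 ->
      d (c1 t) (c2 t) / (2 * t) @[t --> +oo] --> sin (a / 2)].

Definition tits_path (xi eta : boundary) (p : R -> boundary) : Prop :=
  [/\ p 0 = xi, p 1 = eta &
      forall s : R, s \in `[0, 1] ->
        tits_angle (p s) (p t) @[t --> within `[0, 1] (nbhs s)] --> (0 : R)].

(* As in the library's [variation], [s] lists the points of a subdivision of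
   [0, 1] except the first one. *)
Definition tits_length (p : R -> boundary) : \bar R :=
  ereal_sup [set (\sum_(0 <= n < size s)
      tits_angle (p (nth 1 (0 :: s) n)) (p (nth 1 (0 :: s) n.+1)))%:E
    | s in itv_partition 0 1].

(* The infimum of the empty set is +oo. *)
Definition tits_dist (xi eta : boundary) : \bar R :=
  ereal_inf [set tits_length p | p in tits_path xi eta].

Definition tits_diameter (A : set boundary) : \bar R :=
  ereal_sup [set tits_dist z.1 z.2 | z in A `*` A].

End Hadamard.

(* Main.v *)
(* Fix a free ultrafilter on [nat]; limits are taken along it. A pair (xi, xi')
   of points at infinity is a limit pair of G if f n x -> xi and f n^-1 x -> xi'
   for some f n in G. Three facts give the theorem.
   - Two points at infinity are joined by a path of Tits length at most pi or by
     a geodesic line that bounds no flat half plane: the midpoints of the chords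
     of two rays either stay bounded, which gives a line, or tend to a point of
     the boundary that is a midpoint for the Tits angle, and below angle pi the
     chords sweep out a geodesic of the Tits angle.
   - If a line without flat half plane joins xi' to xi for a limit pair
     (xi, xi'), then G contains a rank one isometry: by the flat strip theorem
     geodesics with end points close to xi' and xi pass near a fixed point, and
     f n plays ping-pong for large n. Hence limit pairs are joined within pi.
   - If (xi, xi') and (eta, eta') are limit pairs and a line without flat half
     plane joins xi' to eta, then (xi, eta') is a limit pair.
   So xi is joined to eta within 2 pi, through xi' or through eta'. *)

Require Import Defs.
From mathcomp Require Import all_boot all_order all_algebra.
From mathcomp Require Import all_classical all_reals all_analysis.
From mathcomp Require Import ring lra.

Set Implicit Arguments.
Unset Strict Implicit.
Unset Printing Implicit Defensive.

Import Order.TTheory GRing.Theory Num.Theory.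
Import numFieldNormedType.Exports.

Local Open Scope classical_set_scope.
Local Open Scope ring_scope.

Local Notation mcvgP := metricType_numDomainType.cvgrPdist_lt.

(** Every path is built as a map that is 1-Lipschitz for the Tits angle, so its length is bounded
    without appeal to geodesics of the Tits metric. The ultrafilter replaces subsequences because
    lines, rays and paths at infinity need limits for uncountably many parameters at once; local
    compactness enters only through the convergence of bounded sequences along it. The elements
    [f n] are unrelated to one another, so no axis is given in advance. The absence of a flat half
    plane is therefore made quantitative in [barrier]: for one radius [r], all geodesics between
    suitable neighbourhoods of the two ends meet the same ball. The contrapositive rests on strips:
    strips of unbounded width along a line have a half plane as ultralimit, so some width is
    excluded. With a barrier, a single [f n] of large displacement satisfies the ping-pong
    conditions. Convexity of the displacement function confines a minimising sequence to the ball,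
    and a point of minimal displacement lies on an axis. If an axis bounded a half plane, its
    parallels at heights [0] and [2 * r + 1] would both meet a ball of diameter [2 * r]. *)

Lemma le_sqr {R : realDomainType} (a b : R) : 0 <= a -> a <= b ->
    a ^+ 2 <= b ^+ 2.
Proof. by move=> a0 ab; rewrite ler_sqr ?nnegrE// (le_trans a0). Qed.

Lemma le_of_sqr {R : realDomainType} (a b : R) :
  0 <= b -> a ^+ 2 <= b ^+ 2 -> a <= b.
Proof. by move=> b0 ab; rewrite leNgt; apply/negP => ba; nra. Qed.

(** * CAT(0) inequalities *)

Section EuclideanPlane.
Context {R : realType}.
Implicit Types (P Q : R * R) (s t D : R).

Lemma eucl_dist_sqr P Q :
  eucl_dist P Q ^+ 2 = (P.1 - Q.1) ^+ 2 + (P.2 - Q.2) ^+ 2.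
Proof. by rewrite sqr_sqrtr// addr_ge0 ?sqr_ge0. Qed.

Lemma eucl_dist_ge0 P Q : 0 <= eucl_dist P Q.
Proof. exact: sqrtr_ge0. Qed.

Lemma eucl_dist_eq P Q D :
  0 <= D -> (P.1 - Q.1) ^+ 2 + (P.2 - Q.2) ^+ 2 = D ^+ 2 -> eucl_dist P Q = D.
Proof. by move=> D0 E; rewrite /eucl_dist E sqrtr_sqr ger0_norm. Qed.

Definition eucl_seg P Q s : R * R :=
  (P.1 + s / eucl_dist P Q * (Q.1 - P.1),
    P.2 + s / eucl_dist P Q * (Q.2 - P.2)).

Lemma eucl_segP P Q : geodesic_segment eucl_dist P Q (eucl_seg P Q).
Proof.
case: P Q => [p1 p2] [q1 q2]; rewrite /geodesic_segment /eucl_seg /=.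
have := eucl_dist_sqr (p1, p2) (q1, q2);
  move: (eucl_dist (p1, p2) (q1, q2)) => D /= E.
have [D0|D0] := eqVneq D 0.
  rewrite D0 expr0n/= ?D0 in E *.
  move/esym/eqP: E; rewrite paddr_eq0 ?sqr_ge0// !sqrf_eq0 !subr_eq0.
  move=> /andP[/eqP -> /eqP ->]; split; rewrite ?subrr ?mulr0 ?addr0//.
  move=> s t /=; rewrite !in_itv/= => /andP[s0 s1] /andP[t0 t1].
  have -> : s = 0 by lra.
  have -> : t = 0 by lra.
  by rewrite subrr normr0; apply: eucl_dist_eq => //=; rewrite !subrr; ring.
split.
- by rewrite !mul0r !addr0.
- by rewrite divff// !mul1r !(addrC _ (_ - _)) !subrK.
- move=> s t _ _; apply: eucl_dist_eq => //=; rewrite real_normK ?num_real//.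
  have -> : (s - t) ^+ 2 = ((s - t) / D) ^+ 2 * D ^+ 2 by field.
  by rewrite E; ring.
Qed.

(** The law of cosines gives [a]. Heron's product, whose factors are nonnegative by the triangle
    inequalities, gives room for [b]. *)
Lemma comparison_apex (D e f : R) : 0 <= D -> 0 <= e -> 0 <= f ->
  D <= e + f -> e <= D + f -> f <= D + e ->
  exists a b : R, a ^+ 2 + b ^+ 2 = f ^+ 2 /\ (a - D) ^+ 2 + b ^+ 2 = e ^+ 2.
Proof.
move=> D0 e0 f0 h1 h2 h3; have [E|DN] := eqVneq D 0.
  by exists f, 0; rewrite E (_ : e = f); [split; ring|lra].
have Dgt : 0 < D by lra.
pose a := (D ^+ 2 + f ^+ 2 - e ^+ 2) / (2 * D).
have aE : 2 * D * a = D ^+ 2 + f ^+ 2 - e ^+ 2 by rewrite /a; field.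
have a2 : 0 <= f ^+ 2 - a ^+ 2.
  have h : 0 <= (2 * D * f) ^+ 2 - (2 * D * a) ^+ 2.
    rewrite aE.
    have -> : (2 * D * f) ^+ 2 - (D ^+ 2 + f ^+ 2 - e ^+ 2) ^+ 2 =
      ((e + f - D) * (D + e - f)) * ((D + f - e) * (D + e + f)) by ring.
    by rewrite !mulr_ge0//; lra.
  have {}h : 0 <= (4 * D ^+ 2) * (f ^+ 2 - a ^+ 2).
    by move: h; congr (_ <= _); ring.
  by move: h; rewrite pmulr_rge0//; nra.
exists a, (Num.sqrt (f ^+ 2 - a ^+ 2)); rewrite sqr_sqrtr//.
by split; [ring|nra].
Qed.

End EuclideanPlane.

Section CNInequality.
Context {R : realType} {X : metricType R}.
Local Notation d := (@mdist R X).
Hypothesis cat0 : CAT0 X.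

(** The weighted inequality of Bruhat and Tits; its right side is Stewart's formula in the
    comparison triangle. *)
Lemma geodesic_CN (p q z : X) (c : R -> X) (l : R) :
  geodesic_segment d p q c -> 0 <= l <= 1 ->
  d z (c (l * d p q)) ^+ 2 <=
    (1 - l) * d z p ^+ 2 + l * d z q ^+ 2 - l * (1 - l) * d p q ^+ 2.
Proof.
case: cat0 => seg cmp cP /andP[l0 l1].
have [c1 c1P] := seg q z; have [c2 c2P] := seg z p.
have [a [b [ab1 ab2]]] := @comparison_apex R (d p q) (d q z) (d z p)
  (mdist_ge0 _ _) (mdist_ge0 _ _) (mdist_ge0 _ _)
  ltac:(have := metric_triangle p z q;
    rewrite (metric_sym p z) (metric_sym z q); lra)
  ltac:(have := metric_triangle q p z;
    rewrite (metric_sym q p) (metric_sym p z); lra)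
  ltac:(have := metric_triangle z q p;
    rewrite (metric_sym z q) (metric_sym q p); lra).
pose v (i : 'I_3) := nth p [:: p; q; z] i.
pose g (i : 'I_3) := nth c [:: c; c1; c2] i.
pose w (i : 'I_3) : R * R := nth (0, 0) [:: (0, 0); (d p q, 0); (a, b)] i.
have wP : forall i, eucl_dist (w i) (w (ordS i)) = d (v i) (v (ordS i)).
  case=> [[|[|[|//]]] ?]; apply: eucl_dist_eq; rewrite ?mdist_ge0//= /v/=; nra.
have gP : forall i, geodesic_segment d (v i) (v (ordS i)) (g i).
  by case=> [[|[|[|//]]] ?].
(* Side 0 runs from [p] to [q] and side 2 from [z] to [p], so parameter 0 on side 2 is the vertex
   [z]. *)
have := cmp v g w (fun i => eucl_seg (w i) (w (ordS i))) gP wP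
  (fun i => eucl_segP _ _) (@Ordinal 3 0 isT) (@Ordinal 3 2 isT) (l * d p q) 0.
rewrite /v/g/=.
have D0 := mdist_ge0 p q.
move=> /(_ ltac:(apply/andP; split; nra) ltac:(by rewrite lexx mdist_ge0)).
case: c2P => -> _ _; rewrite metric_sym.
move=> H; apply: (le_trans (le_sqr (mdist_ge0 _ _) H)).
rewrite eucl_dist_sqr /eucl_seg/=.
rewrite (_ : eucl_dist _ _ = d p q); last by apply: eucl_dist_eq => //=; ring.
have [E|DN] := eqVneq (d p q) 0.
  rewrite E !mulr0 !mul0r in ab2 *.
  rewrite -(metric_sym z q) -ab1 in ab2 *; nra.
rewrite mulfK// (metric_sym z q); nra.
Qed.

End CNInequality.

Section Mix.
Context {R : realType} {X : metricType R}.
Local Notation d := (@mdist R X).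
Hypothesis cat0 : CAT0 X.

(** Characterised by its two distances instead of a chosen geodesic, so that isometries and changes
    of parameter are handled by uniqueness alone. *)
Definition mix (p q : X) (l : R) : X :=
  xget p [set m | d p m = l * d p q /\ d m q = (1 - l) * d p q].

Let mix_ex (p q : X) (l : R) : 0 <= l <= 1 ->
  exists m, [/\ d p m = l * d p q, d m q = (1 - l) * d p q &
    forall z, d z m ^+ 2 <=
      (1 - l) * d z p ^+ 2 + l * d z q ^+ 2 - l * (1 - l) * d p q ^+ 2].
Proof.
move=> l01; have [c cP] := cat0.1 p q; exists (c (l * d p q)).
have D0 := mdist_ge0 p q; case/andP: (l01) => l0 l1.
have [c0 c1 ci] := cP.
have h0 : 0 <= l * d p q by rewrite mulr_ge0.
have h1 : l * d p q <= d p q by nra.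
split; last by move=> z; exact: geodesic_CN.
- rewrite -{1}c0 ci/= ?in_itv/= ?lexx ?h0 ?h1 ?D0//.
  by rewrite sub0r normrN ger0_norm.
- rewrite -{2}c1 ci/= ?in_itv/= ?lexx ?h0 ?h1 ?D0//.
  by rewrite ler0_norm; [ring|lra].
Qed.

Lemma mixP (p q : X) (l : R) : 0 <= l <= 1 ->
  d p (mix p q l) = l * d p q /\ d (mix p q l) q = (1 - l) * d p q.
Proof. by move=> /(mix_ex p q)[m [h1 h2 _]];
  exact: (@xgetI X p [set m | _ /\ _] m (conj h1 h2)). Qed.

(** At a point with the prescribed distances the right side of the CN inequality vanishes. *)
Lemma mix_uniq (p q m : X) (l : R) : 0 <= l <= 1 ->
  d p m = l * d p q -> d m q = (1 - l) * d p q -> m = mix p q l.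
Proof.
move=> l01; have [m0 [_ _ h]] := mix_ex p q l01.
suff uniq m' : d p m' = l * d p q -> d m' q = (1 - l) * d p q -> m' = m0.
  by move=> h1 h2; case: (mixP p q l01) => /uniq/[apply] ->; exact: uniq.
move=> h1 h2; apply: mdist_positivity.
have := h m'; rewrite (metric_sym m' p) h1 h2 => h3.
have h4 : d m' m0 ^+ 2 <= 0 by nra.
by apply/eqP; rewrite -sqrf_eq0 eq_le h4 sqr_ge0.
Qed.

Lemma mix_CN (p q z : X) (l : R) : 0 <= l <= 1 ->
  d z (mix p q l) ^+ 2 <=
    (1 - l) * d z p ^+ 2 + l * d z q ^+ 2 - l * (1 - l) * d p q ^+ 2.
Proof. by move=> l01; have [m [h1 h2 h]] := mix_ex p q l01;
  rewrite -(mix_uniq l01 h1 h2). Qed.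

Lemma mixC (p q : X) (l : R) : 0 <= l <= 1 -> mix p q l = mix q p (1 - l).
Proof.
move=> l01; have [h1 h2] := mixP p q l01; apply: mix_uniq; first lra.
- by rewrite metric_sym h2 (metric_sym q p).
- by rewrite metric_sym h1 (metric_sym q p); ring.
Qed.

Lemma mix0 (p q : X) : mix p q 0 = p.
Proof. by symmetry; apply: mix_uniq; rewrite ?lexx ?ler01// ?mdistxx; ring. Qed.

Lemma mix1 (p q : X) : mix p q 1 = q.
Proof. by symmetry; apply: mix_uniq; rewrite ?lexx ?ler01// ?mdistxx; ring. Qed.

Lemma mixxx (p : X) (l : R) : 0 <= l <= 1 -> mix p p l = p.
Proof. by move=> l01; symmetry; apply: mix_uniq; rewrite ?mdistxx//; ring. Qed.

Lemma mix_dist (p q : X) (l k : R) : 0 <= l <= 1 -> 0 <= k <= 1 ->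
  d (mix p q l) (mix p q k) = `|l - k| * d p q.
Proof.
move=> l01 k01; have [l1 l2] := mixP p q l01; have [k1 k2] := mixP p q k01.
have D0 := mdist_ge0 p q.
apply/le_anti/andP; split.
  apply: le_of_sqr; first by rewrite mulr_ge0.
  have := mix_CN p q (mix p q l) k01; rewrite (metric_sym _ p) l1 l2.
  by rewrite [(`|_| * _) ^+ 2]exprMn real_normK ?num_real//; lra.
have t1 := metric_triangle p (mix p q l) (mix p q k).
have t2 := metric_triangle p (mix p q k) (mix p q l).
rewrite (metric_sym (mix p q k)) in t2; rewrite l1 k1 in t1 t2.
by case: (ler0P (l - k)) => _; nra.
Qed.

(** CN at [mix p q' l] over the base from [p] to [q], then at [q] over the base from [p] to [q'],
    combine to the intercept theorem as an inequality. *)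
Lemma mix_le_r (p q q' : X) (l : R) : 0 <= l <= 1 ->
  d (mix p q l) (mix p q' l) <= l * d q q'.
Proof.
move=> l01; case/andP: (l01) => l0 l1.
have [h1 h2] := mixP p q' l01.
apply: le_of_sqr; first by rewrite mulr_ge0 ?mdist_ge0.
have A := mix_CN p q (mix p q' l) l01.
have B := mix_CN p q' q l01.
rewrite (metric_sym (mix p q l)).
rewrite (metric_sym _ p) h1 (metric_sym _ q) in A.
rewrite (metric_sym q p) in B.
have {}B : l * d q (mix p q' l) ^+ 2 <= l * ((1 - l) * d p q ^+ 2 + l * d q q'
  ^+ 2 -
    l * (1 - l) * d p q' ^+ 2) by rewrite ler_wpM2l.
by nra.
Qed.

(** The diagonal from [p] to [q'] splits the quadrilateral into two triangles. *)
Lemma mix_convex (p q p' q' : X) (l : R) : 0 <= l <= 1 ->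
  d (mix p q l) (mix p' q' l) <= (1 - l) * d p p' + l * d q q'.
Proof.
move=> l01; have l01' : 0 <= 1 - l <= 1 by lra.
apply: le_trans (metric_triangle _ (mix p q' l) _) _.
rewrite addrC lerD ?mix_le_r// (mixC p) // (mixC p')//.
by apply: (le_trans (mix_le_r _ _ _ l01')).
Qed.

Lemma mix_isom (g : X -> X) (p q : X) (l : R) :
  (forall x y, d (g x) (g y) = d x y) -> 0 <= l <= 1 ->
  g (mix p q l) = mix (g p) (g q) l.
Proof. by move=> gi l01; have [h1 h2] := mixP p q l01; apply: mix_uniq;
  rewrite // !gi. Qed.

(** CN from [x2] and from [x4] to the midpoint of [x1] and [x3], together with
    [(u + v) ^+ 2 <= 2 * u ^+ 2 + 2 * v ^+ 2]. *)
Lemma quadrilateral (x1 x2 x3 x4 : X) :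
  d x1 x3 ^+ 2 + d x2 x4 ^+ 2 <=
    d x1 x2 ^+ 2 + d x2 x3 ^+ 2 + d x3 x4 ^+ 2 + d x4 x1 ^+ 2.
Proof.
have h : 0 <= (2^-1 : R) <= 1 by lra.
have A := mix_CN x1 x3 x2 h; have B := mix_CN x1 x3 x4 h.
have T := metric_triangle x2 (mix x1 x3 2^-1) x4.
have := le_sqr (mdist_ge0 _ _) T.
rewrite (metric_sym _ x4) (metric_sym x1 x2) (metric_sym x3 x4).
move: A B; move: (d x2 (mix _ _ _)) (d x4 (mix _ _ _)) => u v A B C.
have := sqr_ge0 (u - v); nra.
Qed.

(** The unit speed parametrisation. If [d p q > 0] and [r] lies outside [[0, d p q]], no point
    qualifies and the value is the default [p]. *)
Definition pt (p q : X) (r : R) : X := mix p q (r / d p q).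

Let frac (r D : R) : 0 <= r <= D -> 0 <= r / D <= 1 /\ r / D * D = r.
Proof.
move=> /andP[r0 rD]; have [D0|D0] := eqVneq D 0.
  by rewrite D0 invr0 mulr0 lexx ler01; split => //; lra.
have Dp : 0 < D by lra.
by rewrite divr_ge0 ?ler_pdivrMr ?mul1r ?divfK//; lra.
Qed.

Lemma ptP (p q : X) (r : R) : 0 <= r <= d p q ->
  d p (pt p q r) = r /\ d (pt p q r) q = d p q - r.
Proof.
move=> /frac[h1 h2]; have [-> ->] := mixP p q h1; split => //.
by rewrite mulrBl mul1r h2.
Qed.

Lemma pt_uniq (p q m : X) (r : R) : 0 <= r <= d p q ->
  d p m = r -> d m q = d p q - r -> m = pt p q r.
Proof.
move=> /frac[h1 h2] h3 h4; apply: mix_uniq; rewrite ?h3 ?h4 ?h2//.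
by rewrite mulrBl mul1r h2.
Qed.

Lemma pt_dist (p q : X) (r r' : R) : 0 <= r <= d p q -> 0 <= r' <= d p q ->
  d (pt p q r) (pt p q r') = `|r - r'|.
Proof.
move=> /frac[h1 h2] /frac[h1' h2']; rewrite mix_dist// -mulrBl normrM normfV.
rewrite (ger0_norm (mdist_ge0 _ _)); have [D0|D0] := eqVneq (d p q) 0.
  by rewrite -h2 -h2' D0 !mulr0 subrr normr0.
by rewrite divfK.
Qed.

Lemma pt0 (p q : X) : pt p q 0 = p.
Proof. by rewrite /pt mul0r mix0. Qed.

Lemma pt_end (p q : X) : pt p q (d p q) = q.
Proof. by symmetry; apply: pt_uniq; rewrite ?lexx ?mdist_ge0// mdistxx subrr.
  Qed.

Lemma pt_pt (p q : X) (r r' : R) : 0 <= r' <= r -> r <= d p q ->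
  pt p (pt p q r) r' = pt p q r'.
Proof.
move=> h1 h2; have hr : 0 <= r <= d p q by lra.
have hr' : 0 <= r' <= d p q by lra.
have [e1 e2] := ptP hr; have [e1' e2'] := ptP hr'.
symmetry; apply: pt_uniq => //; rewrite e1// pt_dist//.
by rewrite ler0_norm; lra.
Qed.

Lemma pt_mix (p q : X) (l r : R) : 0 <= l <= 1 -> 0 <= r <= l * d p q ->
  pt p (mix p q l) r = pt p q r.
Proof.
move=> l01 h; have [e1 e2] := mixP p q l01; have D0 := mdist_ge0 p q.
suff -> : mix p q l = pt p q (l * d p q) by rewrite pt_pt//; nra.
by apply: pt_uniq => //; [nra|lra].
Qed.

Lemma pt_geod (c : R -> X) (b r : R) : 0 <= r <= b ->
  (forall s t, 0 <= s <= b -> 0 <= t <= b -> d (c s) (c t) = `|s - t|) ->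
  pt (c 0) (c b) r = c r.
Proof.
move=> h ci.
have Db : d (c 0) (c b) = b by rewrite ci; [rewrite sub0r normrN ger0_norm;
  lra|lra|lra].
symmetry; apply: pt_uniq; rewrite ?Db//.
- by rewrite ci ?lexx//; [rewrite sub0r normrN ger0_norm; lra|lra].
- by rewrite ci ?lexx ?andbT//; [rewrite ler0_norm; lra|lra].
Qed.

Lemma mix_geod (c : R -> X) (a b l : R) : 0 <= l <= 1 -> a <= b ->
  (forall s t, a <= s <= b -> a <= t <= b -> d (c s) (c t) = `|s - t|) ->
  mix (c a) (c b) l = c ((1 - l) * a + l * b).
Proof.
move=> l01 ab ci; symmetry.
have ha : a <= a <= b by lra.
have hb : a <= b <= b by lra.
have hm : a <= (1 - l) * a + l * b <= b by nra.
apply: mix_uniq => //; rewrite !ci//.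
- have -> : a - ((1 - l) * a + l * b) = l * (a - b) by ring.
  by rewrite normrM ger0_norm//; lra.
- have -> : (1 - l) * a + l * b - b = (1 - l) * (a - b) by ring.
  by rewrite normrM ger0_norm//; lra.
Qed.

(** Points at equal fractions are within [d p p'] by convexity; passing from equal fraction to equal
    distance costs another [d p p']. *)
Lemma pt_origin (p p' q : X) (r : R) : 0 <= r <= d p q -> r <= d p' q ->
  d (pt p q r) (pt p' q r) <= 2 * d p p'.
Proof.
move=> h1 h2; have P0 := mdist_ge0 p p'.
have h1' : 0 <= r <= d p' q by lra.
have [f1 f2] := frac h1; have [g1 g2] := frac h1'.
apply: le_trans (metric_triangle _ (mix p' q (r / d p q)) _) _.
have A := mix_convex p q p' q f1; rewrite mdistxx mulr0 addr0 in A.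
have B := mix_dist p' q f1 g1.
rewrite -[X in _ = _ * X](ger0_norm (mdist_ge0 _ _)) -normrM mulrBl g2 in B.
have T1 := metric_triangle p p' q; have T2 := metric_triangle p' p q.
rewrite (metric_sym p' p) in T2.
rewrite -/(pt p q r) -/(pt p' q r) in A B.
have C : `|r / d p q * d p' q - r| <= d p p'.
  have -> : r / d p q * d p' q - r = r / d p q * (d p' q - d p q)
    by rewrite mulrBr f2.
  rewrite normrM ger0_norm; last by lra.
  have : `|d p' q - d p q| <= d p p' by rewrite ler_norml; lra.
  have := normr_ge0 (d p' q - d p q); nra.
by nra.
Qed.

(** Cutting the longer geodesic to the length of the shorter one at most doubles the distance of the
    ends, and the contraction towards [x] does the rest. Far away points at bounded distance are
    thus seen from [x] in nearly the same direction. *)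
Lemma pt_near (x u v : X) (T M : R) : 0 <= T <= M -> 0 < M ->
  M <= d x u -> M <= d x v -> d (pt x u T) (pt x v T) <= 2 * T * d u v / M.
Proof.
have aux u' v' : 0 <= T <= M -> 0 < M -> M <= d x u' -> d x u' <= d x v' ->
    d (pt x u' T) (pt x v' T) <= 2 * T * d u' v' / M.
  move=> TM M0 Mu uv; pose r := d x u'.
  have hr : 0 <= r <= d x v' by rewrite /r; lra.
  have [e1 e2] := ptP hr.
  rewrite -(@pt_pt x v' r T)//; last by rewrite /r; lra.
  rewrite {2}/pt e1 /pt -/r.
  have f : 0 <= T / r <= 1.
    by rewrite divr_ge0 ?ler_pdivrMr ?mul1r /r//; lra.
  apply: le_trans (mix_le_r _ _ _ f) _.
  have A : d u' (pt x v' r) <= 2 * d u' v'.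
    have := metric_triangle u' v' (pt x v' r);
      rewrite (metric_sym v' (pt _ _ _)) e2.
    have := metric_triangle x u' v'; rewrite /r; lra.
  have B : T / r <= T / M.
    by rewrite ler_wpM2l ?lef_pV2 ?posrE//; rewrite /r; lra.
  have -> : 2 * T * d u' v' / M = T / M * (2 * d u' v') by ring.
  apply: ler_pM => //; [lra|exact: mdist_ge0].
move=> TM M0 Mu Mv; case: (leP (d x u) (d x v)) => uv; first exact: aux.
by rewrite metric_sym (metric_sym u); apply: aux => //; exact: ltW.
Qed.

End Mix.


Lemma ultra_fmap {S T : Type} (f : S -> T) (F : set_system S) :
  UltraFilter F -> UltraFilter (f @ F).
Proof.
move=> UF; split => [|G PG FG]; first exact: fmap_proper_filter.
apply/seteqP; split => [A GA|]; last exact: FG.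
have [//|FnA] := in_ultra_setVsetC (f @^-1` A) UF.
have /(filterI GA) : G (~` A) by apply: FG; rewrite /fmap/= preimage_setC.
by rewrite setICr => /filter_not_empty.
Qed.

(** * Closed balls are compact; ultralimits *)

Section HopfRinow.
Context {R : realType} {X : metricType R}.
Local Notation d := (@mdist R X).
Hypothesis lcX : locally_compact [set: X].
Hypothesis hadX : Hadamard X.

Let cat0 : CAT0 X := hadX.2.

Let cball (p : X) (r : R) : set X := [set x | d p x <= r].

Let cball_closed (p x : X) (r : R) (F : set_system X) :
  ProperFilter F -> F (cball p r) -> F --> x -> cball p r x.
Proof.
move=> PF FK Fx; rewrite /cball/= leNgt; apply/negP => h.
have h' : 0 < d p x - r by lra.
have /metricType_numDomainType.fcvgrPdist_lt/(_ _ h') Fb := Fx.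
have [y [y1 y2]] := filter_ex (filterI FK Fb).
have := metric_triangle p y x; rewrite (metric_sym y x);
  rewrite /cball/= in y1 y2; lra.
Qed.

(** The radial retraction onto a ball transports an ultrafilter from a slightly larger ball to one
    already known to be precompact. *)
Let shrink (p : X) (r : R) (x : X) : X := pt p x (Num.min r (d p x)).

Let shrinkP (p x : X) (r e : R) : 0 <= r -> 0 <= e -> d p x <= r + e ->
  d p (shrink p r x) <= r /\ d (shrink p r x) x <= e.
Proof.
move=> r0 e0 h; have D0 := mdist_ge0 p x.
have hm : 0 <= Num.min r (d p x) <= d p x.
  by rewrite le_min r0 D0 ge_min lexx orbT.
have [-> ->] := ptP cat0 hm; rewrite ge_min lexx/=; split => //.
by case: (leP r (d p x)); lra.
Qed.

Let precomp (p : X) (r : R) : Prop :=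
  forall F : set_system X, UltraFilter F -> F (cball p r) ->
    exists x : X, F --> x.

(** Retracting to radius [r0 - e / 3] moves points by at most [e / 3], and the image converges;
    hence the ultrafilter is Cauchy and completeness applies. *)
Let precomp_limit (p : X) (r0 : R) : 0 <= r0 ->
  (forall r, r < r0 -> precomp p r) -> precomp p r0.
Proof.
move=> r00 Pr F UF FK; apply: hadX.1.
apply: cauchy_exP => e e0.
have [re|re] := ltP r0 e.
  exists p; apply: filterS FK => x; rewrite /cball/= => h.
  by rewrite ballEmdist/=; lra.
pose r := r0 - e / 3; have r_ge0 : 0 <= r by rewrite /r; lra.
have [z zP] : exists z : X, (shrink p r @ F) --> z.
  apply: (Pr r); first by rewrite /r; lra.
    exact: ultra_fmap.
  apply: (@filterS _ F _ (cball p r0) (shrink p r @^-1` cball p r) _ FK) => x.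
  rewrite /cball/= => h.
  by have [] := @shrinkP p x r (e / 3) r_ge0 ltac:(lra) ltac:(rewrite /r; lra).
exists z; have e3 : 0 < e / 3 by lra.
have /mcvgP/(_ _ e3) := zP; apply: filterS2 FK => x.
rewrite /cball/= ballEmdist/= => h1 h2.
have [_ h3] := @shrinkP p x r (e / 3) r_ge0 ltac:(lra) ltac:(rewrite /r; lra).
by have := metric_triangle z (shrink p r x) x; lra.
Qed.

Let precomp_compact (p : X) (r : R) : precomp p r -> compact (cball p r).
Proof.
rewrite compact_ultra => Pr F UF FK; have [x Fx] := Pr F UF FK.
by exists x; split => //; exact: cball_closed FK Fx.
Qed.

(** Compactness of the ball makes the radius in local compactness uniform. *)
Let precomp_extend (p : X) (r : R) : 0 <= r -> precomp p r ->
  exists2 e, 0 < e & precomp p (r + e).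
Proof.
move=> r0 Pr; have /precomp_compact/compact_near_coveringP nc := Pr.
pose Q (e : R) (z : X) := forall F : set_system X,
  UltraFilter F -> F [set x | d z x < e] -> exists x : X, F --> x.
have /nc : forall x, cball p r x -> \forall x' \near x & e \near 0^'+, Q e x'.
  move=> x _; have [V Vx [cV _]] := @lcX x I.
  have {}Vx : nbhs x V.
    by apply: (@filterS _ (nbhs x) _ [set y | [set: X] y -> V y]) => [y h|];
      [exact: h|exact: Vx].
  rewrite -metricType_numDomainType.filter_from_mdist_nbhs in Vx;
    case: Vx => eta/= eta0 etaV.
  exists ([set y | d x y < eta / 2], [set e : R | e < eta / 2]) => /=.
    split; last by apply: nbhs_right_lt; lra.
    by rewrite -metricType_numDomainType.filter_from_mdist_nbhs;
      exists (eta / 2) => //=; lra.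
  move=> [y e] [/= xy eeta] F UF Fy.
  move: cV; rewrite compact_ultra => /(_ F UF) [].
    apply: filterS Fy => z /= yz; apply: etaV => /=.
    by have := metric_triangle x y z; lra.
  by move=> z [_ Fz]; exists z.
move=> [e /= e0 eQ].
have {}eQ : forall z, cball p r z -> Q (e / 2) z.
  by apply: eQ; [rewrite /= sub0r normrN gtr0_norm; lra|lra].
(* The retraction costs [e / 4] and the approach to its limit another [e / 4], within the radius
   [e / 2] of [eQ]. *)
exists (e / 4); first lra.
move=> F UF FK.
have Fs : (shrink p r @ F) (cball p r).
  apply: (@filterS _ F _ (cball p (r + e / 4)) (shrink p r @^-1` cball p r) _
    FK) => x.
  rewrite /cball/= => h.
  by have [] := @shrinkP p x r (e / 4) r0 ltac:(lra) h.
have US := ultra_fmap (shrink p r) UF.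
have [z zP] := Pr _ US Fs.
apply: (eQ z (cball_closed _ Fs zP)).
have e4 : 0 < e / 4 by lra.
have /mcvgP/(_ _ e4) := zP; apply: filterS2 FK => x.
rewrite /cball/= => h1 h2.
have [_ h3] := @shrinkP p x r (e / 4) r0 ltac:(lra) h1.
by have := metric_triangle z (shrink p r x) x; lra.
Qed.

(** The Hopf-Rinow theorem: a finite supremum of the good radii would be good by completeness, yet
    could be exceeded by local compactness. *)
Lemma closed_ball_precompact (p : X) (r : R) (F : set_system X) :
  UltraFilter F -> F [set x | d p x <= r] -> exists x : X, F --> x.
Proof.
suff : forall r, precomp p r by move=> h; exact: (h r F).
move=> {r F} r; apply: contrapT => nPr.
have down a b : a <= b -> precomp p b -> precomp p a.
  move=> ab Pb F UF FK; apply: Pb => //.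
  by apply: filterS FK => x; rewrite /cball/=; lra.
have P0 : precomp p 0.
  move=> F UF FK; exists p; apply/metricType_numDomainType.fcvgrPdist_lt =>
    e e0.
  by apply: filterS FK => x; rewrite /cball/=; lra.
pose S := [set s | precomp p s].
have hS : has_sup S.
  split; first by exists 0.
  exists r => s Ps; rewrite leNgt; apply/negP => rs.
  by apply: nPr; apply: down Ps; exact: ltW.
have s0 : 0 <= sup S by apply: ub_le_sup => //; exact: hS.2.
have Ps : precomp p (sup S).
  apply: precomp_limit => // t tS.
  have [u Su tu] := sup_adherent (ltac:(lra) : 0 < sup S - t) hS.
  by apply: down Su; lra.
have [e e0 Pe] := precomp_extend s0 Ps.
have : sup S + e <= sup S by apply: ub_le_sup => //; exact: hS.2.
by lra.
Qed.

End HopfRinow.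

(** * Limits of bounded sequences along the ultrafilter *)

Section Ultralimit.
Context {R : realType} {X : metricType R}.
Local Notation d := (@mdist R X).
Hypothesis lcX : locally_compact [set: X].
Hypothesis hadX : Hadamard X.
Context {U : set_system nat} {UU : UltraFilter U}.

Lemma ulim_ex (p : X) (K : R) (y : nat -> X) :
  (\forall n \near U, d p (y n) <= K) -> exists l : X, y n @[n --> U] --> l.
Proof.
by move=> h; apply: (@closed_ball_precompact _ _ lcX hadX p K);
  [exact: ultra_fmap|exact: h].
Qed.

Lemma ulim_real_ex (K : R) (a : nat -> R) :
  (\forall n \near U, `|a n| <= K) -> exists l : R, a n @[n --> U] --> l.
Proof.
move=> h; have := @segment_compact R (- K) K; rewrite compact_ultra.
have UFa := ultra_fmap a UU.
move=> /(_ _ UFa)[|l [_ ?]]; last by exists l.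
by apply: filterS h => n; rewrite /= in_itv/= -ler_norml.
Qed.

Lemma cvg_mdist (y z : nat -> X) (l m : X) :
  y n @[n --> U] --> l -> z n @[n --> U] --> m ->
  d (y n) (z n) @[n --> U] --> d l m.
Proof.
move=> /mcvgP yl /mcvgP zm; apply/cvgrPdist_lt => e e0.
have e2 : 0 < e / 2 by lra.
apply: filterS2 (yl _ e2) (zm _ e2) => n h1 h2.
have T1 := metric_triangle l (y n) m; have T2 := metric_triangle (y n) (z n) m.
have T3 := metric_triangle (y n) l (z n); have T4 := metric_triangle l m (z n).
rewrite (metric_sym (z n) m) (metric_sym (y n) l) in T2 T3.
by rewrite ltr_norml; lra.
Qed.

Lemma ulim_unique (y : nat -> X) (l m : X) :
  y n @[n --> U] --> l -> y n @[n --> U] --> m -> l = m.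
Proof. by apply: cvg_unique; exact: metric_hausdorff. Qed.

Lemma ulim_le (y z : nat -> X) (l m : X) (a : nat -> R) (b : R) :
  y n @[n --> U] --> l -> z n @[n --> U] --> m -> a n @[n --> U] --> b ->
  (\forall n \near U, d (y n) (z n) <= a n) -> d l m <= b.
Proof. by move=> yl zm ab h; apply: ler_cvg_to (cvg_mdist yl zm) ab h. Qed.

Lemma ulim_ge (y z : nat -> X) (l m : X) (a : nat -> R) (b : R) :
  y n @[n --> U] --> l -> z n @[n --> U] --> m -> a n @[n --> U] --> b ->
  (\forall n \near U, a n <= d (y n) (z n)) -> b <= d l m.
Proof. by move=> yl zm ab h; apply: ler_cvg_to ab (cvg_mdist yl zm) h. Qed.

Lemma ulim_eq (y z : nat -> X) (l m : X) (b : R) :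
  y n @[n --> U] --> l -> z n @[n --> U] --> m ->
  (\forall n \near U, d (y n) (z n) = b) -> d l m = b.
Proof.
move=> yl zm h; apply/le_anti/andP; split.
  by apply: (ulim_le yl zm (cvg_cst b)); apply: filterS h => n ->.
by apply: (ulim_ge yl zm (cvg_cst b)); apply: filterS h => n ->.
Qed.

End Ultralimit.

(** * Rays and points at infinity *)

(* [lra] fails on hypotheses that are equations between points of a metric
   space. *)
Ltac clear_points := repeat match goal with
  | H : @eq (Metric.sort _) _ _ |- _ => clear H end.
Ltac mlra := clear_points; lra.
Ltac mnra := clear_points; nra.

Section Rays.
Context {R : realType} {X : metricType R}.
Local Notation d := (@mdist R X).
Hypothesis cat0 : CAT0 X.

Lemma ray_dist (c : R -> X) (s t : R) :
  ray c -> 0 <= s -> 0 <= t -> d (c s) (c t) = `|s - t|.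
Proof. by move=> cr s0 t0; apply: cr; rewrite /= in_itv/= ?s0 ?t0. Qed.

Lemma ray_dist0 (c : R -> X) (t : R) : ray c -> 0 <= t -> d (c 0) (c t) = t.
Proof. by move=> cr t0; rewrite ray_dist// sub0r normrN ger0_norm. Qed.

Lemma pt_ray (c : R -> X) (b r : R) : ray c -> 0 <= r <= b ->
  pt (c 0) (c b) r = c r.
Proof.
by move=> cr h; apply: (pt_geod cat0 h) => s t hs ht; apply: ray_dist => //;
  lra.
Qed.

Lemma ray_convex (c c' : R -> X) (a b l : R) : ray c -> ray c' ->
  0 <= a <= b -> 0 <= l <= 1 ->
  d (c ((1 - l) * a + l * b)) (c' ((1 - l) * a + l * b)) <=
  (1 - l) * d (c a) (c' a) + l * d (c b) (c' b).
Proof.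
move=> cr cr' ab l01.
have h : a <= b by lra.
rewrite -(mix_geod cat0 l01 h); last by move=> s t hs ht;
  apply: ray_dist => //; lra.
rewrite -(mix_geod cat0 l01 h); last by move=> s t hs ht;
  apply: ray_dist => //; lra.
exact: mix_convex.
Qed.

Lemma asymptotic_refl (c : R -> X) : asymptotic c c.
Proof. by exists 0 => t _; rewrite mdistxx. Qed.

Lemma asymptotic_sym (c c' : R -> X) : asymptotic c c' -> asymptotic c' c.
Proof. by move=> [K h]; exists K => t t0; rewrite metric_sym h. Qed.

Lemma asymptotic_trans (c2 c1 c3 : R -> X) :
  asymptotic c1 c2 -> asymptotic c2 c3 -> asymptotic c1 c3.
Proof.
move=> [K h] [K' h']; exists (K + K') => t t0.
exact: le_trans (metric_triangle _ (c2 t) _) (lerD (h t t0) (h' t t0)).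
Qed.

(** The distance is convex, bounded and zero at the start; a positive value would force linear
    growth. *)
Lemma asymptotic_eq (c c' : R -> X) (t : R) : ray c -> ray c' ->
  c 0 = c' 0 -> asymptotic c c' -> 0 <= t -> c t = c' t.
Proof.
move=> cr cr' c0 [K h] t0; apply: mdist_positivity; apply/eqP.
rewrite eq_le mdist_ge0 andbT leNgt; apply/negP => D0.
set D := d _ _ in D0.
have K0 : 0 <= K by exact: le_trans (mdist_ge0 _ _) (h 0 (lexx 0)).
(* Chosen so that [u * D > t * K], while convexity on [[0, u]] gives [u * D <= t * K]. *)
pose u := t + (t * K + 1) / D.
have uD : u * D = t * D + t * K + 1 by rewrite /u mulrDl divfK ?addrA// gt_eqF.
have u0 : 0 < u.
  have : 0 < (t * K + 1) / D by rewrite divr_gt0//; nra.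
  by rewrite /u; lra.
have tu : t <= u.
  have : 0 <= (t * K + 1) / D by rewrite divr_ge0//; [nra|lra].
  by rewrite /u; lra.
have l01 : 0 <= t / u <= 1 by rewrite divr_ge0 ?ler_pdivrMr ?mul1r//; lra.
have := @ray_convex c c' 0 u (t / u) cr cr' ltac:(lra) l01.
rewrite mulr0 add0r divfK ?gt_eqF// c0 mdistxx mulr0 add0r -/D.
have := h u (ltW u0) => hu h1.
have h2 : D <= t / u * K by apply: le_trans h1 _; rewrite ler_wpM2l//; lra.
have h3 : D * u <= t * K.
  have := ler_wpM2r (ltW u0) h2.
  by rewrite mulrAC divfK// gt_eqF.
by mnra.
Qed.

Lemma boundaryP (xi : boundary X) (c c' : R -> X) :
  rays_to xi c -> rays_to xi c' <-> ray c' /\ asymptotic c c'.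
Proof.
case: (rays_toP xi) => c0 c0r E; rewrite E /= => -[cr c0c]; split.
  move=> [c'r c0c']; split => //.
  by apply: asymptotic_trans c0c'; exact: asymptotic_sym.
by move=> [c'r cc']; split => //; apply: asymptotic_trans cc'.
Qed.

Lemma boundary_ray (xi : boundary X) (c : R -> X) : rays_to xi c -> ray c.
Proof. by move=> xc; have [] := (boundaryP c xc).1 xc. Qed.

Lemma boundary_asymptotic (xi : boundary X) (c c' : R -> X) :
  rays_to xi c -> rays_to xi c' -> asymptotic c c'.
Proof. by move=> xc xc'; have [] := (boundaryP c' xc).1 xc'. Qed.

Lemma boundary_eq (xi eta : boundary X) (c : R -> X) :
  rays_to xi c -> rays_to eta c -> xi = eta.
Proof.
move=> xc ec; have : rays_to xi = rays_to eta.
  by apply/seteqP; split => c' /=; rewrite (boundaryP c' xc) (boundaryP c' ec).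
case: xi {xc} => A pA; case: eta {ec} => B pB /= E.
by subst B; congr Boundary; exact: Prop_irrelevance.
Qed.

Lemma boundary_ex (xi : boundary X) : exists c, rays_to xi c.
Proof.
by have [c cr ->] := rays_toP xi; exists c; split => //; exact: asymptotic_refl.
Qed.

Definition end_of (c : R -> X) (cr : ray c) : boundary X :=
  @Boundary R X [set c' | ray c' /\ asymptotic c c']
    (ex_intro2 _ _ c cr erefl).

Lemma end_ofP (c : R -> X) (cr : ray c) : rays_to (end_of cr) c.
Proof. by split => //; exact: asymptotic_refl. Qed.

End Rays.

(** * Convergence to points at infinity along the ultrafilter *)

Section Directions.
Context {R : realType} {X : metricType R}.
Local Notation d := (@mdist R X).
Hypothesis lcX : locally_compact [set: X].
Hypothesis hadX : Hadamard X.
Context {U : set_system nat} {UU : UltraFilter U}.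
Hypothesis Ufree : \oo `<=` U.

Let cat0 : CAT0 X := hadX.2.

Definition diverges (p : X) (y : nat -> X) : Prop :=
  forall K, \forall n \near U, K <= d p (y n).

(** Convergence to the end of [rho] in the cone topology seen from [p], as pointwise convergence of
    the geodesics from [p]. *)
Definition dlim (p : X) (y : nat -> X) (rho : R -> X) : Prop :=
  [/\ ray rho, rho 0 = p, diverges p y &
      forall r, 0 <= r -> pt p (y n) r @[n --> U] --> rho r].

Lemma free_infty (K : R) : \forall n \near U, K <= n%:R.
Proof. by apply: Ufree; exact: nbhs_infty_ger. Qed.

Lemma diverges_close (p q : X) (y z : nat -> X) (K : R) : diverges p y ->
  (\forall n \near U, d (y n) (z n) <= K) -> diverges q z.
Proof.
move=> h hK L; apply: filterS2 (h (L + d p q + K)) hK => n h1 h2.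
have := metric_triangle p q (y n); have := metric_triangle q (z n) (y n).
by rewrite (metric_sym (z n)); lra.
Qed.

Lemma dlim_ex (p : X) (y : nat -> X) : diverges p y -> exists rho, dlim p y rho.
Proof.
move=> dv.
have /choice[rho rhoP] : forall r, exists l : X,
    0 <= r -> pt p (y n) r @[n --> U] --> l.
  move=> r; have [r0|r0] := leP 0 r; last by exists p; lra.
  have [l lP] : exists l : X, pt p (y n) r @[n --> U] --> l.
    apply: (ulim_ex lcX hadX (p := p) (K := r)).
    apply: filterS (dv r) => n h; have [|-> //] := @ptP _ _ cat0 p (y n) r.
    by rewrite r0 h.
  by exists l.
exists rho; split=> //.
  move=> s t /=; rewrite !in_itv/= !andbT => s0 t0.
  apply: (ulim_eq (rhoP s s0) (rhoP t t0)).
  apply: filterS2 (dv s) (dv t) => n h1 h2.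
  by rewrite (pt_dist cat0)// ?s0 ?t0.
apply: (ulim_unique (rhoP 0 (lexx 0))).
rewrite (_ : (fun n => pt p (y n) 0) = (fun=> p)); first exact: cvg_cst.
by apply/funext => n; rewrite (pt0 cat0).
Qed.

Lemma dlim_asymptotic (p q : X) (y : nat -> X) (rho rho' : R -> X) :
  dlim p y rho -> dlim q y rho' -> asymptotic rho rho'.
Proof.
move=> [_ _ dv h] [_ _ dv' h']; exists (2 * d p q) => t t0.
apply: (ulim_le (h t t0) (h' t t0) (cvg_cst (2 * d p q))).
apply: filterS2 (dv t) (dv' t) => n h1 h2.
by apply: (pt_origin cat0); rewrite ?t0.
Qed.

Lemma dlim_close (p : X) (y z : nat -> X) (rho : R -> X) (K : R) :
  dlim p y rho -> (\forall n \near U, d (y n) (z n) <= K) -> dlim p z rho.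
Proof.
move=> [rr r0 dv h] hK; have dvz := diverges_close p dv hK.
have [rho' [rr' r0' _ h']] := dlim_ex dvz.
split => // r rge; suff -> : rho r = rho' r by exact: h'.
have [K0|K0] := ltP K 0.
  have [n hn] := filter_ex hK; exfalso; have := mdist_ge0 (y n) (z n); lra.
apply: mdist_positivity; apply/le_anti; rewrite mdist_ge0 andbT.
apply/ler_addgt0Pl => e e0; rewrite addr0.
apply: (ulim_le (h r rge) (h' r rge) (cvg_cst e)).
(* Beyond distance [M] the bound [2 * r * K / M] of [pt_near] is at most [e]. *)
pose M := r + 1 + 2 * r * K / e.
have M1 : r + 1 <= M by rewrite /M lerDl divr_ge0 ?mulr_ge0//; lra.
have Me : 2 * r * K <= e * M.
  have -> : e * M = e * (r + 1) + 2 * r * K by rewrite /M; field;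
    rewrite gt_eqF.
  by nra.
have M0 : 0 < M by lra.
apply: filterS3 (dv M) (dvz M) hK => n h1 h2 h3.
apply: le_trans (pt_near cat0 (M := M) _ _ h1 h2) _ => //; first lra.
rewrite ler_pdivrMr//; apply: le_trans Me.
by rewrite ler_wpM2l//; lra.
Qed.

Definition tends (y : nat -> X) (xi : boundary X) : Prop :=
  exists p rho, dlim p y rho /\ rays_to xi rho.

Lemma tends_base (y : nat -> X) (xi : boundary X) (p : X) :
  tends y xi -> exists2 rho, dlim p y rho & rays_to xi rho.
Proof.
move=> [q [rho [rhoP xr]]]; have [_ _ dv _] := rhoP.
have dvp : diverges p y.
  by apply: (diverges_close p (K := 0) dv); apply: nearW => n; rewrite mdistxx.
have [rho' rhoP'] := dlim_ex dvp; exists rho' => //.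
apply/(boundaryP rho' xr); split; first by case: rhoP'.
exact: dlim_asymptotic rhoP rhoP'.
Qed.

Lemma tends_ray (y : nat -> X) (xi : boundary X) (c : R -> X) :
  tends y xi -> rays_to xi c -> dlim (c 0) y c.
Proof.
move=> yx xc; have [rho [rr r0 dv h] xr] := tends_base (c 0) yx.
split => //; first exact: boundary_ray xc.
move=> r rge; rewrite (@asymptotic_eq _ _ cat0 c rho r)//; first exact: h.
- exact: boundary_ray xc.
- exact: boundary_asymptotic xc xr.
Qed.

Lemma tends_unique (y : nat -> X) (xi eta : boundary X) :
  tends y xi -> tends y eta -> xi = eta.
Proof.
move=> [p [rho [rhoP xr]]] /(tends_base p)[rho' rhoP' xr'].
apply: (boundary_eq (c := rho')) => //.
apply/(boundaryP rho' xr); split; first by case: rhoP'.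
exact: dlim_asymptotic rhoP rhoP'.
Qed.

Lemma tends_ex (p : X) (y : nat -> X) : diverges p y -> exists xi, tends y xi.
Proof.
move=> /dlim_ex[rho rhoP]; have rr : ray rho by case: rhoP.
by exists (end_of rr), p, rho; split => //; exact: end_ofP.
Qed.

Lemma tends_close (y z : nat -> X) (xi : boundary X) (K : R) :
  tends y xi -> (\forall n \near U, d (y n) (z n) <= K) -> tends z xi.
Proof.
move=> [p [rho [rhoP xr]]] h; exists p, rho; split => //.
exact: dlim_close rhoP h.
Qed.

Lemma dlim_ray (c : R -> X) : ray c -> dlim (c 0) (fun n => c n%:R) c.
Proof.
move=> cr; split => // [K|r r0].
  by apply: filterS (free_infty K) => n; rewrite ray_dist0.
apply: (@cvg_trans _ (c r @[n --> U])); last exact: cvg_cst.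
apply: near_eq_cvg; apply: filterS (free_infty r) => n h.
by rewrite pt_ray// r0 h.
Qed.

Lemma ray_from (p : X) (xi : boundary X) : exists2 c, rays_to xi c & c 0 = p.
Proof.
have [c0 xc0] := boundary_ex xi.
have : tends (fun n => c0 n%:R) xi.
  by exists (c0 0), c0; split => //; exact: dlim_ray (boundary_ray xc0).
by move=> /(tends_base p)[rho [_ r0 _ _] xr]; exists rho.
Qed.

(** The points [w n] have the limit of [y n], and up to their distance from [p] the geodesics from
    [p] to [w n] and to [z n] coincide. *)
Lemma tends_through (p : X) (y z w : nat -> X) (xi : boundary X) (K : R) :
  tends y xi ->
  (\forall n \near U, d (y n) (w n) <= K /\
     exists2 l, 0 <= l <= 1 & w n = mix p (z n) l) ->
  tends z xi.
Proof.
move=> yx h.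
have wx : tends w xi.
  by apply: (tends_close (K := K) yx); apply: filterS h => n [].
have [rho [rr r0 dv hr] xr] := tends_base p wx.
exists p, rho; split => //.
have lz : \forall n \near U, exists2 l, 0 <= l <= 1 & w n = mix p (z n) l.
  by apply: filterS h => n [].
split => // [L|r rge].
  apply: filterS2 (dv L) lz => n h1 [l l01 E]; move: h1; rewrite E.
  by have [-> _] := mixP cat0 p (z n) l01; have := mdist_ge0 p (z n); nra.
apply: cvg_trans (hr r rge); apply: near_eq_cvg.
apply: filterS2 (dv r) lz => n h1 [l l01 E]; move: h1; rewrite E.
have [-> _] := mixP cat0 p (z n) l01 => h1.
by rewrite (pt_mix cat0)// rge h1.
Qed.

(** Freeness of [U] turns convergence at infinity in the index into convergence along [U]; the
    segment in a cone neighbourhood is the one given by [pt]. *)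
Lemma limit_set_tends (G : set (X -> X)) (xi : boundary X) : limit_set G xi ->
  exists x, exists2 g : nat -> X -> X, forall n, G (g n) & tends (g^~ x) xi.
Proof.
move=> [x [g gG gx]]; exists x, g => //.
have [c xc] := boundary_ex xi.
exists (c 0), c; split => //.
have key r e : 0 < r -> 0 < e ->
    \forall n \near U, r < d (c 0) (g n x) /\ d (pt (c 0) (g n x) r) (c r) < e.
  move=> r0 e0.
  have : cone_nbhs xi (cone_basic_nbhs (c, r, e)) by exists (c, r, e).
  move=> /gx/Ufree; apply: filterS => n /= [h1 [s [s0 s1 sg] h2]]; split => //.
  rewrite (_ : pt _ _ _ = s r)//; symmetry; apply: (pt_uniq cat0); first lra.
    rewrite -{1}s0 sg /= ?in_itv/= ?lexx ?mdist_ge0//; last lra.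
    by rewrite sub0r normrN gtr0_norm.
  rewrite -{1}s1 sg /= ?in_itv/= ?lexx ?mdist_ge0//; last lra.
  by rewrite ler0_norm; lra.
split => // [|K|r]; first exact: boundary_ray xc.
  have := key (`|K| + 1) 1 ltac:(have := normr_ge0 K; lra) ltr01.
  by apply: filterS => n [h _]; have := ler_norm K; lra.
rewrite le_eqVlt => /predU1P[<-|r0].
  rewrite (_ : (fun n => _) = (fun=> c 0)); first exact: cvg_cst.
  by apply/funext => n; rewrite (pt0 cat0).
apply/mcvgP => e e0.
by apply: filterS (key r e r0 e0) => n [_]; rewrite metric_sym.
Qed.

End Directions.

(** * The Tits angle *)

Section Trigonometry.
Context {R : realType}.
Implicit Types a b x : R.

Lemma cos_half a : cos a = 1 - 2 * sin (a / 2) ^+ 2.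
Proof.
have -> : a = (a / 2) *+ 2 by rewrite mulr2n; lra.
by rewrite cos_mulr2n cos2sin2 (_ : (a / 2) *+ 2 / 2 = a / 2);
  [ring|rewrite mulr2n; lra].
Qed.

Lemma sin_half_le a b : 0 <= a <= pi -> 0 <= b <= pi ->
  sin (a / 2) <= sin (b / 2) -> a <= b.
Proof.
move=> ha hb h; rewrite leNgt; apply/negP => ab.
have : sin (b / 2) < sin (a / 2).
  by rewrite ltr_sin ?in_itv/=; [lra|apply/andP; split; lra|apply/andP; split;
    lra].
by lra.
Qed.

Lemma sin_half_ge0 a : 0 <= a <= pi -> 0 <= sin (a / 2).
Proof. by move=> h; apply: sin_ge0_pi; lra. Qed.

Lemma half_angle_ex x : 0 <= x <= 1 ->
    exists2 a, 0 <= a <= pi & sin (a / 2) = x.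
Proof.
move=> hx; have h1 : -1 <= x <= 1 by lra.
exists (2 * asin x); last first.
  by rewrite mulrAC divff ?mul1r ?asinK ?in_itv//=; lra.
have := asin_lepi2 h1 => h2; suff : 0 <= asin x by lra.
rewrite leNgt; apply/negP => h3.
have : sin (asin x) < sin 0.
  have := @pi_gt0 R; have := asin_geNpi2 h1 => h4 h5.
  by rewrite ltr_sin ?in_itv/=; [lra|apply/andP; split; lra|apply/andP; split;
    lra].
by rewrite asinK ?in_itv//= sin0; lra.
Qed.

End Trigonometry.

Lemma eq_leW {R : realDomainType} (x y : R) : x = y -> x <= y.
Proof. by move=> ->. Qed.

Section Comparison.
Context {R : realType} {X : metricType R}.
Local Notation d := (@mdist R X).
Hypothesis cat0 : CAT0 X.

(** The law of cosines with the comparison angle at [p] of the whole triangle: comparison angles do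
    not grow when the sides are shortened. *)
Lemma mix_comparison (p q q' : X) (l k : R) : 0 <= l <= 1 -> 0 <= k <= 1 ->
  d (mix p q l) (mix p q' k) ^+ 2 <= l ^+ 2 * d p q ^+ 2 + k ^+ 2 * d p q' ^+ 2
    -
    l * k * (d p q ^+ 2 + d p q' ^+ 2 - d q q' ^+ 2).
Proof.
move=> l01 k01; case/andP: (l01) => l0 _.
have A := mix_CN cat0 p q (mix p q' k) l01.
have B := mix_CN cat0 p q' q k01.
have [h1 _] := mixP cat0 p q' k01.
rewrite (metric_sym (mix p q l)).
rewrite (metric_sym _ p) h1 (metric_sym _ q) in A.
rewrite (metric_sym q p) in B.
have {}B := ler_wpM2l l0 B.
by nra.
Qed.

Lemma pt_comparison (p q q' : X) (r r' : R) :
  0 <= r <= d p q -> 0 <= r' <= d p q' -> 0 < d p q -> 0 < d p q' ->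
  d (pt p q r) (pt p q' r') ^+ 2 <= r ^+ 2 + r' ^+ 2 -
    r * r' * ((d p q ^+ 2 + d p q' ^+ 2 - d q q' ^+ 2) / (d p q * d p q')).
Proof.
move=> hr hr' D0 D0'; apply: le_trans (mix_comparison _ _ _ _ _) _.
- by rewrite divr_ge0 ?ler_pdivrMr ?mul1r//; lra.
- by rewrite divr_ge0 ?ler_pdivrMr ?mul1r//; lra.
by apply: eq_leW; field; rewrite !gt_eqF.
Qed.

End Comparison.

Section TitsAngle.
Context {R : realType} {X : metricType R}.
Local Notation d := (@mdist R X).
Hypothesis lcX : locally_compact [set: X].
Hypothesis hadX : Hadamard X.
Context {U : set_system nat} {UU : UltraFilter U}.
Hypothesis Ufree : \oo `<=` U.

Let cat0 : CAT0 X := hadX.2.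

Let slope_mono (c1 c2 : R -> X) (s t : R) : ray c1 -> ray c2 -> c1 0 = c2 0 ->
  0 < s <= t -> d (c1 s) (c2 s) / (2 * s) <= d (c1 t) (c2 t) / (2 * t).
Proof.
move=> r1 r2 c0 st; have t0 : 0 < t by lra.
have l01 : 0 <= s / t <= 1 by rewrite divr_ge0 ?ler_pdivrMr ?mul1r//; mlra.
have := @ray_convex _ _ cat0 c1 c2 0 t (s / t) r1 r2 ltac:(mlra) l01.
rewrite mulr0 add0r divfK ?gt_eqF// c0 mdistxx mulr0 add0r => h.
rewrite ler_pdivrMr; last mlra.
apply: le_trans h _; apply: eq_leW; field.
by rewrite gt_eqF.
Qed.

Let slope_le1 (c1 c2 : R -> X) (t : R) : ray c1 -> ray c2 -> c1 0 = c2 0 ->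
  0 < t -> 0 <= d (c1 t) (c2 t) / (2 * t) <= 1.
Proof.
move=> r1 r2 c0 t0; rewrite divr_ge0 ?mdist_ge0//=; last mlra.
rewrite ler_pdivrMr ?mul1r; last mlra.
have := metric_triangle (c1 t) (c1 0) (c2 t).
rewrite {2}c0 (metric_sym _ (c1 0)) !ray_dist0//; mlra.
Qed.

Let slope_cvg (c1 c2 : R -> X) : ray c1 -> ray c2 -> c1 0 = c2 0 ->
  exists S : R, [/\ 0 <= S <= 1, forall t, 0 < t ->
    d (c1 t) (c2 t) / (2 * t) <= S &
    d (c1 t) (c2 t) / (2 * t) @[t --> +oo] --> S].
Proof.
move=> r1 r2 c0; pose g t := d (c1 t) (c2 t) / (2 * t).
pose A := [set g t | t in [set t | 0 < t]].
have hA : has_sup A.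
  split; first by exists (g 1), 1 => /=.
  by exists 1 => _ [t /= t0 <-]; case/andP: (slope_le1 r1 r2 c0 t0).
have ub t : 0 < t -> g t <= sup A by move=> t0; apply: ub_le_sup;
  [exact: hA.2|exists t].
exists (sup A); split => //.
  have h1 := ub 1 ltr01; case/andP: (slope_le1 r1 r2 c0 (@ltr01 R)) => h2 _.
  apply/andP; split; first exact: le_trans h2 h1.
  by apply: ge_sup => //; [exact: hA.1|move=> _ [t /= t0 <-];
    case/andP: (slope_le1 r1 r2 c0 t0)].
apply/cvgrPdist_lt => e e0.
have [_ [t0 /= t00 <-] ht0] := sup_adherent e0 hA.
have : \forall t \near +oo, t0 <= t by apply: nbhs_pinfty_ge; rewrite num_real.
apply: filterS => t tt0; have := slope_mono r1 r2 c0 (introT andP (conj t00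
  tt0)).
have := ub t (lt_le_trans t00 tt0); rewrite /g => h1 h2.
by rewrite ger0_norm; rewrite /g in ht0; mlra.
Qed.

Let slope_asymptotic (c1 c2 c1' c2' : R -> X) (S : R) :
  asymptotic c1 c1' -> asymptotic c2 c2' ->
  d (c1 t) (c2 t) / (2 * t) @[t --> +oo] --> S ->
  d (c1' t) (c2' t) / (2 * t) @[t --> +oo] --> S.
Proof.
move=> [K hK] [K' hK'] /cvgrPdist_lt h; apply/cvgrPdist_lt => e e0.
have e2 : 0 < e / 2 by lra.
have h3 : \forall t \near (+oo : set_system R),
  Num.max 1 ((K + K') / e + 1) <= t.
  by apply: nbhs_pinfty_ge; rewrite num_real.
apply: filterS2 (h _ e2) h3 => t h1; rewrite ge_max => /andP[t1 tK].
have t0 : 0 <= t by lra.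
have T1 := metric_triangle (c1' t) (c1 t) (c2' t).
have T2 := metric_triangle (c1 t) (c2 t) (c2' t).
have T3 := metric_triangle (c1 t) (c1' t) (c2 t).
have T4 := metric_triangle (c1' t) (c2' t) (c2 t).
rewrite (metric_sym (c1' t) (c1 t)) in T1;
  rewrite (metric_sym (c2' t) (c2 t)) in T4.
have := hK t t0; have := hK' t t0 => H1 H2.
have N : `|d (c1 t) (c2 t) / (2 * t) - d (c1' t) (c2' t) / (2 * t)| <= (K + K')
  / (2 * t).
  rewrite -mulrBl normrM [`|_^-1|]ger0_norm ?invr_ge0; last lra.
  rewrite ler_wpM2r ?invr_ge0 ?ler_norml; [by []|lra|].
  by apply/andP; split; lra.
have M : (K + K') / (2 * t) < e / 2.
  rewrite ltr_pdivrMr; last lra.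
  have E : e * ((K + K') / e + 1) = K + K' + e by field; rewrite gt_eqF.
  have : e * ((K + K') / e + 1) <= e * t by rewrite ler_wpM2l// ltW.
  by rewrite E; lra.
have := ler_normD (S - d (c1 t) (c2 t) / (2 * t)) (d (c1 t) (c2 t) / (2 * t) -
  d (c1' t) (c2' t) / (2 * t)).
by rewrite addrA subrK; lra.
Qed.

(** The limit of the slopes exists by monotonicity, is unchanged within asymptote classes, and lies
    in [[0, 1]]; so the set under [get] is inhabited. *)
Lemma tits_angleP (xi eta : boundary X) : 0 <= tits_angle xi eta <= pi /\
  forall c1 c2, rays_to xi c1 -> rays_to eta c2 -> c1 0 = c2 0 ->
    d (c1 t) (c2 t) / (2 * t) @[t --> +oo] --> sin (tits_angle xi eta / 2).
Proof.
apply: (@getPex _ [set a : R | 0 <= a <= pi /\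
    forall c1 c2, rays_to xi c1 -> rays_to eta c2 -> c1 0 = c2 0 ->
      d (c1 t) (c2 t) / (2 * t) @[t --> +oo] --> sin (a / 2)]).
have [c xc] := boundary_ex xi.
have [c' ec' c0'] := ray_from lcX hadX Ufree (c 0) eta.
have [S [S01 _ cvS]] := slope_cvg (boundary_ray xc) (boundary_ray ec') (esym
  c0').
have [a a01 aS] := half_angle_ex S01; exists a; split => // c1 c2 xc1 ec2 _.
rewrite aS; apply: slope_asymptotic cvS.
- exact: boundary_asymptotic xc xc1.
- exact: boundary_asymptotic ec' ec2.
Qed.

Lemma tits_angle_ge0 (xi eta : boundary X) : 0 <= tits_angle xi eta.
Proof. by case: (tits_angleP xi eta) => /andP[]. Qed.

Lemma tits_angle_lepi (xi eta : boundary X) : tits_angle xi eta <= pi.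
Proof. by case: (tits_angleP xi eta) => /andP[]. Qed.

Let slope_angle (xi eta : boundary X) (c1 c2 : R -> X) (t : R) :
  rays_to xi c1 -> rays_to eta c2 -> c1 0 = c2 0 -> 0 < t ->
  d (c1 t) (c2 t) / (2 * t) <= sin (tits_angle xi eta / 2).
Proof.
move=> xc1 ec2 c0 t0.
have [S [S01 ub cvS]] := slope_cvg (boundary_ray xc1) (boundary_ray ec2) c0.
have cv := (tits_angleP xi eta).2 c1 c2 xc1 ec2 c0.
by rewrite -(@cvg_unique _ (@norm_hausdorff _ R) _ _ _ _ cvS cv); exact: ub.
Qed.

(** The comparison angle at the common origin increases to the Tits angle, so the latter gives an
    upper bound in the law of cosines, also for unequal sides. *)
Lemma tits_angle_upper (xi eta : boundary X) (c1 c2 : R -> X) (s t : R) :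
  rays_to xi c1 -> rays_to eta c2 -> c1 0 = c2 0 -> 0 <= s -> 0 <= t ->
  d (c1 s) (c2 t) ^+ 2 <= s ^+ 2 + t ^+ 2 - 2 * s * t * cos (tits_angle xi eta).
Proof.
move=> xc1 ec2 c0 s0 t0.
have r1 := boundary_ray xc1; have r2 := boundary_ray ec2.
(* A common parameter beyond both [s] and [t], positive even when these vanish. *)
pose u := s + t + 1; have u0 : 0 < u by rewrite /u; mlra.
have l01 : 0 <= s / u <= 1 by rewrite divr_ge0 ?ler_pdivrMr ?mul1r// /u; mlra.
have k01 : 0 <= t / u <= 1 by rewrite divr_ge0 ?ler_pdivrMr ?mul1r// /u; mlra.
have h := slope_angle xc1 ec2 c0 u0.
rewrite ler_pdivrMr in h; last mlra.
have := mix_comparison cat0 (c1 0) (c1 u) (c2 u) l01 k01.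
have -> : mix (c1 0) (c1 u) (s / u) = c1 s.
  by rewrite -(@pt_ray _ _ cat0 c1 u s)// ?/pt ?ray_dist0// /u; mlra.
have -> : mix (c1 0) (c2 u) (t / u) = c2 t.
  by rewrite c0 -(@pt_ray _ _ cat0 c2 u t)// ?/pt ?ray_dist0// /u; mlra.
rewrite {2 4}c0 !ray_dist0 ?(ltW u0)// => H; apply: le_trans H _.
have h2 := le_sqr (mdist_ge0 _ _) h.
have E1 : (s / u) ^+ 2 * u ^+ 2 = s ^+ 2 by field; rewrite gt_eqF.
have E2 : (t / u) ^+ 2 * u ^+ 2 = t ^+ 2 by field; rewrite gt_eqF.
rewrite E1 E2 lerD2l lerN2 cos_half.
set S := sin _ in h h2 *.
have -> : 2 * s * t * (1 - 2 * S ^+ 2) = s / u * (t / u) * (u ^+ 2 + u ^+ 2 -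
  (S * (2 * u)) ^+ 2).
  by field; rewrite gt_eqF.
apply: ler_wpM2l; first by apply: mulr_ge0; [case/andP: l01|case/andP: k01].
by rewrite lerD2l lerN2.
Qed.

Lemma tits_angle_le (xi eta : boundary X) (c1 c2 : R -> X) (a : R) :
  rays_to xi c1 -> rays_to eta c2 -> c1 0 = c2 0 -> 0 <= a <= pi ->
  (forall t, 0 < t -> d (c1 t) (c2 t) ^+ 2 <= 2 * t ^+ 2 * (1 - cos a)) ->
  tits_angle xi eta <= a.
Proof.
move=> xc1 ec2 c0 ha h.
have [A cv] := tits_angleP xi eta.
apply: sin_half_le => //.
have {}cv := cv c1 c2 xc1 ec2 c0.
apply: (ler_cvg_to cv (cvg_cst (sin (a / 2)))).
have : \forall t \near +oo, 1 <= t :> R by apply: nbhs_pinfty_ge;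
  rewrite num_real.
apply: filterS => t t1; have t0 : 0 < t by mlra.
rewrite ler_pdivrMr; last mlra.
apply: le_of_sqr; first by rewrite mulr_ge0 ?sin_half_ge0//; mlra.
by apply: le_trans (h t t0) _; rewrite cos_half; clear_points; nra.
Qed.

Lemma tits_angle_sym (xi eta : boundary X) : tits_angle xi eta = tits_angle eta
    xi.
Proof.
have aux (x y : boundary X) : tits_angle x y <= tits_angle y x.
  have [c xc] := boundary_ex x.
  have [c' ec' c0'] := ray_from lcX hadX Ufree (c 0) y.
  apply: (tits_angle_le xc ec' (esym c0')); first by case: (tits_angleP y x).
  move=> t t0; rewrite metric_sym.
  have := tits_angle_upper ec' xc c0' (ltW t0) (ltW t0); mlra.
by apply/le_anti; rewrite !aux.
Qed.

Lemma tits_angle_refl (xi : boundary X) : tits_angle xi xi = 0.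
Proof.
have [c xc] := boundary_ex xi.
apply/le_anti; rewrite tits_angle_ge0 andbT.
apply: (tits_angle_le xc xc erefl); first by rewrite lexx pi_ge0.
by move=> t t0; rewrite mdistxx cos0 subrr mulr0 expr0n.
Qed.

(* In the Euclidean plane, points at distance [1 / cos u] in direction [u],
   for the three directions [- nu], [a - nu] and [nu] with [nu = (a + b) / 2],
   lie on a line; comparing with them gives the triangle inequality. *)
Lemma tits_angle_triangle (xi zeta eta : boundary X) :
  tits_angle xi eta <= tits_angle xi zeta + tits_angle zeta eta.
Proof.
set a := tits_angle xi zeta; set b := tits_angle zeta eta.
have [ab|ab] := leP pi (a + b); first exact: le_trans (tits_angle_lepi _ _) ab.
have a0 : 0 <= a := tits_angle_ge0 _ _; have b0 : 0 <= b := tits_angle_ge0 _ _.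
have [c1 xc1] := boundary_ex xi.
have [c2 zc2 c20] := ray_from lcX hadX Ufree (c1 0) zeta.
have [c3 ec3 c30] := ray_from lcX hadX Ufree (c1 0) eta.
pose nu := (a + b) / 2; pose u := a - nu.
have cn0 : 0 < cos nu by apply: cos_gt0_pihalf; rewrite /nu; mlra.
have cu0 : 0 < cos u by apply: cos_gt0_pihalf; rewrite /u /nu; mlra.
have sa : sin a = sin u * cos nu + cos u * sin nu.
  by rewrite -sinD; congr sin; rewrite /u; mlra.
have sb : sin b = sin nu * cos u - cos nu * sin u.
  by rewrite -sinB; congr sin; rewrite /u /nu; mlra.
have ca : cos a = cos u * cos nu - sin u * sin nu.
  by rewrite -cosD; congr cos; rewrite /u; mlra.
have cb : cos b = cos nu * cos u + sin nu * sin u.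
  by rewrite -cosB; congr cos; rewrite /u /nu; mlra.
have sa0 : 0 <= sin a by apply: sin_ge0_pi; mlra.
have sb0 : 0 <= sin b by apply: sin_ge0_pi; mlra.
have sn0 : 0 <= sin nu by apply: sin_ge0_pi; rewrite /nu; mlra.
have n1 := cos2Dsin2 nu; have u1 := cos2Dsin2 u.
apply: (tits_angle_le xc1 ec3 (esym c30)); first mlra.
move=> T T0; pose t := T * cos nu; pose r2 := t / cos u.
have t0 : 0 < t by rewrite mulr_gt0.
have r20 : 0 < r2 by rewrite divr_gt0.
have E1 : t = r2 * cos u by rewrite /r2 divfK// gt_eqF.
have h12 : d (c1 T) (c2 r2) <= T * sin a / cos u.
  apply: le_of_sqr; first by apply: divr_ge0; [apply: mulr_ge0 => //|];
    exact: ltW.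
  apply: le_trans (tits_angle_upper xc1 zc2 (esym c20) (ltW T0) (ltW r20)) _.
  rewrite -/a /r2 /t.
  have -> : T ^+ 2 + (T * cos nu / cos u) ^+ 2 - 2 * T * (T * cos nu / cos u) *
    cos a
    = T ^+ 2 * (cos u ^+ 2 + cos nu ^+ 2 - 2 * cos nu * cos u * cos a) / cos u
      ^+ 2.
    by field; rewrite gt_eqF.
  have -> : (T * sin a / cos u) ^+ 2 = T ^+ 2 * sin a ^+ 2 / cos u ^+ 2.
    by field; rewrite gt_eqF.
  apply: eq_leW; congr (_ * _ / _).
  rewrite ca sa.
  have n2 : cos u ^+ 2 * (cos nu ^+ 2 + sin nu ^+ 2) = cos u ^+ 2
    by rewrite n1 mulr1.
  have u2 : cos nu ^+ 2 * (cos u ^+ 2 + sin u ^+ 2) = cos nu ^+ 2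
    by rewrite u1 mulr1.
  by mlra.
have h23 : d (c2 r2) (c3 T) <= T * sin b / cos u.
  apply: le_of_sqr; first by apply: divr_ge0; [apply: mulr_ge0 => //|];
    exact: ltW.
  have c23 : c2 0 = c3 0 by rewrite c20 c30.
  apply: le_trans (tits_angle_upper zc2 ec3 c23 (ltW r20) (ltW T0)) _.
  rewrite -/b /r2 /t.
  have -> : (T * cos nu / cos u) ^+ 2 + T ^+ 2 - 2 * (T * cos nu / cos u) * T *
    cos b
    = T ^+ 2 * (cos u ^+ 2 + cos nu ^+ 2 - 2 * cos nu * cos u * cos b) / cos u
      ^+ 2.
    by field; rewrite gt_eqF.
  have -> : (T * sin b / cos u) ^+ 2 = T ^+ 2 * sin b ^+ 2 / cos u ^+ 2.
    by field; rewrite gt_eqF.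
  apply: eq_leW; congr (_ * _ / _).
  rewrite cb sb.
  have n2 : cos u ^+ 2 * (cos nu ^+ 2 + sin nu ^+ 2) = cos u ^+ 2
    by rewrite n1 mulr1.
  have u2 : cos nu ^+ 2 * (cos u ^+ 2 + sin u ^+ 2) = cos nu ^+ 2
    by rewrite u1 mulr1.
  by mlra.
have h13 : d (c1 T) (c3 T) <= 2 * T * sin nu.
  apply: le_trans (metric_triangle _ (c2 r2) _) _.
  apply: le_trans (lerD h12 h23) _.
  rewrite sa sb; apply: eq_leW; field.
  by rewrite gt_eqF.
rewrite cos_half -/nu; have := le_sqr (mdist_ge0 _ _) h13; mnra.
Qed.

End TitsAngle.

(** * Paths in the Tits boundary *)

Section TitsPaths.
Context {R : realType} {X : metricType R}.
Local Notation d := (@mdist R X).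
Hypothesis lcX : locally_compact [set: X].
Hypothesis hadX : Hadamard X.
Context {U : set_system nat} {UU : UltraFilter U}.
Hypothesis Ufree : \oo `<=` U.

Let angle_sym := tits_angle_sym lcX hadX Ufree.
Let angle_ge0 := tits_angle_ge0 lcX hadX Ufree.

(** A path that is 1-Lipschitz for the Tits angle. Unlike paths over [[0, 1]], such paths are
    concatenated without rescaling, and a larger [L] is reached by waiting at the end. *)
Definition tits_conn (xi eta : boundary X) (L : R) : Prop :=
  exists p : R -> boundary X, [/\ p 0 = xi, p L = eta &
    forall s t, 0 <= s -> s <= t -> t <= L -> tits_angle (p s) (p t) <= t - s].

Lemma tits_conn_refl (xi : boundary X) : tits_conn xi xi 0.
Proof.
by exists (fun=> xi); split => // s t _ st _;
  rewrite (tits_angle_refl lcX hadX Ufree); lra.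
Qed.

Lemma tits_conn_le (xi eta : boundary X) (L M : R) : 0 <= L -> L <= M ->
  tits_conn xi eta L -> tits_conn xi eta M.
Proof.
move=> L0 LM [p [p0 pL h]]; exists (fun t => p (Num.min t L)); split.
- by rewrite min_l.
- by rewrite min_r.
- move=> s t s0 st tM; apply: le_trans (h _ _ _ _ _) _.
  + by rewrite le_min s0.
  + by case: (leP s L); case: (leP t L); lra.
  + by rewrite ge_min lexx orbT.
  + by case: (leP s L); case: (leP t L); lra.
Qed.

Lemma tits_conn_trans (zeta xi eta : boundary X) (L M : R) : 0 <= L -> 0 <= M ->
  tits_conn xi zeta L -> tits_conn zeta eta M -> tits_conn xi eta (L + M).
Proof.
move=> L0 M0 [p [p0 pL hp]] [q [q0 qM hq]].
exists (fun t => if t <= L then p t else q (t - L)); split.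
- by rewrite L0.
(* The junction belongs to the first path; this matters only if [M = 0], where the second path is
   constant. *)
- case: leP => h; last by rewrite addrAC subrr add0r.
  have M00 : M = 0 by lra.
  by rewrite M00 addr0 pL -qM M00.
- move=> s t s0 st tLM; case: (leP s L) => hs; case: (leP t L) => ht.
  + exact: hp.
  + apply: le_trans (tits_angle_triangle lcX hadX Ufree _ zeta _) _.
    have := hp s L s0 hs (lexx L); have :=
      hq 0 (t - L) (lexx 0) ltac:(lra) ltac:(lra).
    by rewrite q0 pL; lra.
  + lra.
  + by apply: le_trans (hq _ _ _ _ _) _; lra.
Qed.

Lemma sum_partition_le (f : R -> R -> R) (L a : R) (s : seq R) :
  (forall x y, 0 <= x -> x <= y -> y <= 1 -> f x y <= L * (y - x)) ->
  0 <= a -> path <%R a s -> last a s <= 1 ->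
  a <= last a s /\
  \sum_(0 <= n < size s) f (nth 1 (a :: s) n) (nth 1 (a :: s) n.+1) <=
    L * (last a s - a).
Proof.
move=> hf; elim: s a => [|b s IH] a a0 /=.
  by move=> _ _; rewrite big_geq// subrr mulr0 lexx.
move=> /andP[ab pbs] l1; have [h1 h2] := IH b ltac:(lra) pbs l1.
split; first lra.
rewrite big_nat_recl//=.
have := hf a b a0 (ltW ab) ltac:(lra); move: h2 => /=; lra.
Qed.

Lemma tits_conn_dist (xi eta : boundary X) (L : R) : 0 <= L ->
  tits_conn xi eta L -> (tits_dist xi eta <= L%:E)%E.
Proof.
move=> L0 [p [p0 pL hp]]; pose q t := p (L * t).
have hq s t : 0 <= s -> s <= t -> t <= 1 ->
  tits_angle (q s) (q t) <= L * (t - s).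
  by move=> s0 st t1; rewrite mulrBr; apply: hp; nra.
apply: (@le_trans _ _ (tits_length q)).
  apply: ereal_inf_lbound; exists q => //; split.
  - by rewrite /q mulr0.
  - by rewrite /q mulr1.
  - move=> s; rewrite in_itv/= => /andP[s0 s1].
    apply/cvgrPdist_lt => e e0; rewrite near_withinE.
    (* [L + 1] instead of [L], which may be zero. *)
    have e1 : 0 < e / (L + 1) by rewrite divr_gt0//; lra.
    exists (e / (L + 1)) => //= t /= ts; rewrite in_itv/= => /andP[t0 t1].
    rewrite sub0r normrN ger0_norm ?angle_ge0//.
    suff h : tits_angle (q s) (q t) <= L * `|s - t|.
      apply: (le_lt_trans h); rewrite ltr_pdivlMr in ts; last lra.
      have := normr_ge0 (s - t); nra.
    case: (leP s t) => st.
      by rewrite ler0_norm ?opprB; [exact: hq|lra].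
    by rewrite ger0_norm; [rewrite angle_sym; apply: hq => //; lra|lra].
apply: ge_ereal_sup => _ [s /= [s1 /eqP s2] <-]; rewrite lee_fin.
have [_] := @sum_partition_le (fun x y =>
  tits_angle (q x) (q y)) L 0 s hq (lexx 0) s1 ltac:(by rewrite s2).
by rewrite s2 subr0 mulr1.
Qed.

(** The edge of the half plane agrees with [c] only as a set. The change of parameter is an isometry
    of the real line, [t] to [x 0 + e * t] with [e ^+ 2 = 1], and is absorbed into the half
    plane. *)
Lemma half_plane_along (c : R -> X) : geodesic_on d setT c ->
  bounds_flat_half_plane c -> exists F : R * R -> X,
    isometric_on eucl_dist d [set z | 0 <= z.2] F /\ forall t, F (t, 0) = c t.
Proof.
move=> cg [F Fi Fr].
have /choice[x xP] : forall t, exists x, F (x, 0) = c t.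
  move=> t; have : range c (c t) by exists t.
  by rewrite Fr => -[x _ <-]; exists x.
have xd s t : (x s - x t) ^+ 2 = (s - t) ^+ 2.
  have := cg s t I I; rewrite -!xP Fi/= ?lexx// => h.
  have := eucl_dist_sqr (x s, 0) (x t, 0).
  by rewrite h real_normK ?num_real//= subrr expr0n/= addr0 => ->.
pose e := x 1 - x 0.
have e2 : e ^+ 2 = 1 by rewrite /e xd; ring.
have xE t : x t = x 0 + e * t.
  have h1 := xd t 0; have h2 := xd t 1.
  have h3 : e * (x t - x 0) = t.
    have : (x t - x 1) ^+ 2 = (x t - x 0) ^+ 2 - 2 * e * (x t - x 0) + e ^+ 2.
      by rewrite /e; ring.
    by rewrite h1 h2 e2; lra.
  have h4 : e ^+ 2 * (x t - x 0) = e * t by rewrite -{2}h3; ring.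
  by rewrite e2 in h4; lra.
exists (fun z => F (x 0 + e * z.1, z.2)); split; last by move=> t /=;
  rewrite -xE xP.
move=> z w /= z0 w0; rewrite Fi//; apply: eucl_dist_eq;
  first exact: eucl_dist_ge0.
rewrite eucl_dist_sqr /=.
have -> : (x 0 + e * z.1 - (x 0 + e * w.1)) ^+ 2 = e ^+ 2 * (z.1 - w.1) ^+ 2
  by ring.
by rewrite e2 mul1r.
Qed.

(** The directions in the half plane form a semicircle; [phi] is measured from the negative end of
    [c], and Euclidean chords give the angle bound. *)
Lemma half_plane_conn (c : R -> X) (xi eta : boundary X) :
  geodesic_on d setT c -> rays_to eta c -> rays_to xi (fun t => c (- t)) ->
  bounds_flat_half_plane c -> tits_conn xi eta pi.
Proof.
move=> cg ec xc /(half_plane_along cg)[F [Fi Fc]].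
pose r phi (t : R) := F (- (t * cos phi), t * sin phi).
have rr phi : 0 <= phi <= pi -> ray (r phi).
  move=> hphi s t /=; rewrite !in_itv/= !andbT => s0 t0.
  have sp := sin_ge0_pi hphi.
  rewrite /r Fi/= ?mulr_ge0//; apply: eucl_dist_eq => //=.
  rewrite real_normK ?num_real//.
  transitivity ((s - t) ^+ 2 * (cos phi ^+ 2 + sin phi ^+ 2)); first ring.
  by rewrite cos2Dsin2 mulr1.
have /choice[p hp] : forall phi, exists zeta, 0 <= phi <= pi ->
  rays_to zeta (r phi).
  move=> phi; case: (boolP (0 <= phi <= pi)) => h; last by exists xi.
  by exists (end_of (rr phi h)) => _; exact: end_ofP.
have pi0 := @pi_ge0 R.
exists p; split.
- apply: (@boundary_eq _ _ _ _ (r 0)); first by apply: hp; rewrite lexx.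
  rewrite (_ : r 0 = fun t => c (- t))//.
  by apply/funext => t; rewrite /r cos0 sin0 mulr1 mulr0 Fc.
- apply: (@boundary_eq _ _ _ _ (r pi)); first by apply: hp; rewrite lexx andbT.
  rewrite (_ : r pi = c)//.
  by apply/funext => t; rewrite /r cospi sinpi mulrN1 mulr0 opprK Fc.
- move=> s t s0 st tpi.
  have hs : 0 <= s <= pi by lra.
  have ht : 0 <= t <= pi by lra.
  apply: (tits_angle_le lcX hadX Ufree (hp s hs) (hp t ht));
    first by rewrite /r !mul0r.
    by lra.
  move=> u u0; rewrite /r Fi/=; try by apply: mulr_ge0;
    [exact: ltW|exact: sin_ge0_pi].
  rewrite eucl_dist_sqr/= cosB; apply: eq_leW.
  have := cos2Dsin2 s; have := cos2Dsin2 t => e1 e2.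
  transitivity (u ^+ 2 * ((cos s ^+ 2 + sin s ^+ 2) + (cos t ^+ 2 + sin t ^+ 2)
    - 2 * (cos t * cos s + sin t * sin s))); first ring.
  by rewrite e1 e2; ring.
Qed.

End TitsPaths.

Section MixMix.
Context {R : realType} {X : metricType R}.
Local Notation d := (@mdist R X).
Hypothesis cat0 : CAT0 X.

Lemma mix_mix (p q : X) (a b l : R) : 0 <= a -> a <= b -> b <= 1 ->
    0 <= l <= 1 ->
  mix (mix p q a) (mix p q b) l = mix p q ((1 - l) * a + l * b).
Proof.
move=> a0 ab b1 l01; have ha : 0 <= a <= 1 by lra.
have hb : 0 <= b <= 1 by lra.
have hm : 0 <= (1 - l) * a + l * b <= 1 by nra.
symmetry; apply: (mix_uniq cat0 l01); rewrite !(mix_dist cat0)//.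
- rewrite [X in _ = _ * (X * _)]ler0_norm ?[X in X * _ = _]ler0_norm;
    [ring|nra|lra].
- rewrite [X in _ = _ * (X * _)]ler0_norm ?[X in X * _ = _]ler0_norm;
    [ring|nra|lra].
Qed.

Lemma between_mix (y z w : X) : d y w + d w z = d y z ->
  exists2 l, 0 <= l <= 1 & w = mix y z l.
Proof.
move=> h; have y0 := mdist_ge0 y w; have z0 := mdist_ge0 w z.
have [D0|D0] := eqVneq (d y z) 0.
  exists 0; first by rewrite lexx ler01.
  by rewrite (mix0 cat0); apply/esym/mdist_positivity; lra.
have Dp : 0 < d y z by rewrite lt_neqAle eq_sym D0 mdist_ge0.
exists (d y w / d y z).
  by rewrite divr_ge0 ?ler_pdivrMr ?mul1r//; lra.
apply: (mix_uniq cat0).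
- by rewrite divr_ge0 ?ler_pdivrMr ?mul1r//; lra.
- by rewrite divfK.
- by rewrite mulrBl mul1r divfK//; lra.
Qed.

Lemma dist_mix_le (p y z : X) (l : R) : 0 <= l <= 1 ->
  d p (mix y z l) <= (1 - l) * d p y + l * d p z.
Proof. by move=> l01; rewrite -{1}(mixxx cat0 p l01); exact: mix_convex. Qed.

End MixMix.

(** * Asymptotic shape of the triangles over two rays *)

Section Chords.
Context {R : realType} {X : metricType R}.
Local Notation d := (@mdist R X).
Hypothesis lcX : locally_compact [set: X].
Hypothesis hadX : Hadamard X.
Context {U : set_system nat} {UU : UltraFilter U}.
Hypothesis Ufree : \oo `<=` U.

Let cat0 : CAT0 X := hadX.2.

Let angleP := @tits_angleP R X lcX hadX U UU Ufree.
Let angle_ge0 := @tits_angle_ge0 R X lcX hadX U UU Ufree.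
Let angle_triangle := @tits_angle_triangle R X lcX hadX U UU Ufree.
Let Uinfty := @free_infty R U Ufree.
Let FU : Filter U := _.
Let dlim_of_ray := @dlim_ray R X hadX U UU Ufree.

(** Semicontinuity: the last hypothesis says that [k n] is at most the cosine of the comparison
    angle at [p], which controls the geodesics from [p] at every fixed distance. *)
Lemma dlim_angle (p : X) (y z : nat -> X) (rho rho' : R -> X)
    (xi eta : boundary X) (a kappa : R) (k : nat -> R) :
  dlim (U := U) p y rho -> dlim (U := U) p z rho' ->
  rays_to xi rho -> rays_to eta rho' -> 0 <= a <= pi ->
  k n @[n --> U] --> kappa -> cos a <= kappa ->
  (\forall n \near U, 2 * k n * (d p (y n) * d p (z n)) <=
     d p (y n) ^+ 2 + d p (z n) ^+ 2 - d (y n) (z n) ^+ 2) ->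
  tits_angle xi eta <= a.
Proof.
move=> [rr r0 dvy hy] [rr' r0' dvz hz] xr er ha kk ka hk.
apply: (tits_angle_le lcX hadX Ufree xr er) => //; first by rewrite r0 r0'.
move=> t t0; apply: (@le_trans _ _ (2 * t ^+ 2 * (1 - kappa))); last first.
  by rewrite ler_wpM2l ?mulr_ge0 ?sqr_ge0//; mlra.
have cv := @cvg_mdist R X U UU _ _ _ _ (hy t (ltW t0)) (hz t (ltW t0)).
have {}cv := @cvgM _ _ U FU _ _ _ _ cv cv.
have cvk : 2 * t ^+ 2 * (1 - k n) @[n --> U] --> 2 * t ^+ 2 * (1 - kappa).
  by apply: cvgM; [exact: cvg_cst|apply: cvgB => //; exact: cvg_cst].
rewrite expr2; apply: (ler_cvg_to cv cvk).
apply: filterS3 (dvy t) (dvz t) hk => n h1 h2 h3.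
have ty : 0 <= t <= d p (y n) by mlra.
have tz : 0 <= t <= d p (z n) by mlra.
have y0 : 0 < d p (y n) by mlra.
have z0 : 0 < d p (z n) by mlra.
have := pt_comparison cat0 ty tz y0 z0.
rewrite -expr2 => h4; apply: (le_trans h4).
have : 2 * k n <= (d p (y n) ^+ 2 + d p (z n) ^+ 2 - d (y n) (z n) ^+ 2) / (d p
  (y n) * d p (z n)).
  by rewrite ler_pdivlMr ?mulr_gt0.
move/(ler_wpM2l (sqr_ge0 t)); rewrite expr2; mlra.
Qed.

Lemma scaled_diverges (p : X) (y : nat -> X) (A : R) : 0 < A ->
  d p (y n) / n%:R @[n --> U] --> A -> diverges (U := U) p y.
Proof.
move=> A0 cv K; have A2 : A / 2 < A by lra.
have h := @cvgr_ge R _ U FU _ A cv _ A2.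
apply: filterS3 h (Uinfty 1) (Uinfty (2 * `|K| / A)) => n h1 h2 h3.
have n0 : 0 < n%:R :> R by lra.
rewrite ler_pdivlMr// in h1; apply: le_trans h1.
rewrite ler_pdivrMr// in h3; have := ler_norm K; lra.
Qed.

(** The numbers [A], [B], [C] are the sides of a triangle in the asymptotic cone; its comparison
    angle bounds the Tits angle. *)
Lemma scaled_angle (p : X) (y z : nat -> X) (rho rho' : R -> X)
    (xi eta : boundary X) (a A B C : R) :
  dlim (U := U) p y rho -> dlim (U := U) p z rho' ->
  rays_to xi rho -> rays_to eta rho' -> 0 <= a <= pi -> 0 < A -> 0 < B ->
  d p (y n) / n%:R @[n --> U] --> A -> d p (z n) / n%:R @[n --> U] --> B ->
  d (y n) (z n) / n%:R @[n --> U] --> C ->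
  cos a <= (A ^+ 2 + B ^+ 2 - C ^+ 2) / (2 * A * B) ->
  tits_angle xi eta <= a.
Proof.
move=> ry rz xr er ha A0 B0 cA cB cC hcos.
pose k n := ((d p (y n) / n%:R) ^+ 2 + (d p (z n) / n%:R) ^+ 2 -
  (d (y n) (z n) / n%:R) ^+ 2) / (2 * (d p (y n) / n%:R) * (d p (z n) / n%:R)).
apply: (dlim_angle (k := k) ry rz xr er ha _ hcos).
  rewrite /k !expr2; under eq_fun do rewrite !expr2.
  apply: cvgM; first by apply: cvgB; [apply: cvgD; exact: cvgM|exact: cvgM].
  apply: cvgV; first by rewrite !mulf_neq0// gt_eqF.
  by apply: cvgM => //; apply: cvgM => //; exact: cvg_cst.
have [_ _ dvy _] := ry; have [_ _ dvz _] := rz.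
apply: filterS3 (dvy 1) (dvz 1) (Uinfty 1) => n h1 h2 h3.
apply: eq_leW; rewrite /k; field.
by rewrite !gt_eqF//; lra.
Qed.

Lemma chord_length (xi eta : boundary X) (c c' : R -> X) :
  rays_to xi c -> rays_to eta c' -> c 0 = c' 0 ->
  d (c n%:R) (c' n%:R) / n%:R @[n --> U] --> 2 * sin (tits_angle xi eta / 2).
Proof.
move=> xc ec c0; have cv := (angleP xi eta).2 c c' xc ec c0.
have nat_oo : (n%:R : R) @[n --> U] --> +oo.
  by apply/cvgryPge => A; exact: Uinfty.
have {}cv := cvg_comp _ _ nat_oo cv.
have H : 2 * (d (c n%:R) (c' n%:R) / (2 * n%:R)) @[n --> U] --> 2 * sin
  (tits_angle xi eta / 2).
  by apply: cvgM; [exact: cvg_cst|exact: cv].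
apply: cvg_trans H; apply: near_eq_cvg; apply: filterS (Uinfty 1) => n n1 /=.
by field; rewrite gt_eqF//; mlra.
Qed.

(* The function [1 - 4 m (1 - m) S^2] is the square of the distance from the
   apex to the point at fraction [m] of the base in the Euclidean isosceles
   triangle of apex angle [theta] and unit sides; the chord triangle is
   asymptotically flat because equality holds at the midpoint and the defect
   is convex. *)
Lemma chord_flat (xi eta : boundary X) (c c' : R -> X) (m : R) :
  rays_to xi c -> rays_to eta c' -> c 0 = c' 0 -> tits_angle xi eta < pi ->
  0 <= m <= 1 ->
  exists2 A, 0 < A /\ A ^+ 2 = 1 - 4 * m * (1 - m) * sin (tits_angle xi eta /
    2) ^+ 2 &
    d (c 0) (mix (c n%:R) (c' n%:R) m) / n%:R @[n --> U] --> A.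
Proof.
set th := tits_angle xi eta; set S := sin (th / 2).
move=> xc ec c0 thpi m01.
have r1 := boundary_ray xc; have r2 := boundary_ray ec.
have th0 : 0 <= th := angle_ge0 _ _.
have pi0 := @pi_gt0 R.
have S0 : 0 <= S by apply: sin_half_ge0; mlra.
pose k := cos (th / 2).
have k0 : 0 < k by apply: cos_gt0_pihalf; mlra.
have k2 : k ^+ 2 = 1 - S ^+ 2 by rewrite /k cos2sin2.
have S1 : S < 1 by rewrite ltNge; apply/negP => h; mnra.
pose q mu n := mix (c n%:R) (c' n%:R) mu.
pose g n := d (c n%:R) (c' n%:R) / n%:R.
have cvg_g : g n @[n --> U] --> 2 * S := chord_length xc ec c0.
pose a mu n := d (c 0) (q mu n) / n%:R.
have a01 mu n : 0 <= mu <= 1 -> 1 <= n%:R :> R -> 0 <= a mu n <= 1.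
  move=> hmu n1; have n0 : 0 < n%:R :> R by mlra.
  apply/andP; split; first by apply: divr_ge0; [exact: mdist_ge0|exact: ltW].
  rewrite ler_pdivrMr// mul1r.
  apply: le_trans (dist_mix_le cat0 _ _ _ hmu) _.
  have e1 : d (c 0) (c n%:R) = n%:R by apply: ray_dist0 => //; exact: ltW.
  have e2 : d (c 0) (c' n%:R) = n%:R by rewrite c0; apply: ray_dist0 => //;
    exact: ltW.
  by rewrite e1 e2; mlra.
have /choice[A cvA] : forall mu, exists l : R, 0 <= mu <= 1 ->
  a mu n @[n --> U] --> l.
  move=> mu; case: (boolP (0 <= mu <= 1)) => hmu; last by exists 0.
  have [|l hl] := @ulim_real_ex R U UU 1 (a mu).
    apply: filterS (Uinfty 1) => n n1.
    by have := a01 mu n hmu n1; rewrite ler_norml; mlra.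
  by exists l.
have A01 mu : 0 <= mu <= 1 -> 0 <= A mu <= 1.
  move=> hmu; apply/andP; split.
    apply: (ler_cvg_to (cvg_cst (0 : R)) (cvA mu hmu)).
    by apply: filterS (Uinfty 1) => n n1; case/andP: (a01 mu n hmu n1).
  apply: (ler_cvg_to (cvA mu hmu) (cvg_cst (1 : R))).
  by apply: filterS (Uinfty 1) => n n1; case/andP: (a01 mu n hmu n1).
have z01 : 0 <= (0 : R) <= 1 by rewrite lexx ler01.
have o01 : 0 <= (1 : R) <= 1 by rewrite lexx ler01.
have h01 : 0 <= (2^-1 : R) <= 1 by lra.
have uniqR (u : nat -> R) (x y : R) : u n @[n --> U] --> x ->
  u n @[n --> U] --> y -> x = y.
  by apply: cvg_unique; exact: norm_hausdorff.
have A0 : A 0 = 1.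
  apply: (uniqR _ _ _ (cvA 0 z01)).
  apply: cvg_near_cst.
  apply: filterS (Uinfty 1) => n n1.
  by rewrite /a /q (mix0 cat0) ray_dist0 ?divff ?gt_eqF//; mlra.
have A1 : A 1 = 1.
  apply: (uniqR _ _ _ (cvA 1 o01)).
  apply: cvg_near_cst.
  apply: filterS (Uinfty 1) => n n1.
  by rewrite /a /q (mix1 cat0) c0 ray_dist0 ?divff ?gt_eqF//; mlra.
(* The CN inequality on the chord, divided by the square of [n] before the limit. *)
have convex x y l : 0 <= x -> x <= y -> y <= 1 -> 0 <= l <= 1 ->
    A ((1 - l) * x + l * y) ^+ 2 <= (1 - l) * A x ^+ 2 + l * A y ^+ 2 -
      l * (1 - l) * ((y - x) * (2 * S)) ^+ 2.
  move=> x0 xy y1 l01.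
  have hx : 0 <= x <= 1 by mlra.
  have hy : 0 <= y <= 1 by mlra.
  have hz : 0 <= (1 - l) * x + l * y <= 1 by mnra.
  have cz := cvA _ hz; have cx := cvA _ hx; have cy := cvA _ hy.
  pose b n := (1 - l) * (a x n * a x n) + l * (a y n * a y n) -
    l * (1 - l) * ((y - x) * g n * ((y - x) * g n)).
  have cvb : b n @[n --> U] --> (1 - l) * (A x * A x) + l * (A y * A y) -
      l * (1 - l) * ((y - x) * (2 * S) * ((y - x) * (2 * S))).
    have cvl (e : R) (u : nat -> R) (v : R) : u n @[n --> U] --> v ->
      e * u n @[n --> U] --> e * v.
      by move=> uv; apply: cvgM => //; exact: cvg_cst.
    apply: cvgB; last by apply: cvgM; [exact: cvg_cst|apply: cvgM; exact: cvl].
    by apply: cvgD; apply: cvl; exact: cvgM.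
  rewrite !expr2; apply: (ler_cvg_to (cvgM cz cz) cvb).
  apply: filterS (Uinfty 1) => n n1.
  have n0 : 0 < n%:R :> R by mlra.
  have := mix_CN cat0 (q x n) (q y n) (c 0) l01.
  rewrite (mix_mix cat0)// (mix_dist cat0)// -/(q _ _).
  have e1 mu : d (c 0) (q mu n) = a mu n * n%:R by rewrite /a divfK// gt_eqF.
  have e2 : d (c n%:R) (c' n%:R) = g n * n%:R by rewrite /g divfK// gt_eqF.
  rewrite !e1 e2 ler0_norm; last by mlra.
  move=> h.
  rewrite -(ler_pM2r (mulr_gt0 n0 n0)) /b /=; move: h; congr (_ <= _); ring.
have Ah : A 2^-1 = k.
  (* Positivity of [A 2^-1] is needed for the midpoints to have a direction; it follows from the
     triangle inequality because [S < 1]. *)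
  have Amin : 1 - S <= A 2^-1.
    have : g n / 2 @[n --> U] --> 2 * S / 2 by apply: cvgM => //;
      exact: cvg_cst.
    rewrite (_ : 2 * S / 2 = S); last by mlra.
    move=> cvg2; have cv1 : 1 - g n / 2 @[n --> U] --> 1 - S
      by apply: cvgB => //; exact: cvg_cst.
    apply: (ler_cvg_to cv1 (cvA _ h01)).
    apply: filterS (Uinfty 1) => n n1.
    have n0 : 0 < n%:R :> R by mlra.
    rewrite /a ler_pdivlMr// /g.
    have T := metric_triangle (c 0) (q 2^-1 n) (c n%:R).
    have e1 : d (c 0) (c n%:R) = n%:R by apply: ray_dist0 => //; exact: ltW.
    have [m1 _] := mixP cat0 (c n%:R) (c' n%:R) h01.
    rewrite e1 (metric_sym (q _ _)) /q m1 in T.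
    rewrite mulrBl mul1r mulrAC divfK ?gt_eqF//; rewrite /q; mlra.
  have Ap : 0 < A 2^-1 by mlra.
  have dv := scaled_diverges Ap (cvA _ h01).
  have [zeta tz] := tends_ex lcX hadX dv.
  have [rho rhoP zr] := tends_base lcX hadX (c 0) tz.
  (* The cosine of the apex angle in the Euclidean triangle of sides [1], [A 2^-1] and opposite side
     [S]. As [1 - S ^+ 2 = k ^+ 2], the inequality [k <= kap] is that of the two means. *)
  pose kap := (1 + A 2^-1 ^+ 2 - S ^+ 2) / (2 * A 2^-1).
  have kapE : kap * (2 * A 2^-1) = 1 + A 2^-1 ^+ 2 - S ^+ 2.
    by rewrite /kap divfK// mulf_neq0// gt_eqF.
  have kap1 : kap <= 1.
    case/andP: (A01 _ h01) => _ Ah1.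
    have := @le_sqr R (1 - A 2^-1) S ltac:(mlra) ltac:(mlra).
    by rewrite /kap ler_pdivrMr; mlra.
  have kapk : k <= kap by rewrite /kap ler_pdivlMr;
    [have := sqr_ge0 (A 2^-1 - k); mnra|mlra].
  have hk : -1 <= kap <= 1 by mlra.
  have cK : cos (acos kap) = kap by rewrite acosK// in_itv.
  have ac0 := acos_ge0 hk; have acpi := acos_lepi hk.
  have hac : 0 <= acos kap <= pi by mlra.
  have cvr : d (c 0) (c n%:R) / n%:R @[n --> U] --> (1 : R).
    apply: cvg_near_cst.
    apply: filterS (Uinfty 1) => n n1.
    by rewrite ray_dist0 ?divff ?gt_eqF//; mlra.
  have cvr' : d (c 0) (c' n%:R) / n%:R @[n --> U] --> (1 : R).
    apply: cvg_near_cst.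
    apply: filterS (Uinfty 1) => n n1.
    by rewrite c0 ray_dist0 ?divff ?gt_eqF//; mlra.
  have cvm : d (c n%:R) (q 2^-1 n) / n%:R @[n --> U] --> S.
    rewrite (_ : S = 2^-1 * (2 * S)); last by mlra.
    have H : 2^-1 * g n @[n --> U] --> 2^-1 * (2 * S).
      by apply: cvgM; [exact: cvg_cst|exact: cvg_g].
    apply: cvg_trans H; apply: near_eq_cvg;
      apply: filterS (Uinfty 1) => n n1 /=.
    by have [-> _] := mixP cat0 (c n%:R) (c' n%:R) h01; rewrite /g mulrA.
  have cvm' : d (q 2^-1 n) (c' n%:R) / n%:R @[n --> U] --> S.
    rewrite (_ : S = 2^-1 * (2 * S)); last by mlra.
    have H : 2^-1 * g n @[n --> U] --> 2^-1 * (2 * S).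
      by apply: cvgM; [exact: cvg_cst|exact: cvg_g].
    apply: cvg_trans H; apply: near_eq_cvg;
      apply: filterS (Uinfty 1) => n n1 /=.
    by have [_ ->] := mixP cat0 (c n%:R) (c' n%:R) h01; rewrite /g; mlra.
  have dl' : dlim (U := U) (c 0) (fun n => c' n%:R) c'.
    by rewrite c0; exact: (dlim_of_ray r2).
  have ang1 : tits_angle xi zeta <= acos kap.
    apply: (scaled_angle (dlim_of_ray r1) rhoP xc zr hac ltr01 Ap cvr (cvA _
      h01) cvm).
    by rewrite cK /kap expr1n mulr1.
  have ang2 : tits_angle zeta eta <= acos kap.
    apply: (scaled_angle rhoP dl' zr ec hac Ap ltr01 (cvA _ h01) cvr' cvm').
    by rewrite cK /kap expr1n mulr1 (addrC 1).
  have ang := angle_triangle xi zeta eta.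
  (* Both halves have angle at most [acos kap], so [th <= 2 * acos kap]. Equality in the inequality
     of the means then forces [A 2^-1 = k]. *)
  have kle : kap <= k.
    rewrite -cK /k leNgt; apply/negP => h.
    have : acos kap < th / 2.
      by move: h; rewrite ltr_cos ?in_itv//=; mlra.
    by rewrite -/th in ang; mlra.
  have kk : kap = k by mlra.
  have : (A 2^-1 - k) ^+ 2 <= 0 by rewrite kk in kapE; mnra.
  move=> h; apply/eqP; rewrite -subr_eq0 -sqrf_eq0; apply/eqP/le_anti.
  by rewrite h sqr_ge0.
have [AmS AmS'] : A m ^+ 2 <= 1 - 4 * m * (1 - m) * S ^+ 2 /\
    1 - 4 * m * (1 - m) * S ^+ 2 <= A m ^+ 2.
  split.
    have := convex 0 1 m (lexx _) ler01 (lexx _) m01.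
    by rewrite mulr0 add0r mulr1 A0 A1; mlra.
  (* The midpoint lies between [m] and the farther end of the chord. Convexity there, with the
     values at the midpoint and at that end known, bounds [A m] from below. *)
  have [mh|mh] := leP m 2^-1.
    have m1 : 0 < 1 - m by mlra.
    pose l := (2^-1 - m) / (1 - m).
    have lE : l * (1 - m) = 2^-1 - m by rewrite /l divfK// gt_eqF.
    have l01 : 0 <= l <= 1 by rewrite divr_ge0 ?ler_pdivrMr ?mul1r//; mlra.
    have := convex m 1 l ltac:(mlra) ltac:(mlra) (lexx _) l01.
    rewrite (_ : (1 - l) * m + l * 1 = 2^-1); last by mlra.
    rewrite Ah A1 k2 => h.
    have l1 : (1 - l) * (1 - m) = 2^-1 by mlra.
    have : (1 - l) * (1 - 4 * m * (1 - m) * S ^+ 2) <= (1 - l) * A m ^+ 2.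
      have e1 : l * (1 - l) * ((1 - m) * (2 * S)) ^+ 2 =
        (l * (1 - m)) * ((1 - l) * (1 - m)) * (4 * S ^+ 2) by ring.
      have e2 : (1 - l) * (1 - 4 * m * (1 - m) * S ^+ 2) =
        (1 - l) - ((1 - l) * (1 - m)) * (4 * m * S ^+ 2) by ring.
      by rewrite e1 lE l1 in h; rewrite e2 l1; mlra.
    by rewrite ler_pM2l//; mnra.
  pose l := 2^-1 / m.
  have m0 : 0 < m by mlra.
  have lE : l * m = 2^-1 by rewrite /l divfK// gt_eqF.
  have l01 : 0 <= l <= 1 by rewrite divr_ge0 ?ler_pdivrMr ?mul1r//; mlra.
  have := convex 0 m l (lexx _) ltac:(mlra) ltac:(mlra) l01.
  rewrite (_ : (1 - l) * 0 + l * m = 2^-1); last by mlra.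
  rewrite Ah A0 k2 => h.
  have l0 : 0 < l by rewrite divr_gt0.
  have : l * (1 - 4 * m * (1 - m) * S ^+ 2) <= l * A m ^+ 2.
    have e1 : l * (1 - l) * ((m - 0) * (2 * S)) ^+ 2 =
      (l * m) * (m - l * m) * (4 * S ^+ 2) by ring.
    have e2 : l * (1 - 4 * m * (1 - m) * S ^+ 2) =
      l - (l * m) * (4 * (1 - m) * S ^+ 2) by ring.
    by rewrite e1 lE in h; rewrite e2 lE; mlra.
  by rewrite ler_pM2l.
have AE : A m ^+ 2 = 1 - 4 * m * (1 - m) * S ^+ 2 by mlra.
exists (A m); last exact: cvA.
split => //; rewrite lt_neqAle; case/andP: (A01 m m01) => -> _; rewrite andbT.
apply/eqP => h; rewrite -h expr0n /= in AE.
have : 0 < 1 - S ^+ 2 by mnra.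
by have := mulr_ge0 (sqr_ge0 S) (sqr_ge0 (1 - 2 * m)); mlra.
Qed.

End Chords.

(** * Tits geodesics and lines as limits of chords *)

Section Dichotomy.
Context {R : realType} {X : metricType R}.
Local Notation d := (@mdist R X).
Hypothesis lcX : locally_compact [set: X].
Hypothesis hadX : Hadamard X.
Context {U : set_system nat} {UU : UltraFilter U}.
Hypothesis Ufree : \oo `<=` U.

Let cat0 : CAT0 X := hadX.2.

Lemma boundary_common_rays (xi eta : boundary X) : exists c c',
  [/\ rays_to xi c, rays_to eta c' & c 0 = c' 0].
Proof.
have [c xc] := boundary_ex xi.
by have [c' ec' c0'] := ray_from lcX hadX Ufree (c 0) eta; exists c, c'.
Qed.

Lemma tits_angle_eq0 (xi eta : boundary X) : tits_angle xi eta = 0 -> xi = eta.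
Proof.
move=> h; have [c [c' [xc ec c0]]] := boundary_common_rays xi eta.
apply: (@boundary_eq _ _ _ _ c') => //.
apply/(boundaryP c' xc); split; first exact: boundary_ray ec.
exists 0 => t t0; apply: le_of_sqr => //.
apply: le_trans (tits_angle_upper lcX hadX Ufree xc ec c0 t0 t0) _.
by rewrite h cos0; mlra.
Qed.

(** By [chord_flat] the triangles over the chords look Euclidean at large scale, so the angles seen
    from the apex between points of the chord pass to the limit. *)
Lemma tits_conn_angle (xi eta : boundary X) : tits_angle xi eta < pi ->
  tits_conn xi eta (tits_angle xi eta).
Proof.
set th := tits_angle xi eta => thpi.
have th0 : 0 <= th := @tits_angle_ge0 R X lcX hadX U UU Ufree _ _.
have [thE|thN] := eqVneq th 0.
  rewrite thE (tits_angle_eq0 thE).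
  exact: (@tits_conn_refl R X lcX hadX U UU Ufree).
have thp : 0 < th by rewrite lt_neqAle eq_sym thN.
have [c [c' [xc ec c0]]] := boundary_common_rays xi eta.
pose S := sin (th / 2); pose k := cos (th / 2).
have k0 : 0 < k by apply: cos_gt0_pihalf; mlra.
have S0 : 0 < S by apply: sin_gt0_pi; mlra.
have k2 : k ^+ 2 = 1 - S ^+ 2 by rewrite /k cos2sin2.
pose u s := s - th / 2.
(* In the isosceles triangle of unit legs, height [k] and base [2 * S], the ray at angle [s] from
   the first leg meets the base at fraction [mu s], at distance [k / cos (u s)] from the apex. *)
pose mu s := 2^-1 + tan (u s) * k / (2 * S).
have cu0 s : 0 <= s <= th -> 0 < cos (u s).
  by move=> hs; apply: cos_gt0_pihalf; rewrite /u; mlra.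
have tanE : tan (th / 2) = S / k by [].
have tan_mono x y : - (th / 2) <= x -> x <= y -> y <= th / 2 -> tan x <= tan y.
  move=> hx xy hy; rewrite leNgt; apply/negP.
  by rewrite ltr_tan ?in_itv/=; [mlra|apply/andP; split; mlra|apply/andP;
    split; mlra].
have tanS : tan (th / 2) * k / (2 * S) = 2^-1.
  by rewrite tanE; field; rewrite !gt_eqF.
have mu01 s : 0 <= s <= th -> 0 <= mu s <= 1.
  move=> hs; have kS : 0 <= k / (2 * S) by rewrite divr_ge0 ?mulr_ge0 ?ltW.
  have h1 := tan_mono (- (th / 2)) (u s) (lexx _) ltac:(rewrite /u;
    mlra) ltac:(rewrite /u; mlra).
  have h2 := tan_mono (u s) (th / 2) ltac:(rewrite /u; mlra) ltac:(rewrite /u;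
    mlra) (lexx _).
  rewrite {1}/tan sinN cosN mulNr -/(tan _) in h1.
  have := ler_wpM2r kS h1; have := ler_wpM2r kS h2.
  by rewrite mulNr !mulrA tanS /mu => h3 h4; apply/andP; split; mlra.
pose q s n := mix (c n%:R) (c' n%:R) (mu s).
have cq s : 0 <= s <= th -> d (c 0) (q s n) / n%:R @[n --> U] --> k / cos (u s).
  move=> hs; have [A [A0 AE] cvA] := chord_flat lcX hadX Ufree xc ec c0 thpi
    (mu01 s hs).
  have cs := cu0 s hs.
  suff -> : k / cos (u s) = A by [].
  apply/eqP; rewrite -(@eqrXn2 _ 2) ?divr_ge0 ?ltW//; apply/eqP;
    rewrite AE -/th -/S.
  have -> : 1 - 4 * mu s * (1 - mu s) * S ^+ 2 = k ^+ 2 + (tan (u s) * k) ^+ 2.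
    by rewrite [in k ^+ 2 + _]k2 /mu; field; rewrite gt_eqF.
  rewrite expr_div_n cos2_tan2 ?gt_eqF//; ring.
have dvq s : 0 <= s <= th -> diverges (U := U) (c 0) (q s).
  move=> hs; have cs := cu0 s hs.
  by apply: (@scaled_diverges R X U UU Ufree _ _ (k / cos (u s))) (cq s hs);
    rewrite divr_gt0.
have /choice[P hP] : forall s, exists zeta, 0 <= s <= th -> tends (U :=
  U) (q s) zeta.
  move=> s; case: (boolP (0 <= s <= th)) => hs; last by exists xi.
  by have [zeta tz] := tends_ex lcX hadX (dvq s hs); exists zeta.
have uniq y z1 z2 := @tends_unique R X lcX hadX U UU y z1 z2.
exists P; split.
- have h0 : 0 <= (0 : R) <= th by rewrite lexx th0.
  apply: (uniq _ _ _ (hP 0 h0)); exists (c 0), c; split => //.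
  rewrite (_ : q 0 = fun n => c n%:R);
    first exact: (dlim_ray hadX Ufree (boundary_ray xc)).
  apply/funext => n; rewrite /q (_ : mu 0 = 0) ?(mix0 cat0)//.
  rewrite /mu /u sub0r /tan sinN cosN mulNr -/(tan _) mulNr mulNr tanS; mlra.
- have h0 : 0 <= th <= th by rewrite lexx th0.
  apply: (uniq _ _ _ (hP th h0)); exists (c' 0), c'; split => //.
  rewrite (_ : q th = fun n => c' n%:R);
    first exact: (dlim_ray hadX Ufree (boundary_ray ec)).
  apply/funext => n; rewrite /q (_ : mu th = 1) ?(mix1 cat0)//.
  by rewrite /mu /u (_ : th - th / 2 = th / 2) ?tanS; mlra.
- move=> s t s0 st tth.
  have hs : 0 <= s <= th by mlra.
  have ht : 0 <= t <= th by mlra.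
  have cs := cu0 s hs; have ct := cu0 t ht.
  have [rho rhoP zr] := tends_base lcX hadX (c 0) (hP s hs).
  have [rho' rhoP' zr'] := tends_base lcX hadX (c 0) (hP t ht).
  have cvC : d (q s n) (q t n) / n%:R @[n --> U] --> `|mu s - mu t| * (2 * S).
    have H : `|mu s - mu t| * (d (c n%:R) (c' n%:R) / n%:R) @[n --> U] --> `|mu
      s - mu t| * (2 * S).
      by apply: cvgM; [exact: cvg_cst|exact: (chord_length lcX hadX Ufree xc ec
        c0)].
    apply: cvg_trans H; apply: near_eq_cvg; apply: nearW => n.
    by rewrite /q (mix_dist cat0) ?mu01// mulrA.
  apply: (scaled_angle lcX hadX Ufree rhoP rhoP' zr zr' _ _ _ (cq s hs) (cq t
    ht) cvC).
  + by mlra.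
  + by rewrite divr_gt0.
  + by rewrite divr_gt0.
  rewrite [(`|_| * _) ^+ 2]exprMn real_normK ?num_real//.
  have -> : (mu s - mu t) ^+ 2 * (2 * S) ^+ 2 = k ^+ 2 * (tan (u s) - tan (u
    t)) ^+ 2.
    by rewrite /mu; field; rewrite gt_eqF.
  have -> : t - s = u t - u s by rewrite /u; ring.
  rewrite cosB; apply: eq_leW; rewrite /tan.
  have es := sin2cos2 (u s); have et := sin2cos2 (u t).
  have E : cos (u t) ^+ 2 + cos (u s) ^+ 2 -
      (sin (u s) * cos (u t) - sin (u t) * cos (u s)) ^+ 2 =
      2 * cos (u s) * cos (u t) * (cos (u t) * cos (u s) + sin (u t) * sin (u
        s)).
    transitivity (cos (u t) ^+ 2 * (1 - sin (u s) ^+ 2) + cos (u s) ^+ 2 * (1 -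
      sin (u t) ^+ 2)
      + 2 * sin (u s) * sin (u t) * cos (u s) * cos (u t)); first ring.
    by rewrite es et; ring.
  transitivity ((cos (u t) ^+ 2 + cos (u s) ^+ 2 -
      (sin (u s) * cos (u t) - sin (u t) * cos (u s)) ^+ 2) / (2 * cos (u s) *
        cos (u t))).
    by rewrite E; field; rewrite !gt_eqF.
  by field; rewrite !gt_eqF.
Qed.

Lemma line_limit (p : X) (K : R) (y z m : nat -> X) (xi eta : boundary X) :
  (\forall n \near U, d p (m n) <= K) ->
  (\forall n \near U, exists2 l, 0 <= l <= 1 & m n = mix (y n) (z n) l) ->
  tends (U := U) y xi -> tends (U := U) z eta ->
  exists c : R -> X, [/\ geodesic_on d setT c, rays_to eta c,
    rays_to xi (fun t => c (- t)), d p (c 0) <= K &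
    forall t, exists2 w, w n @[n --> U] --> c t &
      \forall n \near U, exists2 l, 0 <= l <= 1 & w n = mix (y n) (z n) l].
Proof.
move=> hK hm ty tz.
(* Arc length along the chord from [m n], positive towards [z n] and negative towards [y n]. *)
pose w t n := if 0 <= t then pt (m n) (z n) t else pt (m n) (y n) (- t).
have [ry ryP xry] := tends_base lcX hadX p ty.
have [rz rzP ezr] := tends_base lcX hadX p tz.
have [rry ry0 dvy hy] := ryP; have [rrz rz0 dvz hz] := rzP.
have dvmy : forall L, \forall n \near U, L <= d (m n) (y n).
  move=> L; apply: filterS2 (dvy (L + K)) hK => n h1 h2.
  by have := metric_triangle p (m n) (y n); lra.
have dvmz : forall L, \forall n \near U, L <= d (m n) (z n).
  move=> L; apply: filterS2 (dvz (L + K)) hK => n h1 h2.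
  by have := metric_triangle p (m n) (z n); lra.
have hm' : \forall n \near U, d (y n) (m n) + d (m n) (z n) = d (y n) (z n).
  by apply: filterS hm => n [l l01 ->];
    have [-> ->] := mixP cat0 (y n) (z n) l01; ring.
have wdist s t : \forall n \near U, d (w s n) (w t n) = `|s - t|.
  have aux a b : 0 <= a -> b < 0 -> \forall n \near U,
    d (w a n) (w b n) = a - b.
    move=> a0 b0; near=> n.
    have hz1 : 0 <= a <= d (m n) (z n).
      by rewrite a0 /=; near: n; exact: dvmz.
    have hy1 : 0 <= - b <= d (m n) (y n).
      by apply/andP; split; [lra|near: n; exact: dvmy].
    have hE : d (y n) (m n) + d (m n) (z n) = d (y n) (z n) by near: n;
      exact: hm'.
    rewrite /w a0 leNgt b0 /=.
    have [z1 z2] := ptP cat0 hz1; have [y1 y2] := ptP cat0 hy1.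
    have T1 := metric_triangle (pt (m n) (z n) a) (m n) (pt (m n) (y n) (- b)).
    rewrite (metric_sym _ (m n)) z1 y1 in T1.
    have T2 := metric_triangle (y n) (pt (m n) (y n) (- b)) (z n).
    have T3 := metric_triangle (pt (m n) (y n) (- b)) (pt (m n) (z n) a) (z n).
    rewrite z2 (metric_sym (pt _ (y n) _) (pt _ _ _)) in T3.
    rewrite (metric_sym (y n) (pt _ _ _)) y2 -hE (metric_sym (y n)) in T2.
    by lra.
  case: (leP 0 s) => hs; case: (leP 0 t) => ht.
  - apply: filterS2 (dvmz s) (dvmz t) => n h1 h2.
    by rewrite /w hs ht (pt_dist cat0)// ?hs ?ht.
  - by apply: filterS (aux s t hs ht) => n ->; rewrite ger0_norm//; lra.
  - apply: filterS (aux t s ht hs) => n h; rewrite metric_sym h ltr0_norm//;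
      lra.
  - apply: filterS2 (dvmy (- s)) (dvmy (- t)) => n h1 h2.
    rewrite /w !leNgt hs ht/= (pt_dist cat0); [|lra|lra].
    by rewrite distrC; congr `|_|; ring.
have /choice[c hc] : forall t, exists l : X, w t n @[n --> U] --> l.
  move=> t; apply: (ulim_ex lcX hadX (p := p) (K := K + `|t|)).
  have w0 n : w 0 n = m n by rewrite /w lexx (pt0 cat0).
  apply: filterS2 (wdist 0 t) hK => n h1 h2.
  have := metric_triangle p (m n) (w t n); rewrite -{2}w0 h1 sub0r normrN; lra.
have cg : geodesic_on d setT c.
  by move=> s t _ _; apply: (ulim_eq (hc s) (hc t)); exact: wdist.
exists c; split => //.
- apply/(boundaryP c ezr); split; first by move=> s t _ _; exact: cg.
  apply: asymptotic_sym; exists (2 * K) => t t0.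
  apply: (ulim_le (hc t) (hz t t0) (cvg_cst (2 * K))).
  apply: filterS3 (dvmz t) (dvz t) hK => n h1 h2 h3.
  rewrite /w t0; apply: (le_trans (pt_origin cat0 _ h2)); first by rewrite t0.
  by rewrite metric_sym; lra.
- apply/(boundaryP _ xry); split.
    by move=> s t _ _; rewrite cg// opprK addrC distrC; congr `|_|; ring.
  apply: asymptotic_sym; exists (2 * K) => t t0.
  apply: (ulim_le (hc (- t)) (hy t t0) (cvg_cst (2 * K))).
  apply: filterS3 (dvmy t) (dvy t) hK => n h1 h2 h3.
  have -> : w (- t) n = pt (m n) (y n) t.
    rewrite /w; case: leP => h; last by rewrite opprK.
    have t00 : t = 0 by lra.
    by rewrite t00 oppr0 !(pt0 cat0).
  apply: (le_trans (pt_origin cat0 _ h2)); first by rewrite t0.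
  by rewrite metric_sym; lra.
- have cp : (fun=> p) n @[n --> U] --> p by exact: cvg_cst.
  apply: (ulim_le cp (hc 0) (cvg_cst K)).
  by apply: filterS hK => n; rewrite /w lexx (pt0 cat0).
- move=> t; exists (w t); first exact: hc.
  near=> n; apply: (between_mix cat0); rewrite /w.
  have hE : d (y n) (m n) + d (m n) (z n) = d (y n) (z n) by near: n;
    exact: hm'.
  have T n' := metric_triangle (y n) n' (z n).
  case: leP => ht.
    have hz1 : 0 <= t <= d (m n) (z n).
      by rewrite ht /=; near: n; exact: dvmz.
    have [z1 z2] := ptP cat0 hz1.
    have T1 := metric_triangle (y n) (m n) (pt (m n) (z n) t).
    have T2 := T (pt (m n) (z n) t).
    by rewrite z1 in T1; rewrite z2 -hE in T2 *; lra.
  have hy1 : 0 <= - t <= d (m n) (y n).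
    by apply/andP; split; [lra|near: n; exact: dvmy].
  have [y1 y2] := ptP cat0 hy1.
  have T1 := metric_triangle (pt (m n) (y n) (- t)) (m n) (z n).
  have T2 := T (pt (m n) (y n) (- t)).
  rewrite (metric_sym _ (m n)) y1 in T1.
  by rewrite (metric_sym (y n) (pt _ _ _)) y2 (metric_sym (m n) (y n)) -hE in
    T2 *; lra.
Unshelve. all: by end_near. Qed.

Lemma conn_or_line (xi eta : boundary X) : tits_conn xi eta pi \/
  exists c : R -> X, [/\ geodesic_on d setT c, rays_to eta c,
    rays_to xi (fun t => c (- t)) & ~ bounds_flat_half_plane c].
Proof.
have pi0 := @pi_gt0 R.
have ang0 := @tits_angle_ge0 R X lcX hadX U UU Ufree.
have [thpi|thpi] := ltP (tits_angle xi eta) pi.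
  left; apply: (tits_conn_le _ (ltW thpi)); first exact: ang0.
  exact: tits_conn_angle.
have [c [c' [xc ec c0]]] := boundary_common_rays xi eta.
have r1 := boundary_ray xc; have r2 := boundary_ray ec.
have h01 : 0 <= (2^-1 : R) <= 1 by lra.
pose m n := mix (c n%:R) (c' n%:R) 2^-1.
have ray1 := @dlim_ray R X hadX U UU Ufree _ r1.
have ray2 := @dlim_ray R X hadX U UU Ufree _ r2.
have tc : tends (U := U) (fun n => c n%:R) xi by exists (c 0), c.
have tc' : tends (U := U) (fun n => c' n%:R) eta by exists (c' 0), c'.
have [dv|ndv] := pselect (diverges (U := U) (c 0) m); last first.
  (* For an ultrafilter, failing to diverge means being bounded on a set of [U]. *)
  have [K hK] : exists K, \forall n \near U, d (c 0) (m n) <= K.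
    move/existsNP : ndv => [K nK]; exists K.
    have [//|h] := in_ultra_setVsetC [set n | K <= d (c 0) (m n)] UU.
    by apply: filterS h => n /= /negP; rewrite -ltNge => /ltW.
  have [|l [lg el xl _ _]] := line_limit hK _ tc tc'.
    by apply: nearW => n; exists 2^-1.
  have [hp|nhp] := pselect (bounds_flat_half_plane l); last by right; exists l.
  by left; exact: (half_plane_conn lcX hadX Ufree lg el xl hp).
left; have [zeta tz] := tends_ex lcX hadX dv.
have [rho rhoP zr] := tends_base lcX hadX (c 0) tz.
have nr n : d (c 0) (c n%:R) = n%:R by rewrite ray_dist0.
have nr' n : d (c 0) (c' n%:R) = n%:R by rewrite c0 ray_dist0.
have half : 0 <= (pi / 2 : R) <= pi by lra.
have Ln n : d (c n%:R) (c' n%:R) <= 2 * n%:R.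
  have := metric_triangle (c n%:R) (c 0) (c' n%:R);
    rewrite nr' (metric_sym (c n%:R) (c 0)) nr; mlra.
have ray2' : dlim (U := U) (c 0) (fun n => c' n%:R) c' by rewrite c0.
(* Half of the chord is at most [n], the length of the leg, so the comparison angle at [c 0] between
   the leg and the median is at most [pi / 2]. *)
have a1 : tits_angle xi zeta <= pi / 2.
  apply: (dlim_angle lcX hadX Ufree (k :=
    fun=> 0) ray1 rhoP xc zr half (cvg_cst (0 : R))).
    by rewrite cos_pihalf.
  apply: nearW => n; rewrite mulr0 mul0r nr;
    have [-> _] := mixP cat0 (c n%:R) (c' n%:R) h01.
  have := Ln n; have := mdist_ge0 (c n%:R) (c' n%:R);
    have := sqr_ge0 (d (c 0) (m n)); mnra.
have a2 : tits_angle zeta eta <= pi / 2.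
  apply: (dlim_angle lcX hadX Ufree (k :=
    fun=> 0) rhoP ray2' zr ec half (cvg_cst (0 : R))).
    by rewrite cos_pihalf.
  apply: nearW => n; rewrite mulr0 mul0r nr';
    have [_ ->] := mixP cat0 (c n%:R) (c' n%:R) h01.
  have := Ln n; have := mdist_ge0 (c n%:R) (c' n%:R);
    have := sqr_ge0 (d (c 0) (m n)); mnra.
have -> : pi = pi / 2 + pi / 2 :> R by lra.
have p2 : 0 <= pi / 2 :> R by lra.
apply: (tits_conn_trans lcX hadX Ufree (zeta := zeta) p2 p2).
  by apply: (tits_conn_le _ a1); [exact: ang0|apply: tits_conn_angle; lra].
by apply: (tits_conn_le _ a2); [exact: ang0|apply: tits_conn_angle; lra].
Qed.

End Dichotomy.

(** * Flat strips *)

Section FlatStrip.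
Context {R : realType} {X : metricType R}.
Local Notation d := (@mdist R X).
Hypothesis cat0 : CAT0 X.

(** Extrapolating from [b] through [a] by a factor [N > M / e] shows that [f a] exceeds [f b] by at
    most [e]. *)
Lemma bounded_convex_const (f : R -> R) (M : R) :
  (forall a b l, 0 <= l <= 1 -> f ((1 - l) * a + l * b) <= (1 - l) * f a + l *
    f b) ->
  (forall a, 0 <= f a <= M) -> forall a b, f a = f b.
Proof.
move=> cf bf; suff h a b : f a <= f b by move=> a b; apply/le_anti; rewrite !h.
apply/ler_addgt0Pl => e e0.
have M0 : 0 <= M by case/andP: (bf a); lra.
pose N := M / e + 1; have N1 : 1 <= N by rewrite /N lerDr divr_ge0 // ltW.
have l01 : 0 <= N^-1 <= 1 by rewrite invr_ge0 invf_le1//; lra.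
have := cf b (b + (a - b) * N) N^-1 l01.
have -> : (1 - N^-1) * b + N^-1 * (b + (a - b) * N) = a by field; lra.
move=> h; apply: (le_trans h).
case/andP: (bf (b + (a - b) * N)) => _ h1; case/andP: (bf b) => h2 _.
have : N^-1 * f (b + (a - b) * N) <= e.
  rewrite ler_pdivrMl; last lra.
  apply: (le_trans h1); rewrite /N mulrDl divfK ?gt_eqF//; lra.
case/andP: l01; nra.
Qed.

(** Convexity at the midpoint [0] gives the opposite of the last hypothesis, so [k] is odd, hence
    both convex and concave. *)
Lemma odd_convex_linear (k : R -> R) :
  (forall a b l, 0 <= l <= 1 -> k ((1 - l) * a + l * b) <= (1 - l) * k a + l *
    k b) ->
  k 0 = 0 -> (forall u, k u + k (- u) <= 0) -> forall u, k u = u * k 1.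
Proof.
move=> ck k0 ok.
have odd u : k (- u) = - k u.
  have := ck u (- u) 2^-1 ltac:(lra).
  rewrite (_ : (1 - 2^-1) * u + 2^-1 * - u = 0) ?k0; last by field.
  have := ok u; lra.
have scale u l : 0 <= l <= 1 -> k (l * u) = l * k u.
  move=> l01; have := ck 0 u l l01; have := ck 0 (- u) l l01.
  rewrite !mulr0 !add0r k0 !mulr0 !add0r mulrN !odd; lra.
have pos u : 0 <= u -> k u = u * k 1.
  move=> u0; have [u1|u1] := leP u 1.
    by rewrite -{1}(mulr1 u) scale// u0.
  have h : 0 <= u^-1 <= 1 by rewrite invr_ge0 invf_le1//; lra.
  have := scale u u^-1 h; rewrite mulVf ?gt_eqF//; last lra.
  by move=> ->; rewrite mulrA divff ?mul1r// gt_eqF//; lra.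
move=> u; have [u0|u0] := leP 0 u; first exact: pos.
by have := pos (- u) ltac:(lra); rewrite odd; lra.
Qed.

Lemma line_dist (c : R -> X) (s t : R) : geodesic_on d setT c ->
    d (c s) (c t) = `|s - t|.
Proof. by move=> cg; apply: cg. Qed.

Lemma line_mix (c : R -> X) (a b l : R) : geodesic_on d setT c -> 0 <= l <= 1 ->
  c ((1 - l) * a + l * b) = mix (c a) (c b) l.
Proof.
move=> cg l01; apply: (mix_uniq cat0) => //; rewrite !line_dist//.
- have -> : a - ((1 - l) * a + l * b) = l * (a - b) by ring.
  by rewrite normrM ger0_norm//; lra.
- have -> : (1 - l) * a + l * b - b = (1 - l) * (a - b) by ring.
  by rewrite normrM ger0_norm//; lra.
Qed.

(** Moving both parameters together gives a bounded convex function on the real line. *)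
Lemma parallel_dist (c c' : R -> X) (K s t : R) :
  geodesic_on d setT c -> geodesic_on d setT c' ->
  (forall t, d (c t) (c' t) <= K) -> d (c s) (c' t) = d (c 0) (c' (t - s)).
Proof.
move=> cg cg' hK; pose f v := d (c v) (c' (t - s + v)).
have := @bounded_convex_const f (K + `|t - s|) _ _ s 0.
rewrite /f subrK addr0; apply.
  move=> a b l l01; rewrite (line_mix _ _ cg)//.
  have -> : t - s + ((1 - l) * a + l * b) = (1 - l) * (t - s + a) + l * (t - s
    + b) by ring.
  by rewrite (line_mix _ _ cg')//; exact: mix_convex.
move=> a; rewrite mdist_ge0/=.
have := metric_triangle (c a) (c' a) (c' (t - s + a)).
rewrite (line_dist _ _ cg') (_ : a - (t - s + a) = - (t - s)); last by ring.
by rewrite normrN; have := hK a; lra.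
Qed.

(* With [g u = d (c 0) (c' u)], the CN inequality says that [g u ^+ 2 - u ^+ 2]
   is convex and the quadrilateral inequality that it is concave about [0], so
   that it is affine; a shift of the parameter makes it constant. *)
Lemma parallel_shift (c c' : R -> X) (K : R) :
  geodesic_on d setT c -> geodesic_on d setT c' ->
  (forall t, d (c t) (c' t) <= K) ->
  exists a : R, forall s t,
    d (c s) (c' (t + a)) ^+ 2 = (t - s) ^+ 2 + d (c 0) (c' a) ^+ 2.
Proof.
move=> cg cg' hK; pose g u := d (c 0) (c' u).
have pd := parallel_dist _ _ cg cg' hK.
pose k u := g u ^+ 2 - u ^+ 2 - g 0 ^+ 2.
have kE : forall u, k u = u * k 1.
  apply: odd_convex_linear.
  - move=> a b l l01; rewrite /k /g (line_mix _ _ cg')//.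
    have := mix_CN cat0 (c' a) (c' b) (c 0) l01.
    rewrite (line_dist _ _ cg') real_normK ?num_real//; lra.
  - by rewrite /k expr0n/= subr0 subrr.
  - move=> u; rewrite /k /g.
    have := quadrilateral cat0 (c 0) (c' 0) (c' u) (c u).
    have p1 := pd u 0; have p2 := pd u u; rewrite sub0r in p1;
      rewrite subrr in p2.
    rewrite (metric_sym (c' 0) (c u)) p1 (metric_sym (c' u) (c u)) p2.
    rewrite (line_dist _ _ cg) (line_dist _ _ cg') subr0 sub0r.
    by rewrite normrN !real_normK ?num_real//; lra.
pose al := k 1; exists (- (al / 2)) => s t.
have gE u : g u ^+ 2 = u ^+ 2 + u * al + g 0 ^+ 2.
  by have := kE u; rewrite -/al /k; lra.
have G1 := gE (t - al / 2 - s); have G2 := gE (- (al / 2)); rewrite /g in G1 G2.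
by rewrite pd G1 G2; field.
Qed.

(** [parallel_shift] gives the exact distances between the two edges. CN bounds distances inside
    from above, and the edge distances bound them from below. *)
Lemma flat_strip (c c' : R -> X) (K r : R) :
  geodesic_on d setT c -> geodesic_on d setT c' ->
  (forall t, d (c t) (c' t) <= K) -> 0 < r -> (forall t, r <= d (c 0) (c' t)) ->
  exists F : R * R -> X,
    isometric_on eucl_dist d [set z | 0 <= z.2 <= r] F /\ forall t, F (t,
      0) = c t.
Proof.
move=> cg cg0 hK r0 hr; have [a ha] := parallel_shift cg cg0 hK.
pose e t := c' (t + a); pose w := d (c 0) (c' a).
have rw : r <= w := hr a.
have w0 : 0 < w by lra.
have {}ha s t : d (c s) (e t) ^+ 2 = (t - s) ^+ 2 + w ^+ 2 := ha s t.
have he s : d (c s) (e s) = w.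
  apply/eqP; rewrite -(@eqrXn2 _ 2) ?mdist_ge0// ?ltW// ha.
  by apply/eqP; ring.
pose F (z : R * R) := mix (c z.1) (e z.1) (z.2 / w).
have l01 y : 0 <= y <= w -> 0 <= y / w <= 1.
  by move=> hy; rewrite divr_ge0 ?ler_pdivrMr ?mul1r//; lra.
have F0 x : F (x, 0) = c x by rewrite /F mul0r (mix0 cat0).
have Fw x : F (x, w) = e x by rewrite /F/= divff ?gt_eqF// (mix1 cat0).
have upc x y s : 0 <= y <= w -> d (c s) (F (x,
  y)) ^+ 2 <= (s - x) ^+ 2 + y ^+ 2.
  move=> hy; apply: le_trans (mix_CN cat0 _ _ _ (l01 y hy)) _ => /=.
  rewrite ha he (line_dist _ _ cg) real_normK ?num_real//.
  by apply: eq_leW; field; rewrite gt_eqF.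
have cg' : geodesic_on d setT e.
  by move=> s t _ _; rewrite /e (line_dist _ _ cg0); congr `|_|; ring.
have upe x y s : 0 <= y <= w -> d (e s) (F (x,
  y)) ^+ 2 <= (s - x) ^+ 2 + (w - y) ^+ 2.
  move=> hy; apply: le_trans (mix_CN cat0 _ _ _ (l01 y hy)) _ => /=.
  rewrite (metric_sym _ (c x)) (ha x s) (he x) (line_dist _ _ cg') real_normK
    ?num_real//.
  by apply: eq_leW; field; rewrite gt_eqF.
have up x y x' y' : 0 <= y <= w -> 0 <= y' <= w ->
    d (F (x, y)) (F (x', y')) <= eucl_dist (x, y) (x', y').
  move=> hy hy'; apply: le_of_sqr; first exact: eucl_dist_ge0.
  apply: le_trans (mix_CN cat0 _ _ _ (l01 y' hy')) _ => /=.
  rewrite he eucl_dist_sqr /= -/(F (x, y)).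
  rewrite (metric_sym _ (c x')) (metric_sym _ (e x')).
  have := upc x y x' hy; have := upe x y x' hy.
  case/andP: (l01 y' hy') => h1 h2 h3 h4.
  apply: (@le_trans _ _ ((1 - y' / w) * ((x' - x) ^+ 2 + y ^+ 2) +
    y' / w * ((x' - x) ^+ 2 + (w - y) ^+ 2) - y' / w * (1 - y' / w) * w ^+ 2)).
    by rewrite lerD2r lerD// ler_wpM2l//; lra.
  by apply: eq_leW; field; rewrite gt_eqF.
have low x y x' y' : 0 <= y <= w -> 0 <= y' <= w -> y < y' ->
    eucl_dist (x, y) (x', y') <= d (F (x, y)) (F (x', y')).
  move=> hy hy' yy; pose q := y' - y; have q0 : 0 < q by rewrite /q; lra.
  (* The segment is prolonged with slope [m] to both edges. Its full length [w / q * E] is an exact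
     edge distance, and the two added pieces are at most their Euclidean lengths. *)
  pose m := (x' - x) / q.
  have E0 := eucl_dist_ge0 (x, y) (x', y').
  have E2 := eucl_dist_sqr (x, y) (x', y').
  set E := eucl_dist (x, y) (x', y') in E0 E2 *; rewrite /= in E2.
  have xE : x' = x + m * q by rewrite /m divfK ?gt_eqF//; ring.
  have dPA : d (c (x - m * y)) (F (x, y)) <= y / q * E.
    apply: le_of_sqr; first by rewrite mulr_ge0// divr_ge0//; lra.
    apply: le_trans (upc _ _ _ hy) _; rewrite exprMn E2 xE /q.
    by apply: eq_leW; field; rewrite gt_eqF.
  have dBQ : d (F (x', y')) (e (x + m * (w - y))) <= (w - y') / q * E.
    apply: le_of_sqr; first by rewrite mulr_ge0// divr_ge0//; lra.
    rewrite metric_sym; apply: le_trans (upe _ _ _ hy') _;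
      rewrite exprMn E2 xE /q.
    by apply: eq_leW; field; rewrite gt_eqF.
  have dPQ : w / q * E <= d (c (x - m * y)) (e (x + m * (w - y))).
    apply: le_of_sqr; first exact: mdist_ge0.
    rewrite ha exprMn E2 xE /q.
    by apply: eq_leW; field; rewrite gt_eqF.
  have T1 := metric_triangle (c (x - m * y)) (F (x, y)) (e (x + m * (w - y))).
  have T2 := metric_triangle (F (x, y)) (F (x', y')) (e (x + m * (w - y))).
  have : w / q * E - y / q * E - (w - y') / q * E = E.
    by rewrite /q; field; rewrite gt_eqF.
  by lra.
have lowne x y x' y' : 0 <= y <= w -> 0 <= y' <= w -> y != y' ->
    eucl_dist (x, y) (x', y') <= d (F (x, y)) (F (x', y')).
  move=> hy hy'; rewrite neq_lt => /orP[|] h; first exact: low.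
  rewrite metric_sym; apply: le_trans (low _ _ _ _ hy' hy h).
  by apply: eq_leW; rewrite /eucl_dist/=; congr Num.sqrt; ring.
have lowall x y x' y' : 0 <= y <= w -> 0 <= y' <= w ->
    eucl_dist (x, y) (x', y') <= d (F (x, y)) (F (x', y')).
  move=> hy hy'; have [E|] := eqVneq y y'; last exact: lowne.
  (* A horizontal segment does not reach the edges when prolonged; one end is lifted by at most
     [eps], which changes the distance by at most [eps]. *)
  rewrite -{}E {y' hy'}; apply/ler_addgt0Pl => eps eps0.
  have [y' [hy' yy' yd]] : exists y', [/\ 0 <= y' <= w,
    y != y' & `|y - y'| <= eps].
    have [h|h] := leP y (w / 2).
      exists (y + Num.min eps (w / 2)); split.
      - by case: (leP eps (w / 2)) => ?; apply/andP; split; lra.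
      - by rewrite lt_eqF// ltrDl lt_min eps0/=; lra.
      - by rewrite opprD addNKr normrN ger0_norm ?ge_min ?lexx// le_min ltW//=;
          lra.
    exists (y - Num.min eps (w / 2)); split.
    - by case: (leP eps (w / 2)) => ?; apply/andP; split; lra.
    - by rewrite gt_eqF// ltrBlDr ltrDl lt_min eps0/=; lra.
    - by rewrite subKr ger0_norm ?ge_min ?lexx// le_min ltW//=; lra.
  have h1 := lowne x y x' y' hy hy' yy'.
  have h2 := metric_triangle (F (x, y)) (F (x', y)) (F (x', y')).
  have h3 := up x' y x' y' hy hy'.
  have h4 : eucl_dist (x', y) (x', y') = `|y - y'|.
    by apply: eucl_dist_eq => //=; rewrite subrr real_normK ?num_real//; ring.
  have h5 : eucl_dist (x, y) (x', y) <= eucl_dist (x, y) (x', y').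
    apply: le_of_sqr; first exact: eucl_dist_ge0.
    by rewrite !eucl_dist_sqr/= subrr expr0n/= addr0 lerDl sqr_ge0.
  by lra.
exists F; split; last exact: F0.
move=> [x y] [x' y'] /= hy hy'; apply/le_anti.
by rewrite up ?lowall//; apply/andP; split; lra.
Qed.

End FlatStrip.

(** * Lines without flat half plane as barriers *)

Section Barrier.
Context {R : realType} {X : metricType R}.
Local Notation d := (@mdist R X).
Hypothesis lcX : locally_compact [set: X].
Hypothesis hadX : Hadamard X.
Context {U : set_system nat} {UU : UltraFilter U}.
Hypothesis Ufree : \oo `<=` U.

Let cat0 : CAT0 X := hadX.2.
Let Uinfty := @free_infty R U Ufree.

Definition bounds_strip (c : R -> X) (r : R) : Prop :=
  exists F : R * R -> X,
    isometric_on eucl_dist d [set z | 0 <= z.2 <= r] F /\ forall t, F (t,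
      0) = c t.

(** Any two points of the half plane lie in all but finitely many of the strips, and the strips
    share the edge [c], so their ultralimit is isometric. *)
Lemma half_plane_of_strips (c : R -> X) :
  (forall n : nat, bounds_strip c n.+1%:R) -> bounds_flat_half_plane c.
Proof.
move=> /choice[F hF].
have Fi z w : 0 <= z.2 -> 0 <= w.2 ->
    \forall n \near U, d (F n z) (F n w) = eucl_dist z w.
  move=> z0 w0; apply: filterS2 (Uinfty z.2) (Uinfty w.2) => n h1 h2.
  have n1 : n%:R <= n.+1%:R :> R by rewrite ler_nat.
  by apply: (hF n).1 => /=; apply/andP; split => //; lra.
have /choice[G hG] : forall z : R * R, exists l : X, 0 <= z.2 ->
  F n z @[n --> U] --> l.
  move=> z; have [z0|z0] := leP 0 z.2; last by exists (c 0); lra.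
  have [|l hl] := @ulim_ex R X lcX hadX U UU (c 0) (eucl_dist (0, 0) z) (F^~ z).
    apply: filterS (Fi (0, 0) z (lexx 0) z0) => n.
    by rewrite (hF n).2 => ->.
  by exists l.
exists G.
  by move=> z w /= z0 w0; apply: (ulim_eq (hG z z0) (hG w w0)); exact: Fi.
have Gc t : G (t, 0) = c t.
  apply: (@ulim_unique R X U UU _ _ _ (hG (t, 0) (lexx 0))).
  apply: cvg_near_cst; apply: nearW => n; exact: (hF n).2.
by apply/seteqP; split => [_ [t _ <-]|_ [t _ <-]]; exists t.
Qed.

Lemma narrow_strip (c : R -> X) : ~ bounds_flat_half_plane c ->
  exists2 r, 0 < r & ~ bounds_strip c r.
Proof.
move=> nh; apply: contrapT => h; apply: nh; apply: half_plane_of_strips => n.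
by apply: contrapT => hn; apply: h; exists n.+1%:R.
Qed.

(** An error [r] at distance [n.+1] shrinks to at most [t * r / n.+1] at distance [t]. *)
Lemma dlim_of_close (c : R -> X) (y : nat -> X) (r : R) : ray c ->
  (forall n, n.+1%:R <= d (c 0) (y n) /\
     d (pt (c 0) (y n) n.+1%:R) (c n.+1%:R) <= r) ->
  dlim (U := U) (c 0) y c.
Proof.
move=> cr h; have nS n : n%:R <= n.+1%:R :> R by rewrite ler_nat.
split => // [K|t t0].
  by apply: filterS (Uinfty K) => n hn; have [h1 _] := h n; have := nS n; lra.
apply/mcvgP => e e0.
apply: filterS2 (Uinfty t) (Uinfty (t * r / e)) => n h1 h2.
have [h3 h4] := h n; have h5 := nS n.
have N0 : 0 < n.+1%:R :> R by rewrite ltr0n.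
set N := n.+1%:R in h3 h4 h5 N0.
have tN : 0 <= t <= N by lra.
have Nd : 0 <= N <= d (c 0) (y n) by lra.
have [e1 _] := ptP cat0 Nd.
rewrite -(@pt_pt _ _ cat0 _ _ N t)//.
have l01 : 0 <= t / N <= 1 by rewrite divr_ge0 ?ler_pdivrMr ?mul1r//; lra.
have u1 : c t = mix (c 0) (c N) (t / N).
  by rewrite -(@pt_ray _ _ cat0 c N t)// /pt ray_dist0// ltW.
have u2 : pt (c 0) (pt (c 0) (y n) N) t = mix (c 0) (pt (c 0) (y n) N) (t / N).
  by move: e1; set v := pt (c 0) (y n) N; rewrite /pt => ->.
rewrite u1 u2; apply: le_lt_trans (mix_le_r cat0 _ _ _ l01) _.
rewrite (metric_sym (c N)).
have r0 : 0 <= r by have := mdist_ge0 (pt (c 0) (y n) N) (c N); lra.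
apply: (@le_lt_trans _ _ (t / N * r)).
  by rewrite ler_wpM2l//; case/andP: l01.
rewrite mulrAC ltr_pdivrMr//; rewrite ler_pdivrMr// in h2.
case: (ltP 0 (t * r)) => tr; last first.
  by apply: le_lt_trans tr _; rewrite mulr_gt0.
have hN : n%:R < N by rewrite /N ltr_nat.
by nra.
Qed.

(* Push the end points of geodesics that miss the ball of radius [r] inwards
   along the rays from [c 0] until the geodesics almost touch the ball: these
   have a limit line, which is parallel to [c] and at distance at least [r]
   from [c 0], so that [c] bounds a flat strip of width [r]. *)
Lemma barrier (c : R -> X) : geodesic_on d setT c ->
    ~ bounds_flat_half_plane c ->
  exists r T : R, [/\ 0 < r, 0 < T & forall y z,
    T < d (c 0) y -> d (pt (c 0) y T) (c (- T)) < r ->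
    T < d (c 0) z -> d (pt (c 0) z T) (c T) < r ->
    exists2 l, 0 <= l <= 1 & d (c 0) (mix y z l) <= r].
Proof.
move=> cg /narrow_strip[r r0 nstrip]; exists r; apply: contrapT => hn.
pose x := c 0.
have bad (n : nat) : exists y z, [/\ n.+1%:R < d x y,
    d (pt x y n.+1%:R) (c (- n.+1%:R)) < r, n.+1%:R < d x z,
    d (pt x z n.+1%:R) (c n.+1%:R) < r &
    forall l, 0 <= l <= 1 -> r < d x (mix y z l)].
  apply: contrapT => hyz; apply: hn; exists n.+1%:R; split => //.
  move=> y z h1 h2 h3 h4; apply: contrapT => hl; apply: hyz; exists y, z.
  split => // l l01; rewrite ltNge; apply/negP => h; apply: hl; by exists l.
have good (n : nat) : exists Y Z l, [/\ n.+1%:R <= d x Y /\ n.+1%:R <= d x Z,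
    d (pt x Y n.+1%:R) (c (- n.+1%:R)) <= r,
    d (pt x Z n.+1%:R) (c n.+1%:R) <= r,
    forall l, 0 <= l <= 1 -> r <= d x (mix Y Z l) &
    0 <= l <= 1 /\ d x (mix Y Z l) <= r + 1].
  have [y [z [y1 y2 z1 z2 yz]]] := bad n; set T := n.+1%:R in y1 y2 z1 z2 *.
  have T0 : 0 < T by rewrite /T ltr0n.
  pose tr (v : X) (k : nat) := Num.min (T + k%:R) (d x v).
  pose f (v : X) (k : nat) := pt x v (tr v k).
  have trP v k : T < d x v -> T <= tr v k /\ tr v k <= d x v.
    move=> Tv; rewrite /tr; split; last by rewrite ge_min lexx orbT.
    by rewrite le_min (ltW Tv) andbT lerDl ler0n.
  have fd v k : T < d x v -> d x (f v k) = tr v k.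
    by move=> /(trP _ k)[h1 h2]; have [|-> //] := @ptP _ _ cat0 x v (tr v k);
      lra.
  have fT v k : T < d x v -> pt x (f v k) T = pt x v T.
    by move=> /(trP _ k)[h1 h2]; rewrite /f (pt_pt cat0)//; lra.
  have fstep v k : T < d x v -> d (f v k.+1) (f v k) <= 1.
    move=> Tv; have [h1 h2] := trP v k Tv; have [h3 h4] := trP v k.+1 Tv.
    rewrite /f (pt_dist cat0); [|lra|lra].
    rewrite /tr -natr1; case: (leP (T + (k%:R + 1)) (d x v)) => h5;
      case: (leP (T + k%:R) (d x v)) => h6; rewrite ler_norml; apply/andP;
        split; lra.
  have f0 v : T < d x v -> f v 0%N = pt x v T.
    by move=> Tv; rewrite /f /tr addr0 min_l// ltW.
  pose P k := forall l, 0 <= l <= 1 -> r <= d x (mix (f y k) (f z k) l).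
  have exP : exists k, `[< P k >].
    pose k := (Num.truncn (d x y + d x z)).+1.
    have hk : d x y + d x z < k%:R by rewrite /k truncnS_gt.
    have y0 := mdist_ge0 x y; have z0 := mdist_ge0 x z.
    exists k; apply/asboolP => l l01.
    have -> : f y k = y by rewrite /f /tr min_r ?(pt_end cat0)//; lra.
    have -> : f z k = z by rewrite /f /tr min_r ?(pt_end cat0)//; lra.
    exact/ltW/yz.
  have [k /asboolP Pk kmin] := ex_minnP exP.
  (* At [k = 0] the end points are closer than [r] to [c (- T)] and [c T], so their midpoint is
     closer than [r] to [x]. *)
  case: k Pk kmin => [P0|k Pk kmin].
    have h01 : 0 <= (2^-1 : R) <= 1 by lra.
    have := P0 2^-1 h01; rewrite !f0//.
    have xm : x = mix (c (- T)) (c T) 2^-1.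
      by rewrite -(line_mix cat0 _ _ cg h01) /x; congr c; field.
    have := mix_convex cat0 (c (- T)) (c T) (pt x y T) (pt x z T) h01.
    by rewrite -xm (metric_sym (c (- T))) (metric_sym (c T)); mlra.
  (* By minimality the preceding chord enters the open ball; one step moves it by at most 1, which
     gives the bound [r + 1]. *)
  have [l l01 hl] : exists2 l, 0 <= l <= 1 & d x (mix (f y k) (f z k) l) < r.
    apply: contrapT => hl; have : (k.+1 <= k)%N by apply: kmin;
      apply/asboolP => l l01;
      rewrite leNgt; apply/negP => h; apply: hl; exists l.
    by rewrite ltnn.
  exists (f y k.+1), (f z k.+1), l; rewrite !fd// !fT//; split => //.
  - by have [? _] := trP y k.+1 y1; have [? _] := trP z k.+1 z1.
  - exact: ltW.
  - exact: ltW.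
  - split => //; apply: le_trans (metric_triangle _ (mix (f y k) (f z k) l) _)
      _.
    have := mix_convex cat0 (f y k) (f z k) (f y k.+1) (f z k.+1) l01.
    have := fstep y k y1; have := fstep z k z1.
    rewrite (metric_sym (f y k)) (metric_sym (f z k)); case/andP: l01; nra.
have {bad good} /choice[Y /choice[Z /choice[l hYZ]]] := good.
have cr : ray c by move=> s t _ _; exact: cg.
have cr' : ray (fun t => c (- t)).
  by move=> s t _ _; rewrite (line_dist _ _ cg) opprK addrC distrC;
    congr `|_|; ring.
have tY : tends (U := U) Y (end_of cr').
  exists (c (- 0)), (fun t => c (- t)); split; last exact: end_ofP.
  apply: (@dlim_of_close (fun t => c (- t)) Y r) => // n; rewrite oppr0.
  by have [[? _] ? _ _ _] := hYZ n.
have tZ : tends (U := U) Z (end_of cr).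
  exists (c 0), c; split; last exact: end_ofP.
  by apply: (@dlim_of_close c Z r) => // n; have [[_ ?] _ ? _ _] := hYZ n.
have [||L [Lg eL xL _ Lw]] := line_limit lcX hadX (p := x) (K := r + 1)
    (m := fun n => mix (Y n) (Z n) (l n)) _ _ tY tZ.
- by apply: nearW => n; have [_ _ _ _ []] := hYZ n.
- by apply: nearW => n; exists (l n) => //; have [_ _ _ _ []] := hYZ n.
(* Being asymptotic to [c] at both ends, [L] is parallel to [c]. *)
have [_ [K1 hK1]] := eL; have [_ [K2 hK2]] := xL.
apply: nstrip; apply: (flat_strip cat0 (c' := L) (K := Num.max K1 K2)) => //.
  move=> t; rewrite le_max; have [t0|t0] := leP 0 t; first by rewrite hK1.
  by have := hK2 (- t) ltac:(lra); rewrite opprK => ->; rewrite orbT.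
move=> t; have [w wL hw] := Lw t.
have cx : (fun=> x) n @[n --> U] --> x by exact: cvg_cst.
apply: (ulim_ge cx wL (cvg_cst r)); apply: filterS hw => n [k k01 ->].
by have [_ _ _ h _] := hYZ n; exact: h.
Qed.

End Barrier.

(** * Rank one isometries *)

Section Axes.
Context {R : realType} {X : metricType R}.
Local Notation d := (@mdist R X).
Hypothesis lcX : locally_compact [set: X].
Hypothesis hadX : Hadamard X.
Context {U : set_system nat} {UU : UltraFilter U}.
Hypothesis Ufree : \oo `<=` U.

Let cat0 : CAT0 X := hadX.2.
Let Uinfty := @free_infty R U Ufree.

Lemma iter_isom (f : X -> X) (k : nat) : (forall p q, d (f p) (f q) = d p q) ->
  forall p q, d (iter k f p) (iter k f q) = d p q.
Proof. by move=> fi p q; elim: k => //= k IH; rewrite fi. Qed.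

Lemma iter_dist_le (f : X -> X) (k : nat) (p : X) :
  (forall p q, d (f p) (f q) = d p q) -> d p (iter k f p) <= k%:R * d p (f p).
Proof.
move=> fi; elim: k => [|k IH]; first by rewrite mdistxx mul0r.
rewrite iterSr -natr1 mulrDl mul1r.
apply: le_trans (metric_triangle _ (f p) _) _.
by rewrite addrC lerD2r -iterSr/= fi.
Qed.

(** The midpoints of [p, f p] and of [f p, f (f p)] correspond under [f], and their distance is at
    most half of [d p (f (f p))]. *)
Lemma displacement_double (f : X -> X) (e : R) : (forall p q,
    d (f p) (f q) = d p q) ->
  (forall p, e <= d p (f p)) -> forall p, 2 * e <= d p (f (f p)).
Proof.
move=> fi he p; have h01 : 0 <= (2^-1 : R) <= 1 by lra.
have h := he (mix p (f p) 2^-1).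
rewrite (mix_isom cat0 _ _ fi)// (mixC cat0 p)// in h.
rewrite (_ : 1 - 2^-1 = 2^-1 :> R) in h; last by field.
have := mix_le_r cat0 (f p) p (f (f p)) h01; lra.
Qed.

Lemma displacement_exp (f : X -> X) (e : R) (k : nat) : (forall p q,
    d (f p) (f q) = d p q) ->
  (forall p, e <= d p (f p)) -> forall p, 2 ^+ k * e <= d p (iter (2 ^ k) f p).
Proof.
elim: k f e => [|k IH] f e fi he p; first by rewrite expr0 mul1r expn0.
rewrite expnSr iterM exprSr -mulrA; apply: IH => [u v|u];
  first exact: iter_isom.
exact: displacement_double.
Qed.

(* At a point of minimal displacement, the displacement of the powers is
   additive: the midpoint argument doubles the minimum for the square. *)
Lemma min_displacement_iter (f : X -> X) (p : X) (n : nat) :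
  (forall p q, d (f p) (f q) = d p q) -> (forall q, d p (f p) <= d q (f q)) ->
  d p (iter n f p) = n%:R * d p (f p).
Proof.
move=> fi hp; apply/le_anti; rewrite iter_dist_le//=.
have h1 := displacement_exp n fi hp p.
have n2 : (n <= 2 ^ n)%N by exact: ltnW (ltn_expl n (ltnSn 1)).
have T := metric_triangle p (iter n f p) (iter (2 ^ n) f p).
have h2 : d (iter n f p) (iter (2 ^ n) f p) <= (2 ^ n - n)%:R * d p (f p).
  rewrite -{1}(subnKC n2) iterD iter_isom//; exact: iter_dist_le.
rewrite natrB// natrX in h2; lra.
Qed.

(** Displacements of powers add up at [p], so the orbit points lie in order on the geodesics from
    [g ^ n p] to [f ^ n p]; the axis is the ultralimit of these. *)
Lemma min_displacement_axis (f g : X -> X) (p : X) :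
  (forall p q, d (f p) (f q) = d p q) -> cancel f g -> cancel g f ->
  (forall q, d p (f p) <= d q (f q)) -> 0 < d p (f p) -> exists c, axis f c.
Proof.
move=> fi fK gK hp; set e := d p (f p) => e0.
have gi u v : d (g u) (g v) = d u v by rewrite -fi !gK.
have fgK n v : iter n f (iter n g v) = v.
  by elim: n v => [|n IH] v //; rewrite iterSr /= gK IH.
pose P n := iter n g p; pose Q n := iter n f p.
have PQ n m : d (P n) (Q m) = (n + m)%:R * e.
  by rewrite -(iter_isom n fi) /P fgK /Q -iterD min_displacement_iter.
have fP n : f (P n.+1) = P n by rewrite /P iterS gK.
have PP n : d (P n.+1) (P n) = e.
  by rewrite -(iter_isom n.+1 fi) /P [X in d X _]fgK iterS fgK.
(* The shift by [n%:R * e] puts [p] at parameter 0 for every [n]. *)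
pose L n t := pt (P n) (Q n) (t + n%:R * e).
have ran t : \forall n \near U, 0 <= t + n%:R * e <= d (P n) (Q n).
  apply: filterS (Uinfty (`|t| / e)) => n; rewrite ler_pdivrMr// => hn.
  rewrite PQ natrD; have := ler_norm t; have := ler_norm (- t);
    rewrite normrN; mlra.
have Ld s t : \forall n \near U, d (L n s) (L n t) = `|s - t|.
  apply: filterS2 (ran s) (ran t) => n hs ht.
  by rewrite /L (pt_dist cat0)//; congr `|_|; ring.
have L0 n : L n 0 = p.
  symmetry; rewrite /L add0r; have D0 : 0 <= n%:R * e by rewrite mulr_ge0// ltW.
  have E1 := PQ n 0%N; have E2 := PQ 0%N n; have E3 := PQ n n.
  rewrite addn0 in E1; rewrite add0n in E2; rewrite natrD in E3.
  apply: (pt_uniq cat0); rewrite ?E3//; first by mlra.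
  by rewrite -[p]/(P 0%N) E2; mlra.
have /choice[c hc] : forall t, exists l : X, L n t @[n --> U] --> l.
  move=> t; apply: (ulim_ex lcX hadX (p := p) (K := `|t|)).
  by apply: filterS (Ld 0 t) => n; rewrite L0 sub0r normrN => ->.
have fcont y l : y n @[n --> U] --> l -> f (y n) @[n --> U] --> f l.
  move=> /mcvgP h.
  apply/mcvgP => eps eps0.
  by apply: filterS (h eps eps0) => n; rewrite fi.
exists c; split; first by move=> s t _ _; exact: (ulim_eq (hc s) (hc t)).
exists e => // t.
apply: (@ulim_unique R X U UU (fun n => f (L n t))); first exact: fcont.
apply: cvg_trans (hc (t + e)); apply: near_eq_cvg.
apply: filterS3 (ran t) (ran (t + e)) (Uinfty 1) => n h1 h2 h3.
(* The translation is exact before the limit: [f] carries the geodesic from [P n.+1] to [Q n.+1] to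
   that from [P n] to [Q n.+2], and both contain the segment from [P n] to [Q n.+1]. *)
case: n h1 h2 h3 => [|n] h1 h2 h3; first by rewrite ler10 in h3.
pose s := t + n.+1%:R * e.
have E1 := PQ n n.+1; have E2 := PQ n.+1 n.+1.
rewrite natrD -natr1 in E1; rewrite natrD -natr1 in E2.
rewrite E2 in h1 h2; rewrite -natr1 in h1 h2.
have n0 : 0 <= n%:R * e by rewrite mulr_ge0 ?ler0n// ltW.
have Ps : P n = pt (P n.+1) (Q n.+1) e.
  by apply: (pt_uniq cat0); rewrite ?PP// ?E1 E2; mlra.
have hs : 0 <= s <= d (P n) (Q n.+1) by rewrite E1 /s -natr1; mlra.
have Fn : L n.+1 (t + e) = pt (P n) (Q n.+1) s.
  rewrite /L; have hz : 0 <= t + e + n.+1%:R * e <= d (P n.+1) (Q n.+1).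
    by rewrite E2 -natr1; mlra.
  have [z1 z2] := ptP cat0 hz.
  apply: (pt_uniq cat0) => //; last by rewrite z2 E1 E2 /s; mlra.
  rewrite {1}Ps (pt_dist cat0)//; last by rewrite E2; mlra.
  rewrite ler0_norm; rewrite /s -natr1; mlra.
rewrite Fn; symmetry.
have fQ : f (Q n.+1) = Q n.+2 by [].
have E3 : d (P n) (Q n.+2) = (n%:R + (n%:R + 1 + 1)) * e.
  by rewrite PQ natrD -!natr1.
have hz : 0 <= s <= d (P n) (Q n.+2) by rewrite E3 /s -natr1; mlra.
have Lf : f (L n.+1 t) = pt (P n) (Q n.+2) s.
  have hL : 0 <= s <= d (P n.+1) (Q n.+1) by rewrite E2 /s -natr1; mlra.
  have [z1 z2] := ptP cat0 hL.
  apply: (pt_uniq cat0) => //; first by rewrite -fP fi.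
  by rewrite -fQ fi z2 E3 E2; mlra.
have Qs : Q n.+1 = pt (P n) (Q n.+2) (d (P n) (Q n.+1)).
  have QQ : d (Q n.+1) (Q n.+2) = e.
    by rewrite /Q [iter n.+2 f p]iterSr iter_isom.
  by apply: (pt_uniq cat0); rewrite ?QQ ?E3 ?E1 //; mlra.
rewrite Lf Qs (pt_pt cat0)//; last by rewrite E3 E1; mlra.
Qed.

End Axes.

(** * Ping-pong and a criterion for rank one *)

Section RankOne.
Context {R : realType} {X : metricType R}.
Local Notation d := (@mdist R X).
Hypothesis lcX : locally_compact [set: X].
Hypothesis hadX : Hadamard X.
Context {U : set_system nat} {UU : UltraFilter U}.
Hypothesis Ufree : \oo `<=` U.

Let cat0 : CAT0 X := hadX.2.
Let Uinfty := @free_infty R U Ufree.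

Definition shadow (x a : X) (T e : R) : set X :=
  [set y | T < d x y /\ d (pt x y T) a < e].

(** One half of ping-pong. With [D = d x (f x)], the bound on [D] makes [D - 2 * r] at least 1, so
    the orbit escapes, and makes [D - r] exceed [8 * T], so directions change by at most [r / 4].
    Starting from [r / 2], a margin of [r / 4] is left for points near the orbit. *)
Lemma shadow_attracts (f g : X -> X) (x a b : X) (r T : R) :
  (forall p q, d (f p) (f q) = d p q) -> cancel g f -> 0 < r -> 0 < T ->
  (forall y z, shadow x b T r y -> shadow x a T r z ->
     exists2 l, 0 <= l <= 1 & d x (mix y z l) <= r) ->
  8 * T + 2 * r + 1 <= d x (f x) ->
  d (pt x (f x) T) a < r / 2 -> shadow x b T r (g x) ->
  (forall K, exists k0, forall k, (k0 <= k)%N -> K <= d x (iter k f x)) /\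
  (forall K, exists k0, forall k, (k0 <= k)%N -> forall q,
     d q (iter k f x) <= K -> shadow x a T r q).
Proof.
move=> fi gK r0 T0 bar; set D := d x (f x) => hD hfx hgx.
(* The geodesic from [g x] to [y] passes within [r] of [x], so its image, from [x] to [f y], passes
   within [r] of [f x]. *)
have step y : shadow x a T r y ->
    D - 2 * r + d x y <= d x (f y) /\ d (pt x (f y) T) a < 3 / 4 * r.
  move=> hy; have [l l01 hl] := bar _ _ hgx hy.
  set m := mix (g x) y l in hl.
  have fm : f m = mix x (f y) l by rewrite /m (mix_isom cat0 _ _ fi)// gK.
  have hfm : d (f x) (f m) <= r by rewrite fi.
  have [m1 m2] := mixP cat0 x (f y) l01; rewrite -fm in m1 m2.
  have T1 := metric_triangle x (f m) (f x);
    rewrite (metric_sym (f m) (f x)) in T1.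
  have T2 := metric_triangle x m y.
  have e1 : d m y = d (f m) (f y) by rewrite fi.
  have hDm : D - r <= d x (f m) by rewrite -/D in T1; mlra.
  split; first by rewrite -e1 in m2; mlra.
  have -> : pt x (f y) T = pt x (f m) T.
    by rewrite fm (pt_mix cat0)// -m1; mlra.
  have near1 := @pt_near R X cat0 x (f m) (f x) T (D - r) ltac:(mlra)
    ltac:(mlra) hDm ltac:(rewrite -/D; mlra).
  rewrite (metric_sym (f m) (f x)) in near1.
  have : 2 * T * d (f x) (f m) / (D - r) <= r / 4.
    rewrite ler_pdivrMr; last mlra.
    have : 2 * T * d (f x) (f m) <= 2 * T * r by rewrite ler_wpM2l//; mlra.
    clear_points; nra.
  have := metric_triangle (pt x (f m) T) (pt x (f x) T) a; mlra.
have orbit k : D + k%:R * (D - 2 * r) <= d x (iter k.+1 f x) /\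
    d (pt x (iter k.+1 f x) T) a < 3 / 4 * r.
  elim: k => [|k [IH1 IH2]]; first by rewrite mul0r addr0 /= -/D; mlra.
  have k0 : 0 <= k%:R * (D - 2 * r) by rewrite mulr_ge0 ?ler0n//; mlra.
  have [h1 h2] := step (iter k.+1 f x) ltac:(split; mlra).
  rewrite [iter k.+2 f x]iterS; split => //.
  by rewrite -natr1; mlra.
have growth K : exists k0, forall k, (k0 <= k)%N -> K <= d x (iter k f x).
  exists (Num.truncn `|K|).+1 => -[//|k]; rewrite ltnS => hk.
  have [h _] := orbit k; apply: le_trans h.
  have h1 : `|K| < (Num.truncn `|K|).+1%:R by rewrite truncnS_gt.
  have h2 : (Num.truncn `|K|).+1%:R <= k.+1%:R :> R by rewrite ler_nat ltnS.
  rewrite -natr1 in h2; have := ler_norm K.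
  have : k%:R <= k%:R * (D - 2 * r) by rewrite ler_peMr ?ler0n//; mlra.
  by mlra.
(* [M] exceeds [T] and makes [2 * T * K / M] at most [r / 4]. *)
split => // K; pose M := T + 1 + 8 * T * `|K| / r.
have M1 : T + 1 <= M by rewrite /M lerDl divr_ge0 ?mulr_ge0//; mlra.
have Mr : M * r = (T + 1) * r + 8 * T * `|K|
  by rewrite /M mulrDl divfK// gt_eqF.
have [k0 hk0] := growth (M + `|K|).
exists k0.+1 => -[//|k]; rewrite ltnS => hk q hq.
have h1 := hk0 k.+1 (leqW hk).
have [_ h2] := orbit k.
have T1 := metric_triangle x q (iter k.+1 f x).
have K1 := ler_norm K.
have Mq : M <= d x q by mlra.
split; first by mlra.
have Mk : M <= d x (iter k.+1 f x) by have := normr_ge0 K; mlra.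
have near1 := @pt_near R X cat0 x q (iter k.+1 f x) T M ltac:(mlra) ltac:(mlra)
  Mq Mk.
have : 2 * T * d q (iter k.+1 f x) / M <= r / 4.
  rewrite ler_pdivrMr; last mlra.
  have : 2 * T * d q (iter k.+1 f x) <= 2 * T * `|K| by rewrite ler_wpM2l//;
    mlra.
  clear_points; nra.
have := metric_triangle (pt x q T) (pt x (iter k.+1 f x) T) a; mlra.
Qed.

(** The hypothesis confines a minimising sequence to a ball, so it converges along [U]. *)
Lemma min_displacement_ex (f : X -> X) (x : X) (r : R) :
  (forall p q, d (f p) (f q) = d p q) ->
  (forall p, exists2 m, d x m <= r & d m (f m) <= d p (f p)) ->
  exists p, forall q, d p (f p) <= d q (f q).
Proof.
move=> fi hm; pose A := [set d p (f p) | p in [set: X]].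
have hA : has_inf A.
  split; first by exists (d x (f x)), x.
  by exists 0 => _ [p _ <-]; exact: mdist_ge0.
have /choice[m hmn] : forall n : nat, exists m,
    d x m <= r /\ d m (f m) <= inf A + n.+1%:R^-1.
  move=> n; have n0 : 0 < n.+1%:R^-1 :> R by rewrite invr_gt0 ltr0n.
  have [_ [p _ <-] hp] := inf_adherent n0 hA.
  by have [m h1 h2] := hm p; exists m; split => //; exact: le_trans h2 (ltW hp).
have [p hp] : exists l : X, m n @[n --> U] --> l.
  by apply: (ulim_ex lcX hadX (p := x) (K := r)); apply: nearW => n;
    have [] := hmn n.
have fcont : f (m n) @[n --> U] --> f p.
  move: hp => /mcvgP h.
  apply/mcvgP => eps eps0.
  by apply: filterS (h eps eps0) => n; rewrite fi.
exists p => q.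
apply: (@le_trans _ _ (inf A)); last by apply: ge_inf; [exact: hA.2|exists q].
apply/ler_addgt0Pl => e e0.
apply: (ulim_le hp fcont (cvg_cst (e + inf A))).
apply: filterS (Uinfty e^-1) => n hn; have [_ h] := hmn n.
apply: (le_trans h); rewrite addrC lerD2r.
rewrite -[e]invrK lef_pV2 ?posrE ?invr_gt0 ?ltr0n//.
by apply: (le_trans hn); rewrite ler_nat.
Qed.

Lemma rank_one_of_barrier (f g : X -> X) (x a b : X) (r T : R) :
  Defs.isometry f -> cancel f g -> cancel g f -> 0 < r -> 0 < T ->
  (forall y z, shadow x b T r y -> shadow x a T r z ->
     exists2 l, 0 <= l <= 1 & d x (mix y z l) <= r) ->
  8 * T + 2 * r + 1 <= d x (f x) ->
  d (pt x (f x) T) a < r / 2 -> d (pt x (g x) T) b < r / 2 -> rank_one f.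
Proof.
move=> fiso fK gK r0 T0 bar hD hfx hgx.
have fi p q : d (f p) (f q) = d p q by exact: fiso.2.
have gi p q : d (g p) (g q) = d p q by rewrite -fi !gK.
have Dg : d x (g x) = d x (f x) by rewrite -fi gK metric_sym.
have bar' y z : shadow x a T r y -> shadow x b T r z ->
    exists2 l, 0 <= l <= 1 & d x (mix y z l) <= r.
  move=> hy hz; have [l l01 hl] := bar z y hz hy.
  by exists (1 - l); [mlra|rewrite -(mixC cat0)].
have [fgrow fatt] := shadow_attracts fi gK r0 T0 bar hD hfx
  ltac:(split; [rewrite Dg; mlra|mlra]).
have [_ gatt] := shadow_attracts gi fK r0 T0 bar' ltac:(rewrite Dg;
  exact: hD) hgx
  ltac:(split; mlra).
have fgi n v : d (iter n f v) (iter n f x) = d v x by exact: iter_isom.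
have ggi n v : d (iter n g v) (iter n g x) = d v x by exact: iter_isom.
(* For large [k] the geodesic from the [k]-th iterate of [g] at [p] to that of [f] meets the ball.
   Both ends are displaced as much as [p], and the displacement is convex. *)
have near_x p : exists2 m, d x m <= r & d m (f m) <= d p (f p).
  have [k1 h1] := fatt (d p x); have [k2 h2] := gatt (d p x).
  pose k := maxn k1 k2.
  have [l l01 hl] := bar (iter k g p) (iter k f p)
    (h2 k (leq_maxr _ _) _ (eq_leW (ggi k p))) (h1 k (leq_maxl _ _) _ (eq_leW
      (fgi k p))).
  exists (mix (iter k g p) (iter k f p) l) => //.
  rewrite (mix_isom cat0 _ _ fi)//.
  apply: le_trans (mix_convex cat0 _ _ _ _ l01) _.
  have e1 : d (iter k f p) (f (iter k f p)) = d p (f p).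
    by rewrite -iterS iterSr iter_isom.
  have e2 : d (iter k g p) (f (iter k g p)) = d p (f p).
    rewrite -[RHS](iter_isom k gi); congr (d _ _).
    by elim: (k) => // j IH; rewrite iterS gK iterS -IH fK.
  by rewrite e1 e2; mlra.
have [p hp] := min_displacement_ex fi near_x.
(* A fixed point would keep the orbit of [x] bounded, against [fgrow]. *)
have p0 : 0 < d p (f p).
  rewrite lt_neqAle mdist_ge0 andbT; apply/eqP => h.
  have fp : f p = p by apply/esym/mdist_positivity.
  have fkp k : iter k f p = p by elim: k => //= k ->.
  have [k hk] := fgrow (2 * d p x + 1).
  have := hk k (leqnn k); have := fgi k p; rewrite fkp.
  have := metric_triangle x p (iter k f x); rewrite (metric_sym x p); mlra.
split; first by split => //; exact: (min_displacement_axis lcX hadX Ufree fi fK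
  gK hp p0).
move=> c [cg [l l0 cl]] /(half_plane_along cg)[F [Fi Fc]].
have ck k : c (k%:R * l) = iter k f (c 0).
  elim: k => [|k IH]; first by rewrite mul0r.
  by rewrite iterS -IH cl -natr1 mulrDl mul1r.
have ck' k : c (- (k%:R * l)) = iter k g (c 0).
  elim: k => [|k IH]; first by rewrite mul0r oppr0.
  rewrite iterS -IH -[LHS]fK cl -natr1; congr (g (c _)); ring.
(* The parallel at height [h] stays at distance [h] from the axis, so its far points lie in both
   shadows and the barrier forces it through the ball. *)
have key h : 0 <= h -> exists u, d x (F (u, h)) <= r.
  move=> h0; have Fl : geodesic_on d setT (fun t => F (t, h)).
    move=> s t _ _; rewrite Fi//; apply: eucl_dist_eq => //=.
    by rewrite subrr real_normK ?num_real//; ring.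
  have Fh t : d (F (t, h)) (c t) = h.
    rewrite -Fc Fi//=; apply: eucl_dist_eq => //=; ring.
  have [k1 h1] := fatt (h + d (c 0) x); have [k2 h2] := gatt (h + d (c 0) x).
  pose k := maxn k1 k2.
  have s1 : shadow x a T r (F (k%:R * l, h)).
    apply: (h1 k (leq_maxl _ _)); apply: le_trans (metric_triangle _ (c (k%:R *
      l)) _) _.
    by rewrite Fh ck fgi.
  have s2 : shadow x b T r (F (- (k%:R * l), h)).
    apply: (h2 k (leq_maxr _ _)); apply: le_trans (metric_triangle _ (c (-
      (k%:R * l))) _) _.
    by rewrite Fh ck' ggi.
  have [j j01 hj] := bar _ _ s2 s1.
  by rewrite -(line_mix cat0 _ _ Fl j01) in hj; eexists; exact: hj.
have [u hu] := key 0 (lexx 0).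
have h0 : 0 <= 2 * r + 1 by mlra.
have [v hv] := key (2 * r + 1) h0.
have h1 : d (F (u, 0)) (F (v, 2 * r + 1)) <= 2 * r.
  have := metric_triangle (F (u, 0)) x (F (v, 2 * r + 1)).
  by rewrite (metric_sym _ x); mlra.
rewrite Fi//= in h1.
have := le_sqr (eucl_dist_ge0 _ _) h1; rewrite eucl_dist_sqr/=.
have := sqr_ge0 (u - v); mnra.
Qed.

Lemma rank_one_of_line (f g : nat -> X ->
    X) (p : X) (xi eta : boundary X) (c : R -> X) :
  (forall n, Defs.isometry (f n)) -> (forall n, cancel (f n) (g n)) ->
  (forall n, cancel (g n) (f n)) ->
  tends (U := U) (f^~ p) xi -> tends (U := U) (g^~ p) eta ->
  geodesic_on d setT c -> rays_to xi c -> rays_to eta (fun t => c (- t)) ->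
  ~ bounds_flat_half_plane c -> exists n, rank_one (f n).
Proof.
move=> fiso fK gK tf tg cg xc ec nh.
have [r [T [r0 T0 bar]]] := barrier lcX hadX Ufree cg nh.
have fi n u v : d (f n u) (f n v) = d u v by exact: (fiso n).2.
have gi n u v : d (g n u) (g n v) = d u v by rewrite -(fi n) !gK.
have tf' : tends (U := U) (f^~ (c 0)) xi.
  by apply: (tends_close lcX hadX (K := d p (c 0)) tf); apply: nearW => n /=;
    rewrite fi.
have tg' : tends (U := U) (g^~ (c 0)) eta.
  by apply: (tends_close lcX hadX (K := d p (c 0)) tg); apply: nearW => n /=;
    rewrite gi.
have [_ _ dv hf] := tends_ray lcX hadX tf' xc.
have [_ _ _ hg] := tends_ray lcX hadX tg' ec; rewrite oppr0 in hg.
have r2 : 0 < r / 2 by mlra.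
have /mcvgP/(_ _ r2) nf := hf T (ltW T0).
have /mcvgP/(_ _ r2) ng := hg T (ltW T0).
have [n [[n1 n2] n3]] := filter_ex (filterI (filterI nf ng) (dv (8 * T + 2 * r
  + 1))).
exists n; apply: (@rank_one_of_barrier _ (g n) (c 0) (c T) (c (- T)) r T) => //.
- by move=> y z [h1 h2] [h3 h4]; exact: bar.
- by rewrite metric_sym.
- by rewrite metric_sym.
Qed.

End RankOne.

(** * Limit sets *)

Section LimitSet.
Context {R : realType} {X : metricType R}.
Local Notation d := (@mdist R X).
Hypothesis lcX : locally_compact [set: X].
Hypothesis hadX : Hadamard X.
Context {U : set_system nat} {UU : UltraFilter U}.
Hypothesis Ufree : \oo `<=` U.
Variable G : set (X -> X).
Hypothesis groupG : isometry_group G.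
Hypothesis no_rank_one : forall g, G g -> ~ rank_one g.

Let cat0 : CAT0 X := hadX.2.

Let G_isom (g : X -> X) : G g -> forall p q, d (g p) (g q) = d p q.
Proof. by case: groupG => h _ _ _ /h[_ gi] p q; exact: gi. Qed.

Definition limit_pair (xi eta : boundary X) : Prop :=
  exists (p : X) (f g : nat -> X -> X), [/\ forall n, G (f n) /\ G (g n),
    forall n, cancel (f n) (g n), forall n, cancel (g n) (f n),
    tends (U := U) (f^~ p) xi & tends (U := U) (g^~ p) eta].

Lemma limit_pair_sym (xi eta : boundary X) : limit_pair xi eta ->
    limit_pair eta xi.
Proof.
by move=> [p [f [g [fG fK gK tf tg]]]]; exists p, g, f; split => // n;
  have [] := fG n.
Qed.

Lemma limit_pair_base (q : X) (xi eta : boundary X) : limit_pair xi eta ->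
  exists (f g : nat -> X -> X), [/\ forall n, G (f n) /\ G (g n),
    forall n, cancel (f n) (g n), forall n, cancel (g n) (f n),
    tends (U := U) (f^~ q) xi & tends (U := U) (g^~ q) eta].
Proof.
move=> [p [f [g [fG fK gK tf tg]]]]; exists f, g; split => //.
- apply: (tends_close lcX hadX (K := d p q) tf); apply: nearW => n /=.
  by rewrite G_isom//; have [] := fG n.
- apply: (tends_close lcX hadX (K := d p q) tg); apply: nearW => n /=.
  by rewrite G_isom//; have [] := fG n.
Qed.

(** The inverses diverge since [d x (g n x) = d (f n x) x]; their limit along [U] is the partner. *)
Lemma limit_pair_ex (xi : boundary X) : limit_set G xi ->
    exists eta, limit_pair xi eta.
Proof.
move=> /(limit_set_tends hadX Ufree)[x [f fG tf]].
case: groupG => Gi _ _ Ginv.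
have /choice[g hg] : forall n, exists g, cancel (f n) g /\ cancel g (f n).
  by move=> n; have [[g fK gK] _] := Gi _ (fG n); exists g.
have dv : diverges (U := U) x (g^~ x).
  have [rho [_ _ dv _] _] := tends_base lcX hadX x tf.
  move=> K; apply: filterS (dv K) => n; rewrite -(G_isom (fG n) x (g n x)).
  by rewrite (hg n).2 metric_sym.
have [eta te] := tends_ex lcX hadX dv.
exists eta, x, f, g; split => // n; last 2 first.
- by have [] := hg n.
- by have [] := hg n.
by split => //; have [h1 h2] := hg n; exact: Ginv (fG n) h1 h2.
Qed.

Lemma limit_pair_conn (xi eta : boundary X) : limit_pair xi eta ->
    tits_conn eta xi pi.
Proof.
move=> [p [f [g [fG fK gK tf tg]]]].
have [//|[c [cg xc ec nh]]] := conn_or_line lcX hadX Ufree eta xi.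
have fi n : Defs.isometry (f n) by case: groupG => h _ _ _; apply: h;
  case: (fG n).
have [n hn] := rank_one_of_line lcX hadX Ufree fi fK gK tf tg cg xc ec nh.
by case: (no_rank_one (fG n).1 hn).
Qed.

(* The geodesics from [f n^-1 x] to [h n x] pass near [x] when a line without
   flat half plane joins their limits, so [f n (h n x)] and [f n x] have the
   same limit, as well as [h n^-1 (f n^-1 x)] and [h n^-1 x]. *)
Lemma limit_pair_compose (xi xi' eta eta' : boundary X) (c : R -> X) :
  limit_pair xi xi' -> limit_pair eta eta' ->
  geodesic_on d setT c -> rays_to eta c -> rays_to xi' (fun t => c (- t)) ->
  ~ bounds_flat_half_plane c -> limit_pair xi eta'.
Proof.
move=> /(limit_pair_base (c 0))[f [f' [fG fK fK' tf tf']]].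
move=> /(limit_pair_base (c 0))[h [h' [hG hK hK' th th']]] cg ec xc nh.
have [r [T [r0 T0 bar]]] := barrier lcX hadX Ufree cg nh.
have [_ _ dv hh] := tends_ray lcX hadX th ec.
have [_ _ dv' hf] := tends_ray lcX hadX tf' xc; rewrite oppr0 in dv' hf.
have near0 : \forall n \near U, exists2 l, 0 <= l <= 1 &
    d (c 0) (mix (f' n (c 0)) (h n (c 0)) l) <= r.
  have /mcvgP/(_ _ r0) n1 := hh T (ltW T0).
  have /mcvgP/(_ _ r0) n2 := hf T (ltW T0).
  apply: filterS3 (filterI n1 n2) (dv (T + 1)) (dv' (T + 1)) => n [h1 h2] h3 h4.
  by apply: bar; rewrite ?(metric_sym _ (c _))//; mlra.
have fi n p q : d (f n p) (f n q) = d p q by apply: G_isom; case: (fG n).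
have hi' n p q : d (h' n p) (h' n q) = d p q by apply: G_isom; case: (hG n).
have /choice[l hl] : forall n, exists l, (exists2 l, 0 <= l <= 1 &
    d (c 0) (mix (f' n (c 0)) (h n (c 0)) l) <= r) ->
    0 <= l <= 1 /\ d (c 0) (mix (f' n (c 0)) (h n (c 0)) l) <= r.
  move=> n; have [[l l01 hl]|?] := pselect (exists2 l, 0 <= l <= 1 &
    d (c 0) (mix (f' n (c 0)) (h n (c 0)) l) <= r); first by exists l.
  by exists 0.
case: groupG => _ _ Gcomp _.
exists (c 0), (fun n => f n \o h n), (fun n => h' n \o f' n); split.
- move=> n; have [? ?] := fG n; have [? ?] := hG n.
  by split; exact: Gcomp.
- by move=> n p /=; rewrite fK hK.
- by move=> n p /=; rewrite hK' fK'.
- apply: (tends_through lcX hadX (p := c 0)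
    (w := fun n => f n (mix (f' n (c 0)) (h n (c 0)) (l n))) (K := r) tf).
  apply: filterS near0 => n /hl[l01 hln]; rewrite fi; split => //.
  by exists (l n) => //=; rewrite (mix_isom cat0 _ _ (fi n))// fK'.
- apply: (tends_through lcX hadX (p := c 0)
    (w := fun n => h' n (mix (f' n (c 0)) (h n (c 0)) (l n))) (K := r) th').
  apply: filterS near0 => n /hl[l01 hln]; rewrite hi'; split => //.
  exists (1 - l n); first by mlra.
  rewrite (mix_isom cat0 _ _ (hi' n))// hK /=.
  by rewrite (mixC cat0)//.
Qed.

(** The dichotomy is applied to [xi'] and [eta]. Either the path goes through [xi'], or the line
    makes [xi] and [eta'] a limit pair and the path goes through [eta']; paths are reversed by
    reversing limit pairs. *)
Lemma limit_set_conn (xi eta : boundary X) : limit_set G xi ->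
    limit_set G eta ->
  tits_conn xi eta (pi + pi).
Proof.
move=> /limit_pair_ex[xi' px] /limit_pair_ex[eta' pe]; have pi0 := @pi_ge0 R.
have [h|[c [cg ec xc nh]]] := conn_or_line lcX hadX Ufree xi' eta.
  apply: (tits_conn_trans lcX hadX Ufree (zeta := xi')) => //.
  exact/limit_pair_conn/limit_pair_sym.
apply: (tits_conn_trans lcX hadX Ufree (zeta := eta')) => //.
  exact/limit_pair_conn/limit_pair_sym/(limit_pair_compose px pe cg ec xc nh).
exact: limit_pair_conn.
Qed.

End LimitSet.

Theorem corollary2p19 (R : realType) (X : metricType R) (G : set (X -> X)) :
  locally_compact [set: X] ->
  Hadamard X ->
  isometry_group G ->
  (forall g, G g -> ~ rank_one g) ->
  (tits_diameter (limit_set G) <= (2 * pi)%:E)%E.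
Proof.
move=> lcX hadX groupG noG; apply: ge_ereal_sup => _ [[xi eta] [/= hx he] <-].
(* An ultrafilter that refines the filter of cofinite sets is free. *)
have [U [UU Ufree]] := @ultraFilterLemma nat \oo _.
have -> : 2 * pi = pi + pi :> R by ring.
apply: (tits_conn_dist lcX hadX Ufree); first by rewrite addr_ge0 ?pi_ge0.
exact: (limit_set_conn lcX hadX Ufree groupG noG hx he).
Qed.
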